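(* Consider the $K$-user MISO broadcast channel with a random time-varying, symmetric jammer described in the context, and let $\eta_j$ ($j=0,1,\dots,K$) be the probability that exactly $j$ receivers are jammed at a given time. For the CSIT-JSIT configuration $\mathsf{DD}$ (delayed CSIT, delayed JSIT), the sum degrees of freedom $$\left(\sum_{j=0}^{K}\frac{K-j}{K}\,\eta_j\right)\frac{K}{1+\frac12+\cdots+\frac1K}$$ is achievable, i.e. the degrees-of-freedom region contains a tuple $(d_1,\dots,d_K)$ with $\sum_{k=1}^K d_k$ equal to this value.
   Context: **Channel.** A transmitter with $K$ antennas sends independent, uniformly distributed messages $W_1,\dots,W_K$ to $K$ single-antenna receivers. At time $t=1,2,\dots$ receiver $k\in\{1,\dots,K\}$ observes $$Y_k(t)=\mathbf H_k(t)\mathbf X(t)+S_k(t)\,\mathbf G_k(t)\mathbf J(t)+N_k(t),$$ where $\mathbf X(t)\in\mathbb C^{K}$ is the channel input, subject to $E|\mathbf X(t)|^2\le P_T$; $\mathbf H_k(t)\in\mathbb C^{1\times K}$ is the channel from transmitter to receiver $k$; $\mathbf G_k(t)\in\mathbb C^{1\times K}$ is the channel from the jammer to receiver $k$; $\mathbf J(t)\in\mathbb C^K$ is the jammer's signal, of power $P_T$ (its distribution is otherwise arbitrary); $N_k(t)\sim\mathcal{CN}(0,1)$ is noise, i.i.d. over time and independent across receivers. The vectors $\mathbf H_k(t)$, $\mathbf G_k(t)$ have continuous distributions (i.e. with a density) with identity covariance, not depending on $P_T$, are i.i.d. over time and independent across $k$. The noise, the messages, $\mathbf H$, and the triple $(S,\mathbf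 J,\mathbf G)$ are mutually independent; arbitrary correlations among $S,\mathbf J,\mathbf G$ are allowed. **Jammer state.** $S(t)=(S_1(t),\dots,S_K(t))\in\{0,1\}^K$ is i.i.d. over time, with distribution $\lambda_{\mathbf s}=\Pr(S(t)=\mathbf s)$ not depending on $P_T$; $S_k(t)=1$ means receiver $k$ is jammed at time $t$ and $S_k(t)=0$ means it is not. The jammer is symmetric: $\lambda_{\mathbf s}=\lambda_{\pi(\mathbf s)}$ for every $\mathbf s\in\{0,1\}^K$ and every permutation $\pi$ of its coordinates. $\eta_j=\Pr(\|S(t)\|_1=j)$, where $\|\mathbf s\|_1$ is the number of ones in $\mathbf s$. **Information at the terminals.** Write $\mathbf H(t)=(\mathbf H_1(t),\dots,\mathbf H_K(t))$, $\mathbf H^{t}=(\mathbf H(1),\dots,\mathbf H(t))$, $S^{t}=(S(1),\dots,S(t))$. All receivers know $\mathbf H^n$ and $S^n$ (for the whole block of length $n$). Nobody knows $\mathbf G$. The transmitter always knows the statistics of $S(t)$. In configuration $\mathsf{DD}$, $\mathbf X(t)$ is a function of $(W_1,\dots,W_K,\mathbf H^{t-1},S^{t-1})$. **DoF region.** For fixed $P_T$, a rate tuple $(R_1,\dots,R_K)$, $R_k=\frac1n\log|W_k|$ ($|W_k|$ the number of values of message $W_k$), is achievable if there are encoders (respecting the configuration and the power constraint) and decoders $g_k^{(n)}(Y_k^n,\mathbf H^n,S^n)$ whose error probabilities $\Pr(W_k\ne g_k^{(n)})$ tend to $0$ as $n\to\infty$ for all $k$. The degrees-of-freedom region is the set of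 all $(d_1,\dots,d_K)$ with $d_k=\lim_{P_T\to\infty}\frac{R_k}{\log P_T}$ for achievable rate tuples $(R_1(P_T),\dots,R_K(P_T))$. *)

(* Defs.v *)
From HB Require Import structures.
From mathcomp Require Import all_boot all_order all_algebra all_fingroup.
From mathcomp Require Import complex.
From mathcomp Require Import all_classical all_reals all_analysis.

Set Implicit Arguments.
Unset Strict Implicit.
Unset Printing Implicit Defensive.

Import Order.TTheory GRing.Theory Num.Theory.
Import numFieldNormedType.Exports.

Local Open Scope classical_set_scope.
Local Open Scope ring_scope.

Definition complex_measure_display : measure_display -> measure_display.
Proof. exact. Qed.

Section measurable_complex.
Context {R : realType}.

HB.instance Definition _ := isPointed.Build R[i] 0.

(* Borel sets of C, C being identified with R^2. *)
Let borelC : set (set R[i]) :=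
  g_sigma_preimageU (@complex.Re R) (@complex.Im R).

Let borelC0 : borelC set0. Proof. exact: sigma_algebra0. Qed.

Let borelCC A : borelC A -> borelC (~` A). Proof. exact: sigma_algebraC. Qed.

Let borelC_bigcup (F : (set R[i])^nat) :
  (forall i, borelC (F i)) -> borelC (\bigcup_i F i).
Proof. exact: sigma_algebra_bigcup. Qed.

HB.instance Definition _ :=
  @isMeasurable.Build (complex_measure_display default_measure_display)
    R[i] borelC borelC0 borelCC borelC_bigcup.

End measurable_complex.

Definition matrix_measure_display : measure_display -> measure_display.
Proof. exact. Qed.

Section measurable_matrix.
Context {d} {T : measurableType d} (m n : nat).

Let sigmaM : set (set 'M[T]_(m, n)) :=
  <<s \bigcup_ij preimage_set_system setT
        (fun A : 'M[T]_(m, n) => A ij.1 ij.2) measurable >>.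

Let sigmaM0 : sigmaM set0. Proof. exact: sigma_algebra0. Qed.

Let sigmaMC A : sigmaM A -> sigmaM (~` A). Proof. exact: sigma_algebraC. Qed.

Let sigmaM_bigcup (F : (set 'M[T]_(m, n))^nat) :
  (forall i, sigmaM (F i)) -> sigmaM (\bigcup_i F i).
Proof. exact: sigma_algebra_bigcup. Qed.

HB.instance Definition _ :=
  @isMeasurable.Build (matrix_measure_display d)
    'M[T]_(m, n) sigmaM sigmaM0 sigmaMC sigmaM_bigcup.

End measurable_matrix.

Section probability_notions.
Context {d} {T : measurableType d} {R : realType} (P : probability T R).

Definition mutually_independent (I : choiceType) d' (E : measurableType d')
    (X : I -> T -> E) :=
  forall (s : seq I) (A : I -> set E), uniq s ->
    (forall i, measurable (A i)) ->
    P (\bigcap_(i in [set` s]) X i @^-1` A i) =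
    (\prod_(i <- s) P (X i @^-1` A i))%E.

Definition block (E : Type) (X : nat -> T -> E) n (w : T) : n.-tuple E :=
  [tuple X i w | i < n].

(* Processes are independent when all their finite blocks are; taking some of
   the events to be the full space gives pairwise independence as well. *)
Definition independent_processes3 d1 d2 d3 (E1 : measurableType d1)
    (E2 : measurableType d2) (E3 : measurableType d3)
    (X : nat -> T -> E1) (Y : nat -> T -> E2) (Z : nat -> T -> E3) :=
  forall n (A : set (n.-tuple E1)) (B : set (n.-tuple E2))
      (C : set (n.-tuple E3)),
    measurable A -> measurable B -> measurable C ->
    P (block X n @^-1` A `&` block Y n @^-1` B
         `&` block Z n @^-1` C) =
    (P (block X n @^-1` A) * P (block Y n @^-1` B)
       * P (block Z n @^-1` C))%E.

Definition cexpectation (Z : T -> R[i]) : R[i] :=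
  Complex (fine 'E_P[fun w => complex.Re (Z w)])
          (fine 'E_P[fun w => complex.Im (Z w)]).

Definition sqmodc (z : R[i]) : R := complex.Re z ^+ 2 + complex.Im z ^+ 2.

Definition sqnorm m n (A : 'M[R[i]]_(m, n)) : R :=
  \sum_(i < m) \sum_(j < n) sqmodc (A i j).

(* Finite second moments, and E[(X_i - EX_i) conj(X_j - EX_j)] = (i == j). *)
Definition identity_covariance n (X : T -> 'rV[R[i]]_n) :=
  P.-integrable setT (fun w => (sqnorm (X w))%:E) /\
  let mean i := cexpectation (fun w => X w 0 i) in
  forall i j, cexpectation (fun w =>
    (X w 0 i - mean i) * (X w 0 j - mean j)^*%C) = (i == j)%:R.

(* CN(0,1): real and imaginary parts independent, each of variance 1/2
   (normal_prob takes a standard deviation). *)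
Definition std_complex_gaussian (Z : T -> R[i]) :=
  let gauss := normal_prob 0 (Num.sqrt (2^-1 : R)) in
  forall A B : set R, measurable A -> measurable B ->
    P [set w | A (complex.Re (Z w)) /\ B (complex.Im (Z w))] =
    (gauss A * gauss B)%E.

End probability_notions.

(* Integration of a nonnegative Borel function over C^n = R^(2n) with respect
   to Lebesgue measure, as an iterated integral (Tonelli). *)
Fixpoint integralCn (R : realType) (n : nat) :
    ('rV[R[i]]_n -> \bar R) -> \bar R :=
  match n return ('rV[R[i]]_n -> \bar R) -> \bar R with
  | 0 => fun f => f 0
  | m.+1 => fun f =>
      (\int[lebesgue_measure]_x \int[lebesgue_measure]_y
         integralCn (fun v : 'rV[R[i]]_m =>
           f (row_mx (Complex x y)%:M v : 'rV[R[i]]_(1 + m))))%E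
  end.

Definition has_density d (T : measurableType d) (R : realType)
    (P : probability T R) n (X : T -> 'rV[R[i]]_n) (f : 'rV[R[i]]_n -> R) :=
  [/\ (forall v, 0 <= f v), measurable_fun setT f &
      forall A : set 'rV[R[i]]_n, measurable A ->
        P (X @^-1` A) = integralCn (fun v => (f v * \1_A v)%:E)].

(* Everything random in the channel except the messages. Row k of chH t (resp.
   chG t) is the channel from the transmitter (resp. the jammer) to receiver k
   at time t; tnth (chS t) k tells whether receiver k is jammed, and entry k of
   chN t is the noise of receiver k. Times are numbered from 0. *)
Record channel (R : realType) (K : nat) := Channel {
  ch_disp : measure_display;
  ch_space : measurableType ch_disp;
  ch_prob : probability ch_space R;
  chH : nat -> {mfun ch_space >-> 'M[R[i]]_K};
  chG : nat -> {mfun ch_space >-> 'M[R[i]]_K};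
  chS : nat -> {mfun ch_space >-> K.-tuple bool};
  chJ : nat -> {mfun ch_space >-> 'cV[R[i]]_K};
  chN : nat -> {mfun ch_space >-> 'cV[R[i]]_K} }.

(* A K-user MISO broadcast channel whose jammer has power PT. The parameters
   lam, fH, fG fix the laws of S, H and G, so that requiring this with the same
   lam, fH, fG for all PT expresses that these laws do not depend on PT. The
   joint law of (S, J, G) is otherwise unconstrained. *)
Record jammed_miso_bc (R : realType) (K : nat) (lam : K.-tuple bool -> R)
    (fH fG : 'I_K -> 'rV[R[i]]_K -> R) (PT : R) (c : channel R K) : Prop := {
  H_density : forall t k,
    has_density (ch_prob c) (fun w => row k (chH c t w)) (fH k);
  H_cov : forall t k,
    identity_covariance (ch_prob c) (fun w => row k (chH c t w));
  H_indep : mutually_independent (ch_prob c)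
    (fun (tk : nat * 'I_K) w => row tk.2 (chH c tk.1 w));
  G_density : forall t k,
    has_density (ch_prob c) (fun w => row k (chG c t w)) (fG k);
  G_cov : forall t k,
    identity_covariance (ch_prob c) (fun w => row k (chG c t w));
  G_indep : mutually_independent (ch_prob c)
    (fun (tk : nat * 'I_K) w => row tk.2 (chG c tk.1 w));
  N_law : forall t k,
    std_complex_gaussian (ch_prob c) (fun w => chN c t w k 0);
  N_indep : mutually_independent (ch_prob c)
    (fun (tk : nat * 'I_K) w => chN c tk.1 w tk.2 0);
  S_law : forall t s, ch_prob c (chS c t @^-1` [set s]) = (lam s)%:E;
  S_indep : mutually_independent (ch_prob c) (fun t w => chS c t w);
  J_power : forall t,
    (\int[ch_prob c]_w (sqnorm (chJ c t w))%:E)%E = PT%:E;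
  NHSJG_indep : independent_processes3 (ch_prob c)
    (fun t w => chN c t w) (fun t w => chH c t w)
    (fun t w => (chS c t w, chJ c t w, chG c t w)) }.

Definition symmetric_jammer (R : realType) (K : nat)
    (lam : K.-tuple bool -> R) :=
  forall (pi : 'S_K) (s : K.-tuple bool),
    lam [tuple tnth s (pi i) | i < K] = lam s.

Definition messages (K : nat) (M : 'I_K -> nat) :=
  {dffun forall k : 'I_K, 'I_(M k)}.

(* Block code of length n with delayed CSIT and delayed JSIT: the input at time
   t is a function of the messages and of the t past values of (H, S). *)
Record DD_code (R : realType) (K n : nat) := DDCode {
  msize : 'I_K -> nat;
  msize_gt0 : forall k, (0 < msize k)%N;
  enc : forall t : 'I_n, messages msize ->
    t.-tuple ('M[R[i]]_K * K.-tuple bool) -> 'cV[R[i]]_K;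
  dec : forall k : 'I_K,
    n.-tuple R[i] * n.-tuple 'M[R[i]]_K * n.-tuple (K.-tuple bool) ->
    'I_(msize k);
  enc_measurable : forall t W, measurable_fun setT (@enc t W);
  dec_measurable : forall k j, measurable (dec k @^-1` [set j]) }.

Section coded_transmission.
Context {R : realType} {K n : nat} (c : channel R K) (C : DD_code R K n).

Definition input (W : messages (msize C)) (t : 'I_n) (w : ch_space c) :
    'cV[R[i]]_K :=
  enc W (block (fun s w => (chH c s w, chS c s w)) t w).

Definition output (k : 'I_K) (W : messages (msize C)) (t : 'I_n)
    (w : ch_space c) : R[i] :=
  (chH c t w *m input W t w) k 0
  + (tnth (chS c t w) k)%:R * (chG c t w *m chJ c t w) k 0
  + chN c t w k 0.

Definition decoded (k : 'I_K) (W : messages (msize C)) (w : ch_space c) :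
    'I_(msize C k) :=
  dec C k ([tuple output k W t w | t < n],
         block (fun t w => chH c t w) n w, block (fun t w => chS c t w) n w).

(* The messages are independent of each other and of the channel, and uniform:
   expectation over them is the average over all message tuples. *)
Definition message_mean (F : messages (msize C) -> \bar R) : \bar R :=
  ((#|{: messages (msize C)}|%:R^-1)%:E * \sum_W F W)%E.

Definition input_power (t : 'I_n) : \bar R :=
  message_mean (fun W => \int[ch_prob c]_w (sqnorm (input W t w))%:E)%E.

Definition error_prob (k : 'I_K) : \bar R :=
  message_mean (fun W => ch_prob c [set w | decoded k W w != W k]).

End coded_transmission.

(* The rate of the code of length n is ln |W_k| / n; since |W_k| is an integer,
   a rate tuple is required to be the limit of the rates of the codes. *)
Definition DD_achievable (R : realType) (K : nat) (c : channel R K) (PT : R)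
    (r : 'I_K -> R) :=
  exists C : forall n, DD_code R K n,
    [/\ forall n t, (input_power c (C n) t <= PT%:E)%E,
        forall k, ln (msize (C n) k)%:R / n%:R @[n --> \oo] --> r k &
        forall k, error_prob c (C n) k @[n --> \oo] --> 0%E].

Definition DD_dof_region (R : realType) (K : nat) (c : R -> channel R K) :
    set ('I_K -> R) :=
  [set d | exists r : R -> 'I_K -> R,
    (forall PT : R, 0 < PT -> DD_achievable (c PT) PT (r PT)) /\
    forall k, r PT k / ln PT @[PT --> +oo] --> d k].

(* Main.v *)
(* The scheme is that of Maddah-Ali and Tse, made robust against jamming by
   coding over windows. Let delta be the probability that a given user is not
   jammed; each user gets d = delta / (1 + 1/2 + ... + 1/K).

   A window of length W serves the users of a set S of size j: generic
   combinations (powers of distinct nodes) of (K-j+1) L symbols are sent from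
   the K antennas, where L is slightly below delta W. Each user is unjammed for
   at least L slots with high probability. A user of S lacks the L equations
   overheard by each of the K-j users outside S; once it has them, it inverts a
   matrix that is almost surely regular, because its determinant is multilinear
   in the channel rows and becomes a Vandermonde determinant when the channels
   are unit vectors. With delayed knowledge of channels and jamming, the
   transmitter knows these equations, and for every set T of size j+1 it turns
   the equations that each user r of T overheard in the window of T \ {r} into
   j L symbols wanted by all of T, to be sent in windows of order j+1. Order K
   symbols are decoded by everybody.

   At high power the data symbols are taken from a scaled grid of Gaussian
   integers. For suitable constants independent of the power, a block is good
   (typical jamming, well-conditioned channels, small noise) with probability
   close to 1; here only the law of each of the three processes within a block
   matters. By Chebyshev's inequality all but a small fraction of the blocks are
   good, and a Gilbert-Varshamov code over the blocks corrects the others at a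
   cost that is negligible with respect to log P. *)

Require Import Defs.
From HB Require Import structures.
From mathcomp Require Import all_boot all_order all_algebra all_fingroup.
From mathcomp Require Import complex.
From mathcomp Require Import all_classical all_reals all_analysis.
From mathcomp Require Import measurable_realfun.
From mathcomp Require Import ring lra zify.

Set Implicit Arguments.
Unset Strict Implicit.
Unset Printing Implicit Defensive.

Import Order.TTheory GRing.Theory Num.Theory.
Import numFieldNormedType.Exports.

Local Open Scope classical_set_scope.
Local Open Scope ring_scope.

(** * Probability of finite families of events *)

(** The obstacle is uniformity in the power. The thresholds [cg] for the channels and [a] for the
    noise come from continuity of probability and are not explicit; they can be fixed before the
    power because the laws of channels and noise are the same for all [PT]. Only the lattice then
    depends on the power: its scale [alpha] is constant and its side [Q] is of order sqrt PT, so one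
    symbol carries 2 ln Q, about ln PT. The harmonic number comes from a count: the sets of size j
    occupy binomial(K,j) (j-1)! (K-j)! w = K! w / j slots, and each user owns K! L data symbols, so
    the ratio of symbols to slots is L / (w (1 + 1/2 + ... + 1/K)). Linear decodability enters only
    as an inequality. On integer inputs it becomes a separation of the received points, so that
    searching for a consistent message can replace inversion. Each rate x ln P with x < d is
    available only above a power threshold depending on x; the value d itself is reached by choosing
    a nearly optimal x for every power. *)

Lemma chebyshev_finite (R : realFieldType) (F : finType) (n : nat)
    (p : F -> R) (A : 'I_n -> pred F) (q e : R) :
  (forall x, 0 <= p x) -> \sum_x p x = 1 -> 0 < e -> (0 < n)%N ->
  (forall i, \sum_(x | A i x) p x <= q) ->
  (forall i j, i != j -> \sum_(x | A i x && A j x) p x =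
      (\sum_(x | A i x) p x) * (\sum_(x | A j x) p x)) ->
  \sum_(x | (q + e) * n%:R <= (\sum_i A i x)%:R) p x <= (e ^+ 2 * n%:R)^-1.
Proof.
move=> p0 p1 e0 n0 pq pI.
pose E i := \sum_(x | A i x) p x.
pose D x := \sum_i ((A i x)%:R - E i).
have E0 i : 0 <= E i by exact: sumr_ge0.
have E1 i : E i <= 1.
  by rewrite -p1 [leRHS](bigID (A i))/= lerDl sumr_ge0.
have EA i : \sum_x p x * (A i x)%:R = E i.
  rewrite /E [RHS]big_mkcond; apply: eq_bigr => x _.
  by case: (A i x); rewrite ?mulr1 ?mulr0.
have EAA i j : \sum_x p x * ((A i x)%:R * (A j x)%:R) =
    \sum_(x | A i x && A j x) p x.
  rewrite [RHS]big_mkcond; apply: eq_bigr => x _.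
  by case: (A i x); case: (A j x); rewrite ?mulr1 ?mulr0.
(* Pairwise independence removes the covariances, and each indicator has variance [E i - E i ^+ 2],
   at most 1. *)
have var : \sum_x p x * D x ^+ 2 <= n%:R.
  have -> : \sum_x p x * D x ^+ 2 =
      \sum_i \sum_j (\sum_x p x * ((A i x)%:R * (A j x)%:R) - E i * E j).
    transitivity (\sum_i \sum_j \sum_x
        p x * (((A i x)%:R - E i) * ((A j x)%:R - E j))).
      rewrite exchange_big /=.
      transitivity (\sum_x \sum_i \sum_j
          p x * (((A i x)%:R - E i) * ((A j x)%:R - E j))).
        apply: eq_bigr => x _; rewrite expr2 /D big_distrl /= mulr_sumr.
        by apply: eq_bigr => i _; rewrite big_distrr /= mulr_sumr.
      rewrite exchange_big /= [RHS]exchange_big; apply: eq_bigr => i _ /=.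
      exact: exchange_big.
    apply: eq_bigr => i _; apply: eq_bigr => j _.
    transitivity (\sum_x (p x * ((A i x)%:R * (A j x)%:R)
        - E j * (p x * (A i x)%:R) - E i * (p x * (A j x)%:R)
        + E i * E j * p x)).
      by apply: eq_bigr => x _; ring.
    rewrite big_split /= !sumrB -!mulr_sumr !EA p1; ring.
  apply: (@le_trans _ _ (\sum_(i < n) 1)); last first.
    by rewrite sumr_const card_ord.
  apply: ler_sum => i _; rewrite (bigD1 i)//= [X in _ + X]big1 ?addr0; last first.
    by move=> j ji; rewrite EAA pI 1?eq_sym// subrr.
  rewrite EAA (eq_bigl (A i)); last by move=> x; rewrite andbb.
  rewrite -/(E i); have := sqr_ge0 (E i); have := E1 i; rewrite expr2; lra.
have en : 0 < e * n%:R by rewrite mulr_gt0 // ltr0n.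
rewrite -[leRHS]mul1r ler_pdivlMr ?mulr_gt0 ?exprn_gt0 ?ltr0n//.
have -> : e ^+ 2 * n%:R = (e * n%:R) ^+ 2 / n%:R.
  by rewrite exprMn expr2 [n%:R ^+ 2]expr2 -!mulrA divff ?mulr1// pnatr_eq0 -lt0n.
rewrite mulrA ler_pdivrMr ?ltr0n// mul1r; apply: le_trans var.
rewrite mulr_suml [leRHS](bigID (fun x => (q + e) * n%:R <= (\sum_i A i x)%:R)) /=.
rewrite -[leLHS]addr0; apply: lerD; last first.
  by apply: sumr_ge0 => x _; rewrite mulr_ge0// sqr_ge0.
apply: ler_sum => x hx; apply: ler_wpM2l => //.
have h : e * n%:R <= D x.
  rewrite /D sumrB -natr_sum.
  have : \sum_(i < n) E i <= q * n%:R.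
    apply: (@le_trans _ _ (\sum_(i < n) q)); first by apply: ler_sum => i _; exact: pq.
    by rewrite sumr_const card_ord mulr_natr.
  move: hx; rewrite mulrDl => hx hE.
  by rewrite lerBrDr (le_trans _ hx)// addrC lerD2r.
by rewrite ler_pXn2r ?nnegrE ?(ltW en) ?(le_trans (ltW en) h).
Qed.

Section probability_tools.
Context d (T : measurableType d) (R : realType).

Definition Pr (P : probability T R) (A : set T) : R := fine (P A).

Lemma PrE (P : probability T R) A : measurable A -> P A = (Pr P A)%:E.
Proof. by move=> mA; rewrite fineK// fin_num_measure. Qed.

Lemma Pr_ge0 (P : probability T R) A : 0 <= Pr P A.
Proof. exact: fine_ge0. Qed.

Lemma Pr_le (P : probability T R) A B :
  measurable A -> measurable B -> A `<=` B -> Pr P A <= Pr P B.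
Proof.
move=> mA mB AB; rewrite -lee_fin -!PrE//; apply: le_measure; rewrite ?inE//.
Qed.

Lemma Pr_le1 (P : probability T R) A : measurable A -> Pr P A <= 1.
Proof. by move=> mA; rewrite -lee_fin -PrE// probability_le1. Qed.

Lemma PrC (P : probability T R) A : measurable A -> Pr P (~` A) = 1 - Pr P A.
Proof.
by move=> mA; rewrite /Pr probability_setC// PrE.
Qed.

Lemma PrU_le (P : probability T R) A B : measurable A -> measurable B ->
  Pr P (A `|` B) <= Pr P A + Pr P B.
Proof.
move=> mA mB; rewrite -lee_fin EFinD -!PrE//; first exact: measureU2.
exact: measurableU.
Qed.

Lemma Pr_bigcup_le (P : probability T R) (I : finType) (Q : pred I)
    (A : I -> set T) : (forall i, measurable (A i)) ->
  Pr P (\big[setU/set0]_(i | Q i) A i) <= \sum_(i | Q i) Pr P (A i).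
Proof.
move=> mA.
suff [] : measurable (\big[setU/set0]_(i | Q i) A i) /\
    Pr P (\big[setU/set0]_(i | Q i) A i) <= \sum_(i | Q i) Pr P (A i) by [].
apply: (big_ind2 (fun B r => measurable B /\ Pr P B <= r)).
- by split; rewrite ?/Pr ?measure0.
- move=> B r C s [mB Br] [mC Cs]; split; first exact: measurableU.
  by rewrite (le_trans (PrU_le P mB mC))// lerD.
- by [].
Qed.

Lemma Pr_finite (P : probability T R) (F : finType) (f : T -> F) (Q : pred F) :
  (forall x, measurable (f @^-1` [set x])) ->
  Pr P [set w | Q (f w)] = \sum_(x | Q x) Pr P (f @^-1` [set x]).
Proof.
move=> mf.
have -> : [set w | Q (f w)] = \bigcup_(x in [set` Q]) (f @^-1` [set x]).
  apply/seteqP; split => w /=; first by move=> ?; exists (f w).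
  by move=> [x /= Qx ->].
rewrite /Pr measure_fin_bigcup//; last first.
  by move=> x y _ _ [w [/= <- <-]].
rewrite -(@bigfs _ _ _ _ (index_enum F)) ?index_enum_uniq//; last by move=> x _; rewrite mem_index_enum.
rewrite (eq_bigr (fun x => (Pr P (f @^-1` [set x]))%:E)); last first.
  by move=> x _; exact: PrE.
by rewrite sumEFin.
Qed.

End probability_tools.

(** * Laws and independence of finite subfamilies of a random family *)

Section tuple_measure.
Context d (T : measurableType d) (R : realType) (n : nat).

Definition box (A : 'I_n -> set T) : set (n.-tuple T) :=
  [set v | forall i, A i (tnth v i)].

Lemma box_bigcap (A : 'I_n -> set T) :
  box A = \bigcap_(i in setT) ((@tnth n T ^~ i) @^-1` A i).
Proof. by apply/seteqP; split => v; [move=> h i _; exact: h|move=> h i; exact: h]. Qed.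

Lemma measurable_box (A : 'I_n -> set T) :
  (forall i, measurable (A i)) -> measurable (box A).
Proof.
move=> mA; rewrite box_bigcap; apply: fin_bigcap_measurable => // i _.
by rewrite -[X in measurable X]setTI; exact: measurable_tnth.
Qed.

(** Boxes are closed under intersection and generate the product sigma-algebra, so a finite measure
    is determined by its values on them. *)
Lemma tuple_measure_unique (m1 m2 : {measure set (n.-tuple T) -> \bar R}) :
  (m1 setT < +oo)%E ->
  (forall A, (forall i, measurable (A i)) -> m1 (box A) = m2 (box A)) ->
  forall B, measurable B -> m1 B = m2 B.
Proof.
move=> m1oo m12 B mB.
pose G := [set box A | A in [set A : 'I_n -> set T | forall i, measurable (A i)]].
have boxT : box (fun=> setT) = setT by apply/seteqP; split.
apply: (measure_unique G (fun=> setT)) => //.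
- apply/seteqP; split.
  + apply: smallest_sub; first exact: smallest_sigma_algebra.
    move=> C; rewrite -bigcup_seq => -[i _ [A mA <-]].
    apply: sub_sigma_algebra; exists (fun j => if j == i then A else setT) => /=.
      by move=> j; case: ifP.
    rewrite setTI; apply/seteqP; split => v /=.
      by move/(_ i); rewrite eqxx.
    by move=> Av j; case: eqP => // ->.
  + apply: smallest_sub; first exact: sigma_algebra_measurable.
    by move=> _ [A mA <-]; exact: measurable_box.
- move=> _ _ [A mA <-] [A' mA' <-]; exists (fun i => A i `&` A' i).
    by move=> i; exact: measurableI.
  apply/seteqP; split => v /=; first by move=> h; split => i; have [] := h i.
  by move=> [h1 h2] i; split; [exact: h1|exact: h2].
- by move=> _; exists (fun=> setT).
- by rewrite bigcup_const//; exists 0%N.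
- by move=> _ [A mA <-]; exact: m12.
Qed.

End tuple_measure.

Definition image_measure d1 d2 (T1 : measurableType d1)
    (T2 : measurableType d2) (R : realType) (m : {measure set T1 -> \bar R})
    (f : T1 -> T2) (mf : measurable_fun setT f) : {measure set T2 -> \bar R} :=
  measure_function_pushforward__canonical__measure_function_Measure m mf.

Section finite_subfamilies.
Context d (T : measurableType d) (R : realType) (P : probability T R).
Context (I : choiceType) d' (E : measurableType d') (X : I -> T -> E).
Hypothesis mX : forall i, measurable_fun setT (X i).

Definition subfamily n (s : n.-tuple I) (w : T) : n.-tuple E :=
  [tuple X (tnth s i) w | i < n].

Lemma measurable_subfamily n (s : n.-tuple I) :
  measurable_fun setT (subfamily s).
Proof.
apply/measurable_fun_tnthP => i.
by rewrite (_ : _ \o _ = X (tnth s i))//; apply/funext => w /=; rewrite tnth_mktuple.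
Qed.

Lemma measurable_subfamily_preimage n (s : n.-tuple I) B :
  measurable B -> measurable (subfamily s @^-1` B).
Proof.
by move=> mB; rewrite -[X in measurable X]setTI; exact: measurable_subfamily.
Qed.

Hypothesis iX : mutually_independent P X.

(** Turns sides indexed by positions of [s] into a family indexed by [I], the form that
    [mutually_independent] expects. For x outside [s], [index] returns the length, [insub] fails and
    the side is [setT]. *)
Definition box_at n (s : n.-tuple I) (A : 'I_n -> set E) (x : I) : set E :=
  if insub (index x s) is Some i then A i else setT.

Lemma measurable_box_at n (s : n.-tuple I) A x :
  (forall i, measurable (A i)) -> measurable (box_at s A x).
Proof. by move=> mA; rewrite /box_at; case: insubP. Qed.

Lemma box_at_tnth n (s : n.-tuple I) A i : uniq s ->
  box_at s A (tnth s i) = A i.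
Proof.
move=> us; rewrite /box_at (tnth_nth (tnth s i)) index_uniq ?size_tuple//.
by rewrite valK.
Qed.

Lemma subfamily_box n (s : n.-tuple I) A : uniq s ->
  subfamily s @^-1` box A = \bigcap_(x in [set` s]) X x @^-1` box_at s A x.
Proof.
move=> us; apply/seteqP; split => w /=.
  by move=> h x /= /tnthP[i ->]; rewrite /= box_at_tnth//; have := h i; rewrite tnth_mktuple.
by move=> h i; have := h (tnth s i) (mem_tnth i s); rewrite /= box_at_tnth// tnth_mktuple.
Qed.

Lemma subfamily_box_prob n (s : n.-tuple I) A : uniq s ->
  (forall i, measurable (A i)) ->
  P (subfamily s @^-1` box A) = (\prod_(i < n) P (X (tnth s i) @^-1` A i))%E.
Proof.
move=> us mA; rewrite subfamily_box// iX//; last first.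
  by move=> x; exact: measurable_box_at.
rewrite big_tuple; apply: eq_bigr => i _; by rewrite box_at_tnth.
Qed.

Lemma subfamily_box_indep n1 n2 (s1 : n1.-tuple I) (s2 : n2.-tuple I) A1 A2 :
  uniq (s1 ++ s2) ->
  (forall i, measurable (A1 i)) -> (forall i, measurable (A2 i)) ->
  P (subfamily s1 @^-1` box A1 `&` subfamily s2 @^-1` box A2) =
  (P (subfamily s1 @^-1` box A1) * P (subfamily s2 @^-1` box A2))%E.
Proof.
move=> us mA1 mA2; move: (us); rewrite cat_uniq => /and3P[us1 /hasPn s12 us2].
pose A x := if x \in (s1 : seq I) then box_at s1 A1 x else box_at s2 A2 x.
have mA x : measurable (A x).
  by rewrite /A; case: ifP => _; exact: measurable_box_at.
rewrite subfamily_box// (subfamily_box A2 us2).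
have E1 : \bigcap_(x in [set` s1]) X x @^-1` box_at s1 A1 x =
    \bigcap_(x in [set` s1]) X x @^-1` A x.
  by apply: eq_bigcapr => x /= xs; rewrite /A xs.
have E2 : \bigcap_(x in [set` s2]) X x @^-1` box_at s2 A2 x =
    \bigcap_(x in [set` s2]) X x @^-1` A x.
  by apply: eq_bigcapr => x /= xs; rewrite /A (negbTE (s12 _ xs)).
rewrite E1 E2 !iX// -big_cat -iX//; congr (P _).
rewrite -bigcap_setU (_ : [set` s1] `|` [set` s2] = [set` s1 ++ s2])//.
by apply/seteqP; split => x /=; rewrite mem_cat => /orP.
Qed.

(** Extension from boxes in two passes: with the first set a fixed box, both sides are finite
    measures in [B2]; then, with [B2] arbitrary but fixed, both are finite measures in [B1]. Each
    time they agree on boxes. *)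
Lemma subfamily_indep n1 n2 (s1 : n1.-tuple I) (s2 : n2.-tuple I) B1 B2 :
  uniq (s1 ++ s2) -> measurable B1 -> measurable B2 ->
  P (subfamily s1 @^-1` B1 `&` subfamily s2 @^-1` B2) =
  (P (subfamily s1 @^-1` B1) * P (subfamily s2 @^-1` B2))%E.
Proof.
move=> us mB1 mB2.
have fix1 A1 : (forall i, measurable (A1 i)) -> forall B2, measurable B2 ->
    P (subfamily s1 @^-1` box A1 `&` subfamily s2 @^-1` B2) =
    (P (subfamily s1 @^-1` box A1) * P (subfamily s2 @^-1` B2))%E.
  move=> mA1 C mC.
  have mF := measurable_subfamily_preimage s1 (measurable_box mA1).
  pose r : {nonneg R} := NngNum (fine_ge0 (measure_ge0 P (subfamily s1 @^-1` box A1))).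
  pose mu : {measure set _ -> \bar R} := image_measure (mrestr P mF) (measurable_subfamily s2).
  pose nu : {measure set _ -> \bar R} := mscale r (image_measure P (measurable_subfamily s2)).
  have muE A : mu A = P (subfamily s1 @^-1` box A1 `&` subfamily s2 @^-1` A).
    by rewrite setIC.
  have nuE A : nu A = (P (subfamily s1 @^-1` box A1) * P (subfamily s2 @^-1` A))%E.
    by rewrite /nu /= /mscale /= fineK// fin_num_measure.
  rewrite -muE -nuE; apply: tuple_measure_unique => //.
    by rewrite muE preimage_setT setIT ltey_eq fin_num_measure.
  by move=> A mA; rewrite muE nuE subfamily_box_indep.
have mF := measurable_subfamily_preimage s2 mB2.
pose r : {nonneg R} := NngNum (fine_ge0 (measure_ge0 P (subfamily s2 @^-1` B2))).
pose mu : {measure set _ -> \bar R} := image_measure (mrestr P mF) (measurable_subfamily s1).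
pose nu : {measure set _ -> \bar R} := mscale r (image_measure P (measurable_subfamily s1)).
have muE A : mu A = P (subfamily s1 @^-1` A `&` subfamily s2 @^-1` B2) by [].
have nuE A : nu A = (P (subfamily s1 @^-1` A) * P (subfamily s2 @^-1` B2))%E.
  by rewrite /nu /= /mscale /= fineK ?fin_num_measure// muleC.
rewrite -muE -nuE; apply: tuple_measure_unique => //.
  by rewrite muE preimage_setT setTI ltey_eq fin_num_measure.
by move=> A mA; rewrite muE nuE fix1.
Qed.

End finite_subfamilies.

(** Compares two probability spaces: a bound proved for one block at one power carries over to every
    block at every power. *)
Lemma subfamily_law d1 (T1 : measurableType d1) d2 (T2 : measurableType d2)
    (R : realType) (P1 : probability T1 R) (P2 : probability T2 R)
    (I : choiceType) d' (E : measurableType d')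
    (X1 : I -> T1 -> E) (X2 : I -> T2 -> E) n (s1 s2 : n.-tuple I) B :
  (forall i, measurable_fun setT (X1 i)) ->
  (forall i, measurable_fun setT (X2 i)) ->
  mutually_independent P1 X1 -> mutually_independent P2 X2 ->
  uniq s1 -> uniq s2 ->
  (forall i A, measurable A ->
    P1 (X1 (tnth s1 i) @^-1` A) = P2 (X2 (tnth s2 i) @^-1` A)) ->
  measurable B ->
  P1 (subfamily X1 s1 @^-1` B) = P2 (subfamily X2 s2 @^-1` B).
Proof.
move=> mX1 mX2 i1 i2 u1 u2 X12 mB.
pose mu : {measure set _ -> \bar R} := image_measure P1 (measurable_subfamily mX1 s1).
pose nu : {measure set _ -> \bar R} := image_measure P2 (measurable_subfamily mX2 s2).
apply: (tuple_measure_unique (m1 := mu) (m2 := nu)) => //.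
  by rewrite /mu /= /pushforward preimage_setT probability_setT ltry.
move=> A mA; rewrite /mu /nu /= /pushforward !subfamily_box_prob//.
by apply: eq_bigr => i _; exact: X12.
Qed.

(** An event decided by finitely many measurable bits is measurable for an arbitrary [Q]; this
    covers typicality, counts of bad blocks and the search of the decoder. *)
Lemma measurable_finite_pattern d (T : measurableType d) (I : finType)
    (b : I -> T -> bool) (Q : set {ffun I -> bool}) :
  (forall i, measurable [set w | b i w]) ->
  measurable [set w | Q [ffun i => b i w]].
Proof.
move=> mb.
have mb1 i c : measurable [set w | b i w = c].
  case: c; first exact: mb.
  rewrite (_ : [set w | _] = ~` [set w | b i w]); first exact: measurableC.
  by apply/seteqP; split => w /=; [move=> ->|move/negP/negbTE].
have -> : [set w | Q [ffun i => b i w]] =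
    \bigcup_(x in Q) \bigcap_(i in setT) [set w | b i w = x i].
  apply/seteqP; split => w /=.
    by move=> Qw; exists [ffun i => b i w] => // i _ /=; rewrite ffunE.
  move=> [x Qx bx]; rewrite (_ : [ffun i => b i w] = x)//.
  by apply/ffunP => i; rewrite ffunE; exact: bx.
apply: fin_bigcup_measurable; first exact: finite_finset.
move=> x _; apply: fin_bigcap_measurable; first exact: finite_finset.
by move=> i _; exact: mb1.
Qed.

(** Only the pattern of the n events matters, and its law is a distribution on a finite type, where
    the finite Chebyshev inequality applies without integration. *)
Lemma weak_law d (T : measurableType d) (R : realType) (P : probability T R)
    (n : nat) (A : 'I_n -> set T) (q e : R) : 0 < e -> (0 < n)%N ->
  (forall i, measurable (A i)) -> (forall i, Pr P (A i) <= q) ->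
  (forall i j, i != j -> P (A i `&` A j) = (P (A i) * P (A j))%E) ->
  Pr P [set w | (q + e) * n%:R <= (\sum_i (w \in A i))%:R] <= (e ^+ 2 * n%:R)^-1.
Proof.
move=> e0 n0 mA Aq AI.
pose f w : {ffun 'I_n -> bool} := [ffun i => w \in A i].
have AE i : [set w | w \in A i] = A i by apply/seteqP; split => w /=; rewrite inE.
have mf x : measurable (f @^-1` [set x]).
  by apply: (@measurable_finite_pattern _ _ _ _ [set x]) => i; rewrite AE.
have E Q := Pr_finite P Q mf.
have -> : [set w | (q + e) * n%:R <= (\sum_i (w \in A i))%:R] =
    [set w | (q + e) * n%:R <= (\sum_i f w i)%:R].
  by apply/funext => w /=; under [in RHS]eq_bigr do rewrite ffunE.
have EA i : \sum_(x : {ffun 'I_n -> bool} | x i) Pr P (f @^-1` [set x]) = Pr P (A i).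
  rewrite -(E (fun x => x i)); congr (Pr P _).
  by apply/seteqP; split => w /=; rewrite ffunE; [exact: set_mem|exact: mem_set].
rewrite (E (fun x => (q + e) * n%:R <= (\sum_i x i)%:R)).
apply: (@chebyshev_finite _ _ _ (fun x => Pr P (f @^-1` [set x]))
  (fun i x => x i)) => //.
- by move=> x; exact: Pr_ge0.
- rewrite -(E predT) (_ : [set w | _] = setT)//; last by apply/seteqP; split.
  by rewrite /Pr probability_setT.
- by move=> i; rewrite EA.
- move=> i j ij; rewrite -(E (fun x => x i && x j)) !EA.
  rewrite (_ : [set w | _] = A i `&` A j); last first.
    by apply/seteqP; split => w /=; rewrite !ffunE; [move=> /andP[/set_mem ? /set_mem]|move=> [/mem_set -> /mem_set ->]].
  apply: EFin_inj; rewrite EFinM -!PrE//; first exact: AI.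
  exact: measurableI.
Qed.

(** * Measurability of complex functions and matrices *)

Section measurable_complex_theory.
Context {R : realType} {d} {T : measurableType d}.
Implicit Types f g : T -> R[i].

Lemma measurable_Re : measurable_fun [set: R[i]] (@complex.Re R).
Proof.
by move=> _ A mA; apply: sub_sigma_algebra; left; exists A.
Qed.

Lemma measurable_Im : measurable_fun [set: R[i]] (@complex.Im R).
Proof.
by move=> _ A mA; apply: sub_sigma_algebra; right; exists A.
Qed.

Lemma measurable_fun_complex f :
  measurable_fun setT (fun w => complex.Re (f w)) ->
  measurable_fun setT (fun w => complex.Im (f w)) -> measurable_fun setT f.
Proof.
move=> mr mi; apply: (measurability (preimage_set_system setT (@complex.Re R) measurable
  `|` preimage_set_system setT (@complex.Im R) measurable)) => //.
move=> _ [B [[A mA <-]|[A mA <-]] <-]; rewrite !setTI.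
- by rewrite -[X in measurable X]setTI; exact: mr.
- by rewrite -[X in measurable X]setTI; exact: mi.
Qed.

Lemma measurable_fun_Re f : measurable_fun setT f ->
  measurable_fun setT (fun w => complex.Re (f w)).
Proof. exact: measurableT_comp measurable_Re. Qed.

Lemma measurable_fun_Im f : measurable_fun setT f ->
  measurable_fun setT (fun w => complex.Im (f w)).
Proof. exact: measurableT_comp measurable_Im. Qed.

Lemma measurable_complexD f g : measurable_fun setT f -> measurable_fun setT g ->
  measurable_fun setT (fun w => f w + g w).
Proof.
move=> mf mg; apply: measurable_fun_complex => /=.
- rewrite (_ : (fun w => _) = (fun w => complex.Re (f w) + complex.Re (g w))).
    by apply: measurable_funD; exact: measurable_fun_Re.
  by apply/funext => w; case: (f w) => ? ?; case: (g w).
- rewrite (_ : (fun w => _) = (fun w => complex.Im (f w) + complex.Im (g w))).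
    by apply: measurable_funD; exact: measurable_fun_Im.
  by apply/funext => w; case: (f w) => ? ?; case: (g w).
Qed.

Lemma measurable_complexN f : measurable_fun setT f ->
  measurable_fun setT (fun w => - f w).
Proof.
move=> mf; apply: measurable_fun_complex => /=.
- rewrite (_ : (fun w => _) = (fun w => - complex.Re (f w))).
    by apply: measurableT_comp => //; exact: measurable_fun_Re.
  by apply/funext => w; case: (f w).
- rewrite (_ : (fun w => _) = (fun w => - complex.Im (f w))).
    by apply: measurableT_comp => //; exact: measurable_fun_Im.
  by apply/funext => w; case: (f w).
Qed.

Lemma measurable_complexM f g : measurable_fun setT f -> measurable_fun setT g ->
  measurable_fun setT (fun w => f w * g w).
Proof.
move=> mf mg.
have [mfr mfi] := (measurable_fun_Re mf, measurable_fun_Im mf).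
have [mgr mgi] := (measurable_fun_Re mg, measurable_fun_Im mg).
apply: measurable_fun_complex => /=.
- rewrite (_ : (fun w => _) = (fun w => complex.Re (f w) * complex.Re (g w)
      - complex.Im (f w) * complex.Im (g w))).
    by apply: measurable_funB; exact: measurable_funM.
  by apply/funext => w; case: (f w) => ? ?; case: (g w).
- rewrite (_ : (fun w => _) = (fun w => complex.Re (f w) * complex.Im (g w)
      + complex.Im (f w) * complex.Re (g w))).
    by apply: measurable_funD; exact: measurable_funM.
  by apply/funext => w; case: (f w) => ? ?; case: (g w).
Qed.

Lemma measurable_complex_sum (I : Type) (s : seq I) (Q : pred I) (F : I -> T -> R[i]) :
  (forall i, Q i -> measurable_fun setT (F i)) ->
  measurable_fun setT (fun w => \sum_(i <- s | Q i) F i w).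
Proof.
move=> mF; rewrite (_ : (fun w => _) = \sum_(i <- s | Q i) F i); last first.
  by apply/funext => w; rewrite fct_sumE.
apply: (big_ind (measurable_fun setT)) => //; first exact: measurable_cst.
by move=> f g; exact: measurable_complexD.
Qed.

Lemma measurable_sqmodc f : measurable_fun setT f ->
  measurable_fun setT (fun w => sqmodc (f w)).
Proof.
move=> mf; apply: measurable_funD; apply: measurable_funX.
- exact: measurable_fun_Re.
- exact: measurable_fun_Im.
Qed.

End measurable_complex_theory.

Section measurable_matrix_theory.
Context {d} {T : measurableType d} {d'} {E : measurableType d'} {m n : nat}.

Lemma measurable_entry (i : 'I_m) (j : 'I_n) :
  measurable_fun [set: 'M[E]_(m, n)] (fun A : 'M[E]_(m, n) => A i j).
Proof.
by move=> _ A mA; apply: sub_sigma_algebra; exists (i, j) => //; exists A.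
Qed.

Lemma measurable_fun_entry (f : T -> 'M[E]_(m, n)) i j :
  measurable_fun setT f -> measurable_fun setT (fun w => f w i j).
Proof. exact: measurableT_comp (measurable_entry i j). Qed.

Lemma measurable_fun_matrix (f : T -> 'M[E]_(m, n)) :
  (forall i j, measurable_fun setT (fun w => f w i j)) -> measurable_fun setT f.
Proof.
move=> mf; apply: (measurability (\bigcup_ij preimage_set_system setT
        (fun A : 'M[E]_(m, n) => A ij.1 ij.2) measurable)) => //.
move=> _ [B [ij _ [A mA <-]] <-]; rewrite !setTI.
by have := mf ij.1 ij.2 measurableT A mA; rewrite setTI.
Qed.

End measurable_matrix_theory.

(** The scheme retransmits equations from slots chosen by the random jamming; such a random index
    takes countably many values. *)
Lemma measurable_fun_select d1 (T1 : measurableType d1) d2 (T2 : measurableType d2)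
    (C : countType) (g : T1 -> C) (F : C -> T1 -> T2) :
  (forall c, measurable [set w | g w = c]) ->
  (forall c, measurable_fun setT (F c)) ->
  measurable_fun setT (fun w => F (g w) w).
Proof.
move=> mg mF _ B mB; rewrite setTI.
rewrite (_ : _ @^-1` B = \bigcup_(n in setT)
    (if unpickle n is Some c then [set w | g w = c] `&` F c @^-1` B else set0)).
  apply: bigcup_measurable => n _; case: unpickle => // c.
  by apply: measurableI => //; rewrite -[X in measurable X]setTI; exact: mF.
apply/seteqP; split => w /=.
  by move=> Bw; exists (pickle (g w)) => //; rewrite pickleK.
by move=> [n _]; case: unpickle => // c [/= -> ].
Qed.

Lemma measurable_complex_prod (R : realType) d (T : measurableType d)
    (I : Type) (s : seq I) (Q : pred I) (F : I -> T -> R[i]) :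
  (forall i, measurable_fun setT (F i)) ->
  measurable_fun setT (fun w => \prod_(i <- s | Q i) F i w).
Proof.
move=> mF; elim: s => [|a s IH].
  by rewrite (_ : (fun w => _) = cst 1)//; apply/funext => w; rewrite big_nil.
rewrite (_ : (fun w => _) = (fun w => if Q a then
    F a w * \prod_(i <- s | Q i) F i w else \prod_(i <- s | Q i) F i w)).
  by case: (Q a) => //; exact: measurable_complexM.
by apply/funext => w; rewrite big_cons.
Qed.

Lemma measurable_det (R : realType) d (T : measurableType d) n
    (A : T -> 'M[R[i]]_n) :
  (forall i j, measurable_fun setT (fun w => A w i j)) ->
  measurable_fun setT (fun w => \det (A w)).
Proof.
move=> mA; apply: measurable_complex_sum => s _.
apply: measurable_complexM => //; apply: measurable_complex_prod => i.
exact: mA.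
Qed.

Lemma measurable_complex_set1 (R : realType) (z : R[i]) : measurable [set z].
Proof.
rewrite (_ : [set z] = (@complex.Re R) @^-1` [set complex.Re z] `&`
    (@complex.Im R) @^-1` [set complex.Im z]).
  apply: measurableI; rewrite -[X in measurable X]setTI.
    exact: measurable_Re.
  exact: measurable_Im.
apply/seteqP; split => [_ -> //|x /= [h1 h2]].
by case: x z h1 h2 => a b [c e] /= -> ->.
Qed.

(** * Determinants of random rows with densities *)

(** The constant b makes the induction go through: if some later coefficient is nonzero, the first
    coordinate is absorbed into b. Otherwise g vanishes unless the first coordinate equals one
    complex number z, and the integral over its imaginary part runs over a single point. *)
Lemma integralCn_hyperplane (R : realType) n (a : 'I_n -> R[i]) (b : R[i])
    (g : 'rV[R[i]]_n -> \bar R) :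
  (exists i, a i != 0) ->
  (forall v : 'rV[R[i]]_n, \sum_i v 0 i * a i + b != 0 -> g v = 0%E) -> integralCn g = 0%E.
Proof.
elim: n a b g => [a b g [[]] //|n IH a b g a0 g0 /=].
have int0 m (h : 'rV[R[i]]_m -> \bar R) : (forall v, h v = 0%E) -> integralCn h = 0%E.
  elim: m h => [|m IHm] h h0 //=.
  rewrite integral0_eq// => x _; rewrite integral0_eq// => y _.
  exact: IHm.
pose e : 'I_(1 + n) -> R[i] := a.
have sumE x y (v : 'rV[R[i]]_n) :
    \sum_i (row_mx (Complex x y)%:M v : 'rV[R[i]]_(1 + n)) 0 i * e i =
    Complex x y * a ord0 + \sum_i v 0 i * a (lift ord0 i).
  rewrite big_split_ord /= big_ord1 row_mxEl mxE eqxx mulr1n.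
  congr (_ * a _ + _); first exact: val_inj.
  by apply: eq_bigr => i _; rewrite row_mxEr; congr (_ * a _); exact: val_inj.
have [[i ai]|tail0] := pselect (exists i, a (lift ord0 i) != 0).
  rewrite integral0_eq// => x _; rewrite integral0_eq// => y _.
  apply: (IH (fun i => a (lift ord0 i)) (b + Complex x y * a ord0)); first by exists i.
  move=> v hv; apply: g0; rewrite sumE; apply: contraNneq hv => h; apply/eqP; rewrite -[RHS]h; ring.
have tailE i : a (lift ord0 i) = 0.
  by apply/eqP/negPn/negP => h; apply: tail0; exists i.
have a00 : a ord0 != 0.
  case: a0 => i; case: (unliftP ord0 i) => [j ->|-> //].
  by rewrite tailE eqxx.
pose z := - b / a ord0.
have gz x y : Complex x y <> z ->
    integralCn (fun v => g (row_mx (Complex x y)%:M v : 'rV[R[i]]_(1 + n))) = 0%E.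
  move=> xyz; apply: int0 => v; apply: g0; rewrite sumE big1 ?addr0; last first.
    by move=> i _; rewrite tailE mulr0.
  apply/eqP => /eqP; rewrite addr_eq0 => /eqP h; apply: xyz.
  by rewrite /z -h mulfK.
rewrite integral0_eq// => x _.
pose h y := integralCn (fun v => g (row_mx (Complex x y)%:M v : 'rV[R[i]]_(1 + n))).
transitivity (\int[lebesgue_measure]_y (h \_ [set complex.Im z]) y)%E.
  apply: eq_integral => y _; rewrite /patch; case: ifPn => // /negP yz.
  by apply: gz => xyz; apply: yz; rewrite inE /= -xyz.
by rewrite -integral_mkcond integral_set1.
Qed.

Definition hyperplane_null d (T : measurableType d) (R : realType)
    (P : probability T R) n (X : T -> 'rV[R[i]]_n) :=
  forall a : 'cV[R[i]]_n, a != 0 -> P [set w | (X w *m a) 0 0 = 0] = 0%E.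

Lemma measurable_dot (R : realType) d (T : measurableType d) n
    (X : T -> 'rV[R[i]]_n) (Y : T -> 'cV[R[i]]_n) :
  measurable_fun setT X -> measurable_fun setT Y ->
  measurable_fun setT (fun w => (X w *m Y w) 0 0).
Proof.
move=> mX mY; rewrite (_ : (fun w => _) = (fun w => \sum_i X w 0 i * Y w i 0)).
  apply: measurable_complex_sum => i _; apply: measurable_complexM;
    exact: measurable_fun_entry.
by apply/funext => w; rewrite mxE.
Qed.

Lemma density_hyperplane_null d (T : measurableType d) (R : realType)
    (P : probability T R) n (X : T -> 'rV[R[i]]_n) f :
  has_density P X f -> hyperplane_null P X.
Proof.
move=> [f0 mf fE] a a0.
have mA : measurable [set v : 'rV[R[i]]_n | (v *m a) 0 0 = 0].
  rewrite (_ : [set v | _] = (fun v : 'rV[R[i]]_n => (v *m a) 0 0) @^-1` [set 0])//.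
  rewrite -[X in measurable X]setTI.
  apply: (@measurable_dot _ _ _ _ id (cst a)) => //.
  exact: measurable_complex_set1.
rewrite (fE _ mA); apply: (@integralCn_hyperplane _ _ (fun i => a i 0) 0).
  apply: contrapT => h; move/eqP: a0; apply; apply/matrixP => i j.
  rewrite ord1 mxE; apply/eqP/negPn/negP => ai; apply: h; by exists i.
move=> v; rewrite addr0 => hv; rewrite indicE memNset ?mulr0//= mxE.
by move=> e; rewrite e eqxx in hv.
Qed.

Lemma independent_dot_null d (T : measurableType d) (R : realType)
    (P : probability T R) n (X : T -> 'rV[R[i]]_n) (Y : T -> 'cV[R[i]]_n) :
  measurable_fun setT X -> measurable_fun setT Y ->
  (forall A B, measurable A -> measurable B ->
    P (Y @^-1` A `&` X @^-1` B) = (P (Y @^-1` A) * P (X @^-1` B))%E) ->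
  hyperplane_null P X -> P [set w | Y w = 0] = 0%E ->
  P [set w | (X w *m Y w) 0 0 = 0] = 0%E.
Proof.
move=> mX mY XY nX Y0.
have mX1 A : measurable A -> measurable (X @^-1` A).
  by move=> mA; rewrite -[X in measurable X]setTI; exact: mX.
have mY1 A : measurable A -> measurable (Y @^-1` A).
  by move=> mA; rewrite -[X in measurable X]setTI; exact: mY.
have mdot0 d' (S : measurableType d') (U : S -> 'rV[R[i]]_n) (V : S -> 'cV[R[i]]_n) :
    measurable_fun setT U -> measurable_fun setT V ->
    measurable [set w | (U w *m V w) 0 0 = 0].
  move=> mU mV; rewrite (_ : [set w | _] = (fun w => (U w *m V w) 0 0) @^-1` [set 0])//.
  rewrite -[X in measurable X]setTI; apply: measurable_dot => //.
  exact: measurable_complex_set1.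
have m0 : measurable [set y : 'cV[R[i]]_n | y = 0].
  rewrite (_ : [set y | _] = \bigcap_(i in [set: 'I_n])
      ((fun y : 'cV[R[i]]_n => y i 0) @^-1` [set 0])).
    apply: fin_bigcap_measurable => // i _; rewrite -[X in measurable X]setTI.
    apply: measurable_entry => //; exact: measurable_complex_set1.
  apply/seteqP; split => y /=; first by move=> -> i _ /=; rewrite mxE.
  by move=> h; apply/matrixP => i j; rewrite ord1 mxE; exact: (h i I).
(* By independence the joint law is a product, so Fubini applies: every section of Z at y != 0 lies
   in a hyperplane. The value y = 0 is cut out, since its section would be the whole space. *)
pose Z := [set yx : 'cV[R[i]]_n * 'rV[R[i]]_n | (yx.2 *m yx.1) 0 0 = 0] `&`
  (fst @^-1` ~` [set y | y = 0]).
have mZ : measurable Z.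
  apply: measurableI; first exact: mdot0.
  rewrite -[X in measurable X]setTI; apply: measurable_fst => //.
  exact: measurableC.
pose mXf : {mfun T >-> _} := mfun_Sub (mem_set mX).
pose mYf : {mfun T >-> _} := mfun_Sub (mem_set mY).
have mYX : measurable_fun setT (fun w => (Y w, X w)) by exact: measurable_fun_pair.
pose joint := image_measure P mYX.
have jointE : (distribution P mYf \x distribution P mXf)%E Z = joint Z.
  exact: product_measure_unique.
have joint0 : joint Z = 0%E.
  rewrite -jointE /product_measure1 integral0_eq// => y _ /=.
  have [->|y0] := eqVneq y 0.
    rewrite (_ : xsection Z 0 = set0) ?measure0//.
    by apply/seteqP; split => x //; rewrite /xsection /= inE => -[_]; apply.
  rewrite (_ : xsection Z y = [set x | (x *m y) 0 0 = 0]); first exact: nX.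
  apply/seteqP; split => x; rewrite /xsection /= inE /Z /=; first by case.
  by move=> h; split => //; exact/eqP.
apply/eqP; rewrite eq_le measure_ge0 andbT -(adde0 0%E) -[X in (_ <= X + _)%E]Y0.
rewrite -[X in (_ <= _ + X)%E]joint0.
have mJ : measurable [set w | Z (Y w, X w)].
  by have := mYX measurableT _ mZ; rewrite setTI.
apply: le_trans (measureU2 _ (mY1 _ m0) mJ).
apply: le_measure; rewrite ?inE; first exact: mdot0.
  by apply: measurableU => //; exact: mY1.
move=> w /= h; have [Yw0|Yw0] := eqVneq (Y w) 0; first by left.
by right; split => //; exact/eqP.
Qed.

Definition row_det (F : numFieldType) K M (V : 'I_M -> 'M[F]_(K, M))
    (x : 'I_M -> 'rV[F]_K) : F :=
  \det (\matrix_(m, p) (x m *m V m) 0 p).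

Lemma cofactor_row_eq (F : comRingType) n (A B : 'M[F]_n) i j :
  (forall k l, k != i -> A k l = B k l) -> cofactor A i j = cofactor B i j.
Proof.
move=> AB; rewrite /cofactor; congr (_ * \det _).
by apply/matrixP => k l; rewrite !mxE AB// eq_sym neq_lift.
Qed.

(* Expanding along row i, the determinant is a linear form in x i whose
   coefficients depend on the other rows only. *)
Lemma row_det_linear (F : numFieldType) K M (V : 'I_M -> 'M[F]_(K, M)) x i :
  row_det V x = (x i *m (\col_q \sum_p V i q p *
     cofactor (\matrix_(m, p) (x m *m V m) 0 p) i p)) 0 0.
Proof.
rewrite /row_det (expand_det_row _ i) mxE.
transitivity (\sum_p \sum_q x i 0 q * (V i q p *
     cofactor (\matrix_(m, p) (x m *m V m) 0 p) i p)).
  apply: eq_bigr => p _; rewrite !mxE mulr_suml.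
  by apply: eq_bigr => q _; rewrite mulrA.
rewrite exchange_big; apply: eq_bigr => q _.
by rewrite mxE mulr_sumr.
Qed.

(** The fixed rows [x0] are replaced by random ones, one at a time from the last to the first. At
    each replacement the determinant is a linear form in the new row whose coefficients are
    independent of that row. *)
Lemma row_det_null d (T : measurableType d) (R : realType)
    (P : probability T R) (I : choiceType) K M
    (X : I -> T -> 'rV[R[i]]_K) (s : M.-tuple I)
    (V : 'I_M -> 'M[R[i]]_(K, M)) (x0 : 'I_M -> 'rV[R[i]]_K) :
  (forall i, measurable_fun setT (X i)) -> mutually_independent P X ->
  (forall i, hyperplane_null P (X i)) -> uniq s -> row_det V x0 != 0 ->
  P [set w | row_det V (fun m => X (tnth s m) w) = 0] = 0%E.
Proof.
case: M s V x0 => [|M] s V x0 mX iX nX us x0D.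
  rewrite (_ : [set w | _] = set0) ?measure0//.
  apply/seteqP; split => w //= h; move/eqP: x0D; apply; rewrite -h /row_det.
  by congr (\det _); apply/matrixP => -[].
pose hyb j w := fun m : 'I_M.+1 => if (m < j)%N then x0 m else X (tnth s m) w.
suff H j : P [set w | row_det V (hyb (M.+1 - j)%N w) = 0] = 0%E.
  by have := H M.+1; rewrite subnn.
elim: j => [|j IH].
  rewrite (_ : [set w | _] = set0) ?measure0//; apply/seteqP; split => w //= h.
  move/eqP: x0D; apply; rewrite -h subn0 /row_det.
  by congr (\det _); apply/matrixP => m p; rewrite !mxE /hyb ltn_ord.
have [jM|jM] := leqP M.+1 j.
  by move: IH; rewrite (_ : (M.+1 - j.+1 = M.+1 - j)%N)//; lia.
have ltM : (M.+1 - j.+1 < M.+1)%N by lia.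
pose i := Ordinal ltM.
have Si : (M.+1 - j = i.+1)%N by rewrite /=; lia.
pose s' : M.-tuple I := [tuple tnth s (lift i k) | k < M].
(* The cofactors along row i see the other rows only, hence the placeholder 0 in row i; the
   coefficients [c] are thus a measurable function of a tuple independent of [X (tnth s i)]. *)
pose rows (v : M.-tuple 'rV[R[i]]_K) (m : 'I_M.+1) : 'rV[R[i]]_K :=
  if unlift i m is Some k then (if (m < i)%N then x0 m else tnth v k) else 0.
pose c (v : M.-tuple 'rV[R[i]]_K) : 'cV[R[i]]_K := \col_q \sum_p V i q p *
     cofactor (\matrix_(m, p) (rows v m *m V m) 0 p) i p.
have mrows m : measurable_fun setT (fun v => rows v m).
  rewrite /rows; case: (unlift i m) => [k|] //; case: (m < i)%N => //.
  exact: measurable_tnth.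
have mc : measurable_fun setT c.
  apply: measurable_fun_matrix => q o; under eq_fun do rewrite mxE.
  apply: measurable_complex_sum => p _; apply: measurable_complexM => //.
  apply: measurable_complexM => //; apply: measurable_det => k l.
  under eq_fun do rewrite !mxE; apply: measurable_complex_sum => r _.
  by apply: measurable_complexM => //; exact: measurable_fun_entry.
have cE (j' : nat) w : (j' = i \/ j' = i.+1) ->
    (\col_q \sum_p V i q p * cofactor (\matrix_(m, p) (hyb j' w m *m V m) 0 p) i p)
    = c (subfamily X s' w).
  move=> j'i; apply/matrixP => q o; rewrite !mxE; apply: eq_bigr => p _.
  congr (_ * _); apply: cofactor_row_eq => k l ki; rewrite [LHS]mxE [RHS]mxE.
  suff -> : hyb j' w k = rows (subfamily X s' w) k by [].
  rewrite /rows /hyb; case: unliftP ki => [k' ->|->]; last by rewrite eqxx.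
  move=> _; rewrite /subfamily !tnth_mktuple.
  have ne : (lift i k' != i :> nat) by rewrite eq_sym; exact: neq_lift.
  by case: j'i => ->; rewrite ?ltnS // leq_eqVlt (negbTE ne).
(* If all coefficients vanish, so does the previous hybrid determinant, which has the same
   coefficients with [x0 i] in row i; that event is null by induction. *)
have null0 : P [set w | c (subfamily X s' w) = 0] = 0%E.
  have mc' : measurable_fun setT (fun w => c (subfamily X s' w)).
    exact: measurableT_comp mc (measurable_subfamily mX s').
  have m1 : measurable [set w | c (subfamily X s' w) = 0].
    rewrite (_ : [set w | _] = \bigcap_(q in [set: 'I_K])
      ((fun w => c (subfamily X s' w) q 0) @^-1` [set 0])).
      apply: fin_bigcap_measurable => // q _; rewrite -[X in measurable X]setTI.
      apply: (measurable_fun_entry _ _ mc') => //; exact: measurable_complex_set1.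
    apply/seteqP; split => w /=; first by move=> h q _ /=; rewrite h mxE.
    by move=> h; apply/matrixP => q o; rewrite ord1 [RHS]mxE; exact: (h q Logic.I).
  have m2 : measurable [set w | row_det V (hyb (M.+1 - j)%N w) = 0].
    rewrite (_ : [set w | _] = (fun w => row_det V (hyb (M.+1 - j)%N w)) @^-1` [set 0])//.
    rewrite -[X in measurable X]setTI; apply: measurable_det => //.
      move=> k l; under eq_fun do rewrite !mxE.
      apply: measurable_complex_sum => r _; apply: measurable_complexM => //.
      by apply: measurable_fun_entry; rewrite /hyb; case: (k < _)%N.
    exact: measurable_complex_set1.
  apply/eqP; rewrite eq_le measure_ge0 andbT -[X in (_ <= X)%E]IH.
  apply: le_measure; rewrite ?inE// => w /= h.
  by rewrite (row_det_linear _ _ i) cE ?h ?mulmx0 ?mxE//; right.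
rewrite (_ : [set w | _] = [set w | (X (tnth s i) w *m c (subfamily X s' w)) 0 0 = 0]).
  refine (independent_dot_null (mX (tnth s i)) _ _ (nX _) null0).
  - exact: measurableT_comp mc (measurable_subfamily mX s').
  - move=> A B mA mB.
    pose s1 : 1.-tuple I := [tuple tnth s i].
    have := @subfamily_indep _ _ _ P _ _ _ X mX iX _ _ s' s1 (c @^-1` A)
      ((fun v : 1.-tuple _ => tnth v ord0) @^-1` B).
    have -> : subfamily X s1 @^-1` ((fun v : 1.-tuple _ => tnth v ord0) @^-1` B)
        = X (tnth s i) @^-1` B.
      by apply/funext => w; rewrite /preimage /= tnth_mktuple.
    apply.
    + rewrite cats1 rcons_uniq; apply/andP; split.
        apply/negP => /tnthP[k]; rewrite tnth_mktuple => /(tuple_uniqP _ us).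
        by apply/eqP; exact: neq_lift.
      apply/tuple_uniqP => k l; rewrite !tnth_mktuple => /(tuple_uniqP _ us).
      exact: lift_inj.
    + by rewrite -[X in measurable X]setTI; exact: mc.
    + by rewrite -[X in measurable X]setTI; exact: measurable_tnth.
apply/funext => w /=; rewrite (row_det_linear _ _ i) cE; last by left.
by rewrite /hyb ltnn.
Qed.

(** * The precoding scheme *)

Section schedule.
Variables (K w L : nat).
Local Open Scope nat_scope.

(* Every set S of j users owns one window, of length window_len j; there every
   user outside jammed slots collects window_eqs j equations about the
   num_symbols j order-j symbols of S. The factor (j-1)!(K-j)! makes the number
   of order-(j+1) symbols produced by windows of order j match the number that
   windows of order j+1 can carry. *)
Definition copies (j : nat) := (j.-1)`! * (K - j)`!.
Definition window_len j := copies j * w.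
Definition window_eqs j := copies j * L.
Definition num_symbols j := (K - j).+1 * window_eqs j.

(** This balance dictates the factorials: for each equation number, a set of j+1 users needs j
    combinations of its j+1 overheard equations, as every user already has one of them. *)
Lemma num_symbolsS j : 0 < j < K -> num_symbols j.+1 = j * window_eqs j.
Proof.
case: j => // j /= jK; rewrite /num_symbols /window_eqs /copies /=.
have -> : (K - j.+1 = (K - j.+2).+1) by lia.
rewrite !factS; nia.
Qed.

(** Sorting by cardinality puts every window of lower order first, so that higher order symbols
    depend on the past only. *)
Definition schedule : seq ({set 'I_K} * nat) :=
  sort (fun a b : {set 'I_K} * nat => #|a.1| <= #|b.1|)
    [seq (A, t) | A : {set 'I_K} <- [seq A <- enum {set 'I_K} | A != finset.set0],
                  t : nat <- iota 0 (window_len #|A|)].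

Definition block_len := size schedule.
Definition slot (S : {set 'I_K}) t := index (S, t) schedule.

Lemma mem_schedule S t :
  ((S, t) \in schedule) = (S != finset.set0) && (t < window_len #|S|).
Proof.
rewrite mem_sort; apply/allpairsPdep/andP => [[S' [t' [+ + [-> ->]]]]|[S0 tS]].
  by rewrite mem_filter mem_iota => /andP[-> _].
by exists S, t; rewrite mem_filter mem_iota S0 mem_enum.
Qed.

Lemma uniq_schedule : uniq schedule.
Proof.
rewrite sort_uniq; apply: allpairs_uniq_dep.
- by rewrite filter_uniq// enum_uniq.
- by move=> S _; exact: iota_uniq.
- by move=> [A t] [A' t'] _ _ /= [-> ->].
Qed.

Lemma slot_lt S t : S != finset.set0 -> t < window_len #|S| ->
  slot S t < block_len.
Proof. by move=> S0 tS; rewrite index_mem mem_schedule S0. Qed.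

Lemma nth_slot S t : S != finset.set0 -> t < window_len #|S| ->
  nth (finset.set0, 0) schedule (slot S t) = (S, t).
Proof. by move=> S0 tS; rewrite nth_index// mem_schedule S0. Qed.

Lemma slot_inj S t S' t' : S != finset.set0 -> t < window_len #|S| ->
  slot S t = slot S' t' -> (S, t) = (S', t').
Proof.
move=> S0 tS e; have := slot_lt S0 tS; rewrite /block_len e index_mem => m'.
rewrite -(nth_slot S0 tS) e -[RHS](@nth_index _ (finset.set0, 0) _ schedule)//.
Qed.

Lemma slot_order S t S' t' : S != finset.set0 -> t < window_len #|S| ->
  S' != finset.set0 -> t' < window_len #|S'| -> #|S| < #|S'| ->
  slot S t < slot S' t'.
Proof.
move=> S0 tS S0' tS' SS'; rewrite ltnNge; apply/negP => h.
have tr : transitive (fun a b : {set 'I_K} * nat => #|a.1| <= #|b.1|).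
  by move=> a b c; exact: leq_trans.
have so : sorted (fun a b : {set 'I_K} * nat => #|a.1| <= #|b.1|) schedule.
  by apply: sort_sorted => a b; exact: leq_total.
have := sorted_leq_index tr (fun _ => leqnn _) so.
move=> /(_ (S', t') (S, t)); rewrite !mem_schedule S0 S0' tS tS' => /(_ isT isT h).
by rewrite leqNgt SS'.
Qed.

Lemma block_lenE : block_len =
  w * \sum_(S : {set 'I_K} | S != finset.set0) copies #|S|.
Proof.
rewrite /block_len size_sort size_allpairs_dep.
rewrite sumnE big_map big_filter big_enum_cond /= big_distrr /=.
apply: eq_bigr => S _; by rewrite size_iota /window_len mulnC.
Qed.

Definition open_slots (J : nat -> 'I_K -> bool) (S : {set 'I_K}) r : seq nat :=
  [seq t <- iota 0 (window_len #|S|) | ~~ J (slot S t) r].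
Definition open_slot J S r l := nth 0 (open_slots J S r) l.

(** Asked of users outside S as well: their open slots provide the overheard equations. *)
Definition typical (J : nat -> 'I_K -> bool) : bool :=
  [forall S : {set 'I_K}, (S != finset.set0) ==>
    [forall r, window_eqs #|S| <= size (open_slots J S r)]].

Lemma typicalP J S r : typical J -> S != finset.set0 ->
  window_eqs #|S| <= size (open_slots J S r).
Proof. by move=> /forallP /(_ S) /implyP h /h /forallP. Qed.

Lemma open_slotP J S r l : typical J -> S != finset.set0 ->
  l < window_eqs #|S| ->
  open_slot J S r l < window_len #|S| /\ ~~ J (slot S (open_slot J S r l)) r.
Proof.
move=> tJ S0 lS; have : open_slot J S r l \in open_slots J S r.
  by rewrite mem_nth// (leq_trans lS)// typicalP.
by rewrite mem_filter mem_iota => /and3P[].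
Qed.

(** The default 0 is itself a position of the window, so the bound also covers atypical jamming; the
    encoder has to be causal for every pattern. *)
Lemma open_slot_lt J S r l : 0 < w -> open_slot J S r l < window_len #|S|.
Proof.
move=> w0; rewrite /open_slot; have [lS|lS] := ltnP l (size (open_slots J S r)).
  by have := mem_nth 0 lS; rewrite mem_filter mem_iota => /and3P[].
by rewrite nth_default// /window_len /copies !muln_gt0 !fact_gt0.
Qed.

End schedule.

Section scheme.
Variables (F : numFieldType) (K w L : nat).
Local Notation window_len := (window_len K w).
Local Notation window_eqs := (window_eqs K L).
Local Notation num_symbols := (num_symbols K L).
Local Notation slot := (@slot K w).
Local Notation open_slot := (@open_slot K w).
Local Notation block_len := (block_len K w).
Local Notation inputs := 'M[F]_(K, num_symbols 1).

(* The entries of the precoders of a window are powers of these distinct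
   nodes. *)
Definition node (t : nat) (i : 'I_K) : F := (t * K + i)%:R.

Definition window_obs (h : nat -> 'I_K -> 'rV[F]_K)
    (s : {set 'I_K} -> nat -> F) (S : {set 'I_K}) (r : 'I_K) (t : nat) : F :=
  \sum_i h (slot S t) r 0 i *
    \sum_(p < num_symbols #|S|) node t i ^+ p * s S p.

(* Order-(j+1) symbol number p of the set S of j+1 users: for j = 0 a data
   symbol, otherwise a combination of equations each of which is known to one
   user of S and wanted by all others. *)
Fixpoint symbol h J (z : inputs) (j : nat) (S : {set 'I_K}) (p : nat) : F :=
  match j with
  | 0 => if [pick k in S] is Some k then
           (if insub p is Some q then z k q else 0) else 0
  | j'.+1 => \sum_(r in S) (r%:R) ^+ (p %/ window_eqs j) *
      window_obs h (symbol h J z j') (S :\ r) r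
        (open_slot J (S :\ r) r (p %% window_eqs j))
  end.

Definition antennas h J z (S : {set 'I_K}) t : 'cV[F]_K :=
  \col_i \sum_(p < num_symbols #|S|) node t i ^+ p * symbol h J z #|S|.-1 S p.

Definition transmit h J z (n : nat) : 'cV[F]_K :=
  let St := nth (finset.set0, 0%N) (schedule K w) n in antennas h J z St.1 St.2.

Definition observe h J z (r : 'I_K) (n : nat) : F :=
  (h n r *m transmit h J z n) 0 0.

Lemma observe_slot h J z r (S : {set 'I_K}) t : S != finset.set0 -> (t < window_len #|S|)%N ->
  observe h J z r (slot S t) = window_obs h (symbol h J z #|S|.-1) S r t.
Proof.
move=> S0 tS; rewrite /observe /transmit nth_slot// mxE.
by apply: eq_bigr => i _; rewrite mxE.
Qed.

(** A symbol number splits into a power q and an equation number l. For fixed l the symbols are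
    Vandermonde combinations, with the user numbers as nodes, of the l-th equations overheard by the
    users of T. *)
Lemma symbolS h J z j (T : {set 'I_K}) q l : (l < window_eqs j.+1)%N -> #|T| = j.+2 ->
  symbol h J z j.+1 T (q * window_eqs j.+1 + l) =
  \sum_(r in T) r%:R ^+ q *
    window_obs h (symbol h J z #|T :\ r|.-1) (T :\ r) r (open_slot J (T :\ r) r l).
Proof.
move=> lj Tj /=; apply: eq_bigr => r rT.
have -> : #|T :\ r|.-1 = j by have := cardsD1 r T; rewrite rT Tj add1n => -[<-].
rewrite divnMDl ?(leq_ltn_trans _ lj)// divn_small// addn0.
by rewrite modnMDl modn_small.
Qed.

(** The choice of slots depends on the jamming and not on the data, so the whole retransmission is
    linear in z. Superposition gives both the power bound and the passage to differences of lattice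
    inputs. *)
Lemma symbol_linear h J z j S p :
  symbol h J z j S p =
  \sum_k \sum_q z k q * symbol h J (delta_mx k q) j S p.
Proof.
elim: j S p => [|j IH] S p /=.
  case: pickP => [k kS|_]; last first.
    by rewrite big1// => k _; rewrite big1// => q _; rewrite mulr0.
  case: insubP => [q _ _|_]; last first.
    by rewrite big1// => k' _; rewrite big1// => q _; rewrite mulr0.
  rewrite (bigD1 k)//= (bigD1 q)//= !mxE !eqxx mulr1.
  rewrite !big1 ?addr0// => [k' kk'|q' qq'].
    by rewrite big1// => q' _; rewrite mxE [k == k']eq_sym (negbTE kk') mulr0.
  by rewrite mxE [q == q']eq_sym (negbTE qq') andbF mulr0.
under [RHS]eq_bigr => k _.
  under eq_bigr => q _ do rewrite mulr_sumr.
  rewrite exchange_big /=.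
  over.
rewrite exchange_big /=; apply: eq_bigr => r rS.
under [RHS]eq_bigr => k _.
  under eq_bigr => q _ do rewrite mulrCA.
  rewrite -mulr_sumr.
  over.
rewrite -mulr_sumr; congr (_ * _); rewrite /window_obs.
under [RHS]eq_bigr => k _.
  under eq_bigr => q _ do rewrite mulr_sumr.
  rewrite exchange_big /=.
  over.
rewrite exchange_big /=; apply: eq_bigr => i _.
under [RHS]eq_bigr => k _.
  under eq_bigr => q _ do rewrite mulrCA.
  rewrite -mulr_sumr.
  over.
rewrite -mulr_sumr; congr (_ * _).
under [RHS]eq_bigr => k _.
  under eq_bigr => q _ do rewrite mulr_sumr.
  rewrite exchange_big /=.
  over.
rewrite exchange_big /=; apply: eq_bigr => p' _.
under [RHS]eq_bigr => k _.
  under eq_bigr => q _ do rewrite mulrCA.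
  rewrite -mulr_sumr.
  over.
by rewrite -mulr_sumr IH.
Qed.

Lemma transmit_linear h J z n :
  transmit h J z n = \sum_k \sum_q z k q *: transmit h J (delta_mx k q) n.
Proof.
apply/matrixP => i o; rewrite mxE !summxE.
under [RHS]eq_bigr => k _.
  rewrite summxE; under eq_bigr => q _ do rewrite !mxE mulr_sumr.
  rewrite exchange_big /=.
  over.
rewrite exchange_big /=; apply: eq_bigr => p _.
under [RHS]eq_bigr => k _.
  under eq_bigr => q _ do rewrite mulrCA.
  rewrite -mulr_sumr.
  over.
by rewrite -mulr_sumr symbol_linear.
Qed.

Lemma transmitD h J z z' n :
  transmit h J (z + z') n = transmit h J z n + transmit h J z' n.
Proof.
rewrite transmit_linear [in RHS]transmit_linear [transmit h J z' n]transmit_linear.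
rewrite -big_split; apply: eq_bigr => k _ /=; rewrite -big_split.
by apply: eq_bigr => q _ /=; rewrite mxE scalerDl.
Qed.

Lemma transmitZ h J a z n : transmit h J (a *: z) n = a *: transmit h J z n.
Proof.
rewrite transmit_linear [in RHS]transmit_linear scaler_sumr.
apply: eq_bigr => k _; rewrite scaler_sumr.
by apply: eq_bigr => q _; rewrite mxE scalerA.
Qed.

Lemma observeD h J z z' r n :
  observe h J (z + z') r n = observe h J z r n + observe h J z' r n.
Proof. by rewrite /observe transmitD mulmxDr mxE. Qed.

Lemma observeZ h J a z r n : observe h J (a *: z) r n = a * observe h J z r n.
Proof. by rewrite /observe transmitZ -scalemxAr mxE. Qed.

(** A symbol for j+1 users is built from windows of at most j users; N stands for any time by which
    those windows are over. *)
Lemma symbol_causal h J h' J' z j (S : {set 'I_K}) p N : (0 < w)%N ->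
  (forall n, (n < N)%N -> h n = h' n) -> (forall n, (n < N)%N -> J n = J' n) ->
  (forall (S' : {set 'I_K}) t, S' != finset.set0 -> (#|S'| <= j)%N -> (t < window_len #|S'|)%N ->
     (slot S' t < N)%N) ->
  #|S| = j.+1 -> symbol h J z j S p = symbol h' J' z j S p.
Proof.
move=> w0 hh JJ; elim: j S p => [//|j IH] S p sN Sj.
apply: eq_bigr => r rS; congr (_ * _).
have Sr : #|S :\ r| = j.+1 by have := cardsD1 r S; rewrite rS Sj add1n => -[<-].
have S0 : S :\ r != finset.set0 by rewrite -card_gt0 Sr.
have -> : open_slot J (S :\ r) r = open_slot J' (S :\ r) r.
  rewrite /open_slot; congr nth; apply: eq_in_filter => t; rewrite mem_iota => tS.
  by rewrite JJ// sN// Sr.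
apply: eq_bigr => i _; rewrite hh; last first.
  by apply: sN => //; rewrite ?Sr// -Sr open_slot_lt.
congr (_ * _); apply: eq_bigr => p' _; congr (_ * _); apply: IH => //.
by move=> S' t S0' jS'; apply: sN => //; exact: leqW.
Qed.

Lemma transmit_causal h J h' J' z n : (0 < w)%N -> (n < block_len)%N ->
  (forall m, (m < n)%N -> h m = h' m) -> (forall m, (m < n)%N -> J m = J' m) ->
  transmit h J z n = transmit h' J' z n.
Proof.
move=> w0 nT hh JJ; rewrite /transmit.
case E : (nth _ _ n) => [A t] /=.
have := mem_nth (finset.set0, 0%N) nT; rewrite E mem_schedule => /andP[A0 tA].
have nA : n = slot A t by rewrite /slot -E index_uniq// uniq_schedule.
apply/matrixP => i o; rewrite !mxE; apply: eq_bigr => p _; congr (_ * _).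
apply: (@symbol_causal h J h' J' z _ A p n) => //; last by rewrite prednK// card_gt0.
move=> S' t' S0' S'A tS'; rewrite nA; apply: slot_order => //.
by move: S'A A0; rewrite -card_gt0; case: #|A|.
Qed.

End scheme.

(** * Successive decoding, from order K down to the data symbols *)

Section decodability.
Variables (F : numFieldType) (K w L : nat).
Local Notation window_len := (window_len K w).
Local Notation window_eqs := (window_eqs K L).
Local Notation num_symbols := (num_symbols K L).
Local Notation slot := (@slot K w).
Local Notation open_slot := (@open_slot K w).
Local Notation block_len := (block_len K w).
Local Notation inputs := 'M[F]_(K, num_symbols 1).
Variables (h : nat -> 'I_K -> 'rV[F]_K) (J : nat -> 'I_K -> bool).
Local Notation observe := (@observe F K w L h J).
Local Notation symbol := (@symbol F K w L h J).
Local Notation window_obs := (@window_obs F K w L h).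

(* f is a linear combination of what user k observes while it is not jammed;
   only the resulting inequality is recorded. *)
Definition determined (k : 'I_K) (f : inputs -> F) :=
  exists2 C : F, 0 <= C & forall z, `|f z| <=
    C * \sum_(n < block_len | ~~ J n k) `|observe z k n|.

Lemma determined_sum k (I : Type) (s : seq I) (Q : pred I) (c : I -> F)
    (f : I -> inputs -> F) : (forall i, Q i -> determined k (f i)) ->
  determined k (fun z => \sum_(i <- s | Q i) c i * f i z).
Proof.
move=> kf; elim: s => [|i s [C C0 IH]].
  by exists 0 => // z; rewrite big_nil normr0 mul0r.
have [Qi|Qi] := boolP (Q i); last first.
  by exists C => // z; rewrite big_cons (negbTE Qi).
have [D D0 fD] := kf i Qi; exists (`|c i| * D + C).
  by rewrite addr_ge0// mulr_ge0.
move=> z; rewrite big_cons Qi (le_trans (ler_normD _ _))// mulrDl lerD//.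
by rewrite normrM -mulrA ler_wpM2l.
Qed.

Lemma determined_eq k f g : (forall z, f z = g z) -> determined k f ->
  determined k g.
Proof. by move=> fg [C C0 kf]; exists C => // z; rewrite -fg. Qed.

Lemma determinedB k f g : determined k f -> determined k g ->
  determined k (fun z => f z - g z).
Proof.
move=> kf kg; apply: (@determined_eq _ (fun z =>
    \sum_(i <- [:: (1, f); (-1, g)]) i.1 * i.2 z)).
  by move=> z; rewrite big_cons big_seq1 /= mul1r mulN1r.
rewrite [X in determined _ X](_ : _ = fun z => \sum_(i < 2)
    (if val i == 0%N then 1 else -1) * (if val i == 0%N then f else g) z).
  by apply: determined_sum => i _; case: ifP.
by apply/funext => z; rewrite big_cons big_seq1 big_ord_recl big_ord1.
Qed.

Lemma determined_obs k (S : {set 'I_K}) t : S != finset.set0 ->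
  (t < window_len #|S|)%N -> ~~ J (slot S t) k ->
  determined k (fun z => window_obs (symbol z #|S|.-1) S k t).
Proof.
move=> S0 tS Jk; exists 1 => // z; rewrite mul1r -observe_slot//.
by rewrite (bigD1 (Ordinal (slot_lt S0 tS)))//= lerDl sumr_ge0.
Qed.

Lemma determined_solve k n (A : 'M[F]_n) (g : 'I_n -> inputs -> F) :
  \det A != 0 ->
  (forall m, determined k (fun z => \sum_p A m p * g p z)) ->
  forall p, determined k (g p).
Proof.
move=> detA kA p.
apply: (@determined_eq _ (fun z => \sum_m invmx A p m * \sum_q A m q * g q z)).
  move=> z; pose v : 'cV[F]_n := \col_q g q z.
  have -> : g p z = (invmx A *m (A *m v)) p 0.
    by rewrite mulKmx ?mxE// unitmxE unitfE.
  rewrite [RHS]mxE; apply: eq_bigr => m _; congr (_ * _).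
  by rewrite mxE; apply: eq_bigr => q _; rewrite mxE.
exact: determined_sum.
Qed.

(* To recover the symbols of S, user k \in S uses its own equations and those
   overheard by the users outside S: equation number m is the one received by
   source S k m in the open slot number m %% window_eqs #|S|. *)
Definition source (S : {set 'I_K}) k m : 'I_K :=
  nth k (enum (k |: ~: S)) (m %/ window_eqs #|S|).
Definition source_slot (S : {set 'I_K}) k m : nat :=
  open_slot J S (source S k m) (m %% window_eqs #|S|).
Definition precoder (S : {set 'I_K}) k m : 'M[F]_(K, num_symbols #|S|) :=
  \matrix_(i, p) node F (source_slot S k m) i ^+ p.
Definition window_det (S : {set 'I_K}) k : F :=
  @row_det F K (num_symbols #|S|) (fun m => precoder S k m)
    (fun m => h (slot S (source_slot S k m)) (source S k m)).

Lemma source_ltn (S : {set 'I_K}) k m : k \in S -> (m < num_symbols #|S|)%N ->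
  (0 < window_eqs #|S|)%N /\ (m %/ window_eqs #|S| < size (enum (k |: ~: S)))%N.
Proof.
move=> kS mS.
have e0 : (0 < window_eqs #|S|)%N.
  by move: mS; rewrite /num_symbols; case: window_eqs => //; rewrite muln0.
have cS : #|~: S| = (K - #|S|)%N.
  by rewrite -[X in (X - _)%N](card_ord K) -(cardsC S) addKn.
by split => //; rewrite -cardE cardsU1 !inE kS /= cS add1n ltn_divLR.
Qed.

Lemma source_in (S : {set 'I_K}) k m : k \in S -> (m < num_symbols #|S|)%N ->
  source S k m \in k |: ~: S.
Proof.
by move=> kS /(source_ltn kS)[_ mS]; rewrite -mem_enum mem_nth.
Qed.

Hypothesis typJ : @typical K w L J.
Hypothesis det0 : forall (S : {set 'I_K}) k, k \in S -> window_det S k != 0.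

(** Descending induction on the order. The equations that k lacks in the window of S were overheard
    by users r outside S, and each of them is an ingredient of the symbols of [r |: S], which have
    higher order and contain k. *)
Lemma determined_symbol k j (S : {set 'I_K}) : #|S| = j.+1 -> k \in S ->
  forall p, (p < num_symbols j.+1)%N -> determined k (fun z => symbol z j S p).
Proof.
have [n jn] := ubnP (K - j); elim: n => // n IH in j jn S *.
move=> Sj kS p pj.
have S0 : S != finset.set0 by rewrite -card_gt0 Sj.
rewrite -Sj in pj.
suff H (q : 'I_(num_symbols #|S|)) : determined k (fun z => symbol z j S q).
  exact: (H (Ordinal pj)).
apply: (determined_solve (det0 kS) (g := fun q z => symbol z j S q)) => m {q p pj}.
set r := source S k m; set t := source_slot S k m.
apply: (@determined_eq _ (fun z => window_obs (symbol z #|S|.-1) S r t)).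
  move=> z; rewrite (_ : #|S|.-1 = j) ?Sj//.
  under [RHS]eq_bigr => p _ do rewrite !mxE mulr_suml.
  rewrite exchange_big; apply: eq_bigr => i _ /=; rewrite mulr_sumr.
  by apply: eq_bigr => p _; rewrite mxE mulrA.
have [e0 _] := source_ltn kS (ltn_ord m).
have lS : (m %% window_eqs #|S| < window_eqs #|S|)%N by rewrite ltn_mod.
have [tS Jt] := open_slotP r typJ S0 lS.
have := source_in kS (ltn_ord m); rewrite -/r !inE => /orP[/eqP rk|rS].
  by rewrite rk in Jt *; apply: determined_obs => //; rewrite /t /source_slot -/r rk.
have jK : (j.+1 < K)%N.
  rewrite -Sj -[X in (_ < X)%N](card_ord K) -cardsT proper_card//.
  by apply/properP; split; [exact: finset.subsetT|exists r; rewrite ?inE].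
pose T := r |: S.
have kT : k \in T by rewrite !inE kS orbT.
have rT : r \in T by rewrite !inE eqxx.
have Tj : #|T| = j.+2 by rewrite cardsU1 rS Sj.
have kr : k != r by apply: contraNneq rS => <-.
set l := (m %% window_eqs #|S|)%N in lS.
have lj : (l < window_eqs j.+1)%N by rewrite -Sj.
pose g (r' : 'I_K) z := window_obs (symbol z #|T :\ r'|.-1) (T :\ r') r'
  (open_slot J (T :\ r') r' l).
have Tr r' : r' \in T -> #|T :\ r'| = j.+1.
  by move=> r'T; have := cardsD1 r' T; rewrite r'T Tj add1n => -[<-].
suff : determined k (g r).
  by rewrite /g /T setU1K.
(* The ingredient contributed by k itself was received by k in the window of [T :\ k]; removing it
   leaves one unknown for each other user of T. *)
have Gk : determined k (g k).
  have T0 : T :\ k != finset.set0 by rewrite -card_gt0 Tr.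
  have lT : (l < window_eqs #|T :\ k|)%N by rewrite Tr.
  by have [? ?] := open_slotP k typJ T0 lT; exact: determined_obs.
have cTk : #|T :\ k| = j.+1 by exact: Tr.
(* The powers q below j+1 give as many equations as there are users in [T :\ k], with distinct user
   numbers as nodes. *)
pose A : 'M[F]_(#|T :\ k|) :=
  Vandermonde _ (\row_i (enum_val i : 'I_K)%:R).
have detA : \det A != 0.
  rewrite det_Vandermonde; apply/prodf_neq0 => a _; apply/prodf_neq0 => b ab.
  rewrite !mxE subr_eq0 eqr_nat; apply: contraTneq ab => e.
  by rewrite -leqNgt (enum_val_inj (val_inj e)).
have rTk : r \in T :\ k by rewrite !inE eq_sym kr eqxx.
have := determined_solve detA (g := fun i => g (enum_val i)).
move=> /(_ k); rewrite -(enum_rankK_in rTk rTk); apply => q.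
apply: (@determined_eq _ (fun z => symbol z j.+1 T (q * window_eqs j.+1 + l)
    - k%:R ^+ q * g k z)).
  move=> z; rewrite symbolS//.
  rewrite (_ : \sum_(i in T) _ = k%:R ^+ q * g k z +
    \sum_(i in T | i != k) (i : 'I_K)%:R ^+ q * g i z); last by rewrite (bigD1 k).
  rewrite addrAC subrr add0r.
  transitivity (\sum_(i in T :\ k) (i : 'I_K)%:R ^+ q * g i z).
    by apply: eq_bigl => i; rewrite !inE andbC.
  rewrite big_enum_val; apply: eq_bigr => i _; by rewrite !mxE.
apply: determinedB; last first.
  rewrite [X in determined _ X](_ : _ = fun z => \sum_(i < 1) k%:R ^+ q * g k z).
    exact: determined_sum.
  by apply/funext => z; rewrite big_ord1.
apply: IH => //; first by move: jn jK; clear; lia.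
rewrite num_symbolsS ?jK//.
have := ltn_ord q; rewrite [X in (_ < X)%N]cTk => qj.
rewrite (@leq_trans (q * window_eqs j.+1 + window_eqs j.+1))// ?ltn_add2l//.
by rewrite addnC -mulSn leq_mul2r qj orbT.
Qed.

Lemma determined_input k (q : 'I_(num_symbols 1)) :
  determined k (fun z : inputs => z k q).
Proof.
have := @determined_symbol k 0 ([set k])%SET _ _ q (ltn_ord q).
rewrite cards1 inE => /(_ erefl (eqxx k)); apply: determined_eq => z /=.
case: pickP => [k'|/(_ k)]; rewrite inE ?eqxx// => /eqP ->.
by rewrite valK.
Qed.

End decodability.

(** * Almost sure regularity of the window matrices *)

Section generic_channel.
Variables (K w L : nat) (J : nat -> 'I_K -> bool).
Hypothesis typJ : @typical K w L J.
Local Notation window_eqs := (window_eqs K L).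
Local Notation num_symbols := (num_symbols K L).

(** Distinct equations of a window come from distinct pairs of slot and user. This makes both the
    Vandermonde nodes distinct and the channel rows independent. *)
Lemma source_pair_inj (S : {set 'I_K}) k : k \in S ->
  injective (fun m : 'I_(num_symbols #|S|) =>
    (source_slot w L J S k m, source L S k m)).
Proof.
move=> kS m m'; have [e0 mS] := source_ltn kS (ltn_ord m).
have [_ mS'] := source_ltn kS (ltn_ord m').
move=> [] /[swap] /eqP; rewrite /source nth_uniq// ?enum_uniq// => /eqP qq.
have S0 : S != finset.set0 by apply: contraTneq kS => ->; rewrite inE.
have ll x : (x %% window_eqs #|S| < size (open_slots w J S (source L S k m)))%N.
  by rewrite (leq_trans _ (typicalP _ typJ S0))// ltn_mod.
rewrite /source_slot /source -qq => /eqP; rewrite nth_uniq// ?filter_uniq ?iota_uniq//.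
move=> /eqP ee; apply: val_inj => /=.
by rewrite (divn_eq m (window_eqs #|S|)) qq ee -divn_eq.
Qed.

Lemma node_inj (F : numFieldType) t i t' i' :
  @node F K t i = node F t' i' -> (t, i) = (t', i').
Proof.
move/eqP; rewrite eqr_nat => /eqP e.
have K0 : (0 < K)%N by exact: leq_ltn_trans (ltn_ord i).
have tt : t = t'.
  have := congr1 (divn^~ K) e; rewrite !divnMDl//.
  by rewrite !divn_small ?ltn_ord// !addn0.
congr (_, _); first exact: tt.
by apply: val_inj; apply/eqP; rewrite -(eqn_add2l (t * K)) e tt.
Qed.

(* If the channel row of user r is the r-th unit vector, the matrix of the
   window is a Vandermonde matrix. *)
Lemma window_det_nonzero (F : numFieldType) (S : {set 'I_K}) k : k \in S ->
  @row_det F K (num_symbols #|S|) (fun m => precoder F w L J S k m)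
    (fun m => delta_mx 0 (source L S k m)) != 0.
Proof.
move=> kS; rewrite /row_det.
rewrite (_ : matrix_of_fun _ _ = (Vandermonde (num_symbols #|S|)
  (\row_(m < num_symbols #|S|) node F (source_slot w L J S k m) (source L S k m)))^T).
  rewrite det_tr det_Vandermonde; apply/prodf_neq0 => a _; apply/prodf_neq0 => b ab.
  rewrite !mxE subr_eq0; apply: contraTneq ab => /node_inj/(source_pair_inj kS) ->.
  by rewrite ltnn.
apply/matrixP => m p; rewrite !mxE (bigD1 (source L S k m))//= !mxE !eqxx mul1r.
rewrite big1 ?addr0// => i /negbTE ir.
by rewrite !mxE ir andbF mul0r.
Qed.

Lemma window_det_null d (T : measurableType d) (R : realType)
    (P : probability T R) (X : nat * 'I_K -> T -> 'rV[R[i]]_K)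
    (S : {set 'I_K}) k :
  (forall i, measurable_fun setT (X i)) -> mutually_independent P X ->
  (forall i, hyperplane_null P (X i)) -> k \in S ->
  P [set v | window_det w L (fun n r => X (n, r) v) J S k = 0] = 0%E.
Proof.
move=> mX iX nX kS.
have S0 : S != finset.set0 by apply: contraTneq kS => ->; rewrite inE.
pose s := [tuple (slot w S (source_slot w L J S k m), source L S k m)
  | m < num_symbols #|S|].
have us : uniq s.
  apply/tuple_uniqP => m m'; rewrite !tnth_mktuple => -[e1 e2].
  apply: (source_pair_inj kS); congr (_, _) => //.
  have [e0 _] := source_ltn kS (ltn_ord m).
  have [tS _] := open_slotP (source L S k m) typJ S0 (ltn_pmod m e0).
  by have [] := slot_inj S0 tS e1.
have -> : [set v | window_det w L (fun n r => X (n, r) v) J S k = 0] =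
    [set v | row_det (fun m => precoder R[i] w L J S k m)
       (fun m => X (tnth s m) v) = 0].
  apply/funext => v; congr (_ = 0); congr (row_det _ _).
  by apply/funext => m; rewrite tnth_mktuple.
exact: row_det_null mX iX nX us (window_det_nonzero _ kS).
Qed.

End generic_channel.

(** * Channels on which a block can be decoded *)

Lemma bigcap_countable_measurable d (T : measurableType d) (U : countType)
    (D : set U) (F : U -> set T) :
  (forall i, measurable (F i)) -> measurable (\bigcap_(i in D) F i).
Proof.
move=> mF; rewrite -[X in measurable X]setCK setC_bigcap; apply: measurableC.
rewrite bigcup_mkcond; apply: countable_bigcupT_measurable => // i.
by case: ifP => // _; exact: measurableC.
Qed.

Section measurable_scheme.
Context {R : realType} {d} {T : measurableType d} (K w L : nat).
Variables (h : T -> nat -> 'I_K -> 'rV[R[i]]_K) (J : T -> nat -> 'I_K -> bool).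

Lemma measurable_open_slots (S : {set 'I_K}) r (Q : set (seq nat)) :
  (forall n r, measurable [set v | J v n r]) ->
  measurable [set v | Q (open_slots w (J v) S r)].
Proof.
move=> mJ; pose W := window_len K w #|S|.
pose b (t : 'I_W) v := J v (slot w S t) r.
rewrite (_ : [set v | _] = [set v |
    [set x : {ffun 'I_W -> bool} | Q [seq t <- iota 0 W |
      ~~ (if insub t is Some t' then x t' else false)]] [ffun t => b t v]]).
  by apply: measurable_finite_pattern => t; exact: mJ.
apply/funext => v /=; congr (Q _); apply: eq_in_filter => t.
by rewrite mem_iota => tW; rewrite insubT ffunE.
Qed.

Lemma measurable_typical : (forall n r, measurable [set v | J v n r]) ->
  measurable [set v | typical w L (J v)].
Proof.
move=> mJ; rewrite (_ : [set v | _] =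
  \bigcap_(S in [set S : {set 'I_K} | S != finset.set0]) \bigcap_(r in setT)
    [set v | [set s : seq nat | (window_eqs K L #|S| <= size s)%N] (open_slots w (J v) S r)]).
  apply: fin_bigcap_measurable => // S _; apply: fin_bigcap_measurable => // r _.
  exact: measurable_open_slots.
apply/seteqP; split => v /=.
  by move=> tv S S0 r _ /=; exact: typicalP.
move=> tv; apply/forallP => S; apply/implyP => S0; apply/forallP => r.
exact: (tv S S0 r Logic.I).
Qed.

Hypothesis mJ : forall n r, measurable [set v | J v n r].
Hypothesis mh : forall n r, measurable_fun setT (fun v => h v n r).

Lemma measurable_window_obs s (S : {set 'I_K}) r t :
  (forall p, measurable_fun setT (fun v => s v S p)) ->
  measurable_fun setT (fun v => window_obs w L (h v) (s v) S r t).
Proof.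
move=> ms; apply: measurable_complex_sum => i _; apply: measurable_complexM.
  exact: measurable_fun_entry.
by apply: measurable_complex_sum => p _; apply: measurable_complexM.
Qed.

Lemma measurable_symbol z j S p :
  measurable_fun setT (fun v => symbol w (h v) (J v) (z : 'M[R[i]]_(K, num_symbols K L 1)) j S p).
Proof.
elim: j S p => [|j IH] S p //=.
apply: measurable_complex_sum => r _; apply: measurable_complexM => //.
pose l := (p %% window_eqs K L j.+1)%N.
apply: (@measurable_fun_select _ _ _ _ nat (fun v => open_slot w (J v) (S :\ r) r l)
  (fun t v => window_obs w L (h v) (symbol w (h v) (J v) z j) (S :\ r) r t)).
  move=> c; rewrite /open_slot.
  exact: (@measurable_open_slots (S :\ r) r [set s | nth 0%N s l = c]).
by move=> t; exact: measurable_window_obs.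
Qed.

Lemma measurable_transmit z n :
  measurable_fun setT (fun v => transmit w (h v) (J v) (z : 'M[R[i]]_(K, num_symbols K L 1)) n).
Proof.
apply: measurable_fun_matrix => i o; under eq_fun do rewrite mxE.
apply: measurable_complex_sum => p _; apply: measurable_complexM => //.
exact: measurable_symbol.
Qed.

Lemma measurable_observe z r n :
  measurable_fun setT (fun v => observe w (h v) (J v) (z : 'M[R[i]]_(K, num_symbols K L 1)) r n).
Proof.
exact: measurable_dot (mh n r) (measurable_transmit z n).
Qed.

End measurable_scheme.

Lemma typical_ext K w L (J J' : nat -> 'I_K -> bool) :
  (forall n, (n < block_len K w)%N -> J n = J' n) ->
  typical w L J = typical w L J'.
Proof.
move=> JJ; apply: eq_forallb => S; case: (boolP (S != finset.set0)) => //= S0.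
apply: eq_forallb => r; congr (_ <= size _)%N; apply: eq_in_filter => t.
by rewrite mem_iota => tS; rewrite JJ// slot_lt.
Qed.

Section good_channel.
Variables (R : realType) (K w L : nat).
Local Notation block_len := (block_len K w).
Local Notation inputs := 'M[R[i]]_(K, num_symbols K L 1).
Local Notation pattern := {ffun 'I_block_len * 'I_K -> bool}.

(** Only finitely many patterns concern a block, so one constant and one null set can serve all of
    them. *)
Definition jamming (x : pattern) (n : nat) (r : 'I_K) : bool :=
  if insub n is Some n' then x (n', r) else false.

Definition gauss_int (z : int * int) : R[i] := Complex (z.1)%:~R (z.2)%:~R.

(* The channel h of a block is good if, whatever the typical jamming pattern,
   inputs on the lattice of Gaussian integers that differ for user k are
   separated at receiver k, and no antenna needs too much power. *)
Definition good_channel (c : nat) (h : nat -> 'I_K -> 'rV[R[i]]_K) : Prop :=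
  forall x : pattern, typical w L (jamming x) ->
    (forall k (z : 'M[int * int]_(K, num_symbols K L 1)),
       (exists q, z k q != (0, 0)) ->
       exists2 n : 'I_block_len, ~~ jamming x n k &
         c.+1%:R^-1 <= sqmodc (observe w h (jamming x) (map_mx gauss_int z) k n)) /\
    (forall k q (n : 'I_block_len) i,
       sqmodc (transmit w h (jamming x) (delta_mx k q : inputs) n i 0) <= c%:R).

Lemma good_channel_mono c c' h : (c <= c')%N ->
  good_channel c h -> good_channel c' h.
Proof.
move=> cc' gc x tx; have [gc1 gc2] := gc x tx; split.
  move=> k z /(gc1 k z)[n Jn hn]; exists n => //; apply: le_trans hn.
  by rewrite lef_pV2 ?posrE ?ltr0n// ler_nat.
by move=> k q n i; rewrite (le_trans (gc2 _ _ _ _))// ler_nat.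
Qed.

(** The lattice of inputs is countable and everything else ranges over finite types, so countable
    intersections suffice. *)
Lemma measurable_good_channel d (T : measurableType d) c
    (h : T -> nat -> 'I_K -> 'rV[R[i]]_K) :
  (forall n r, measurable_fun setT (fun v => h v n r)) ->
  measurable [set v | good_channel c (h v)].
Proof.
move=> mh; rewrite (_ : [set v | _] =
  \bigcap_(x in [set x : pattern | typical w L (jamming x)])
   ((\bigcap_(k in [set: 'I_K]) \bigcap_(z in [set z : 'M[int * int]_(K, num_symbols K L 1) |
       exists q, z k q != (0, 0)])
       \bigcup_(n in [set n : 'I_block_len | ~~ jamming x n k])
         [set v | c.+1%:R^-1 <=
            sqmodc (observe w (h v) (jamming x) (map_mx gauss_int z) k n)]) `&`
    (\bigcap_(k in [set: 'I_K]) \bigcap_(q in [set: 'I_(num_symbols K L 1)])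
     \bigcap_(n in [set: 'I_block_len]) \bigcap_(i in [set: 'I_K])
       [set v | sqmodc (transmit w (h v) (jamming x) (delta_mx k q : inputs) n i 0) <= c%:R]))).
  have mle (f g : T -> R) : measurable_fun setT f -> measurable_fun setT g ->
      measurable [set v | f v <= g v].
    move=> mf mg; rewrite -[X in measurable X]setTI.
    by have /(_ [set true]) := measurable_fun_ler mf mg measurableT; apply.
  apply: fin_bigcap_measurable => // x _.
  have mx n r : measurable [set v : T | jamming x n r].
    case: (jamming x n r).
      by rewrite (_ : [set _ | _] = setT)//; apply/seteqP; split.
    by rewrite (_ : [set _ | _] = set0)//; apply/seteqP; split.
  apply: measurableI.
    apply: fin_bigcap_measurable => // k _.
    apply: bigcap_countable_measurable => z; apply: fin_bigcup_measurable => // n _.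
    apply: mle => //; apply: measurable_sqmodc; apply: measurable_observe => //.
  do 4 (apply: fin_bigcap_measurable => // ? _).
  apply: mle => //; apply: measurable_sqmodc; apply: measurable_fun_entry.
  exact: measurable_transmit.
apply/seteqP; split => v /=.
  move=> gv x tx; have [g1 g2] := gv x tx; split.
    by move=> k _ z zk; have [n ? ?] := g1 k z zk; exists n.
  by move=> k _ q _ n _ i _ /=; exact: g2.
move=> gv x tx; have [g1 g2] := gv x tx; split.
  by move=> k z zk; have [n ? ?] := g1 k Logic.I z zk; exists n.
by move=> k q n i; exact: (g2 k Logic.I q Logic.I n Logic.I i Logic.I).
Qed.

End good_channel.

Section complex_modulus.
Context {R : realType}.

Definition cabs (z : R[i]) : R := Num.sqrt (sqmodc z).

Lemma sqmodc_ge0 (z : R[i]) : 0 <= sqmodc z.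
Proof. by rewrite addr_ge0// sqr_ge0. Qed.

Lemma sqr_cabs z : cabs z ^+ 2 = sqmodc z.
Proof. by rewrite sqr_sqrtr// sqmodc_ge0. Qed.

Lemma cabs_ge0 z : 0 <= cabs z. Proof. exact: sqrtr_ge0. Qed.

Lemma normcE (z : R[i]) : `|z| = (cabs z)%:C%C.
Proof. by case: z => a b; rewrite normc_def. Qed.

Lemma cabsD x y : cabs (x + y) <= cabs x + cabs y.
Proof. by have := ler_normD x y; rewrite !normcE -rmorphD lecR. Qed.

Lemma cabsM x y : cabs (x * y) = cabs x * cabs y.
Proof. by have := normrM x y; rewrite !normcE -rmorphM => -[]. Qed.

Lemma cabsN x : cabs (- x) = cabs x.
Proof. by have := normrN x; rewrite !normcE => -[]. Qed.

Lemma cabs_sum (I : Type) (s : seq I) (Q : pred I) (f : I -> R[i]) :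
  cabs (\sum_(i <- s | Q i) f i) <= \sum_(i <- s | Q i) cabs (f i).
Proof.
elim/big_rec2: _ => [|i y x _ xy]; first by rewrite /cabs /sqmodc /= expr0n addr0 sqrtr0.
by rewrite (le_trans (cabsD _ _))// lerD2l.
Qed.

Lemma sqmodc_le z (a : R) : 0 <= a -> (sqmodc z <= a ^+ 2) = (cabs z <= a).
Proof.
by move=> a0; rewrite -sqr_cabs ler_pXn2r// ?nnegrE// cabs_ge0.
Qed.

Lemma cabs_gauss_int (z : int * int) : z != (0, 0) -> 1 <= cabs (gauss_int R z).
Proof.
move=> z0; rewrite -[1]sqrtr1 ler_wsqrtr// /sqmodc /gauss_int /=.
have int1 (n : int) : n != 0 -> 1 <= (n%:~R : R) ^+ 2.
  by move=> n0; rewrite -rmorphXn /= ler1z; move: n0; nia.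
case: z z0 => a b /= ab; have [a0|/int1 a1] := eqVneq a 0.
  have [b0|/int1 b1] := eqVneq b 0; first by rewrite a0 b0 eqxx in ab.
  by rewrite (le_trans b1)// lerDr sqr_ge0.
by rewrite (le_trans a1)// lerDl sqr_ge0.
Qed.

End complex_modulus.

Lemma finite_uniform_bound (I : finType) (Q : I -> nat -> Prop) :
  (forall i m n, (m <= n)%N -> Q i m -> Q i n) ->
  (forall i, exists n, Q i n) -> exists n, forall i, Q i n.
Proof.
move=> mono /choice[f fQ]; exists (\max_i f i) => i.
by apply: mono (fQ i); exact: leq_bigmax.
Qed.

Section good_channel_probability.
Variables (R : realType) (K w L : nat).
Local Notation block_len := (block_len K w).
Local Notation inputs := 'M[R[i]]_(K, num_symbols K L 1).
Local Notation pattern := {ffun 'I_block_len * 'I_K -> bool}.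
Implicit Types h : nat -> 'I_K -> 'rV[R[i]]_K.

(** Regular windows bound each input by a constant times its open observations. A nonzero Gaussian
    integer has modulus at least 1, so the observations cannot all be small. *)
Lemma good_channel_exists h :
  (forall (x : pattern) (S : {set 'I_K}) k, typical w L (jamming x) -> k \in S ->
     window_det w L h (jamming x) S k != 0) ->
  exists c, good_channel w L c h.
Proof.
move=> det0.
pose Q1 (xkq : pattern * 'I_K * 'I_(num_symbols K L 1)) (c : nat) :=
  typical w L (jamming xkq.1.1) ->
  forall z : 'M[int * int]_(K, num_symbols K L 1), z xkq.1.2 xkq.2 != (0, 0) ->
       exists2 n : 'I_block_len, ~~ jamming xkq.1.1 n xkq.1.2 &
         c.+1%:R^-1 <= sqmodc (observe w h (jamming xkq.1.1)
           (map_mx (gauss_int R) z) xkq.1.2 n).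
have [c1 hc1] : exists c, forall i, Q1 i c.
  apply: finite_uniform_bound => [[[x k] q] m n mn Qm tx z zk|[[x k] q]].
    have [l Jl hl] := Qm tx z zk; exists l => //; apply: le_trans hl.
    by rewrite lef_pV2 ?posrE ?ltr0n// ler_nat.
  have [tx|ntx] := boolP (typical w L (jamming x)); last first.
    by exists 0%N => /=; rewrite /Q1 /= (negbTE ntx).
  have [C C0 HC] := determined_input tx (fun S k kS => det0 x S k tx kS) k q.
  have CE : C = (cabs C)%:C%C by rewrite -normcE ger0_norm.
  pose D := cabs C * block_len%:R.
  have D0 : 0 <= D by rewrite mulr_ge0// cabs_ge0.
  (* With this threshold, observations that are all below it would give 1 <= D e with e ^+ 2 = 1 /
     (c + 1), although D ^+ 2 < c. *)
  exists (Num.bound (D ^+ 2)) => _ z /= zk; apply: contrapT => nh.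
  set c := Num.bound (D ^+ 2) in nh; pose e := Num.sqrt c.+1%:R^-1 : R.
  have he (n : 'I_block_len) : ~~ jamming x n k ->
      cabs (observe w h (jamming x) (map_mx (gauss_int R) z) k n) <= e.
    move=> Jn; apply: ler_wsqrtr; rewrite leNgt; apply/negP => /ltW lt.
    by apply: nh; exists n.
  have : 1 <= D * e.
    apply: (le_trans (cabs_gauss_int zk)).
    have := HC (map_mx (gauss_int R) z); rewrite mxE normcE CE.
    under eq_bigr do rewrite normcE.
    rewrite -rmorph_sum -rmorphM lecR => /le_trans; apply.
    rewrite /D -mulrA ler_wpM2l ?cabs_ge0//.
    apply: (@le_trans _ _ (\sum_(n < block_len) e)); last first.
      by rewrite sumr_const card_ord mulr_natl.
    rewrite [leRHS](bigID (fun n : 'I__ => ~~ jamming x n k))/= -[leLHS]addr0 lerD//.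
      exact: ler_sum.
    by rewrite sumr_ge0// => n _; exact: sqrtr_ge0.
  rewrite -(ler_pXn2r (n := 2))// ?nnegrE ?mulr_ge0 ?sqrtr_ge0//.
  rewrite expr1n exprMn sqr_sqrtr ?invr_ge0// ler_pdivlMr ?ltr0n// mul1r.
  apply/negP; rewrite -ltNge; apply: (@lt_le_trans _ _ c%:R).
    exact/archi_boundP/sqr_ge0.
  by rewrite ler_nat.
pose Q2 (i : pattern * 'I_K * 'I_(num_symbols K L 1) * 'I_block_len * 'I_K) (c : nat) :=
  sqmodc (transmit w h (jamming i.1.1.1.1)
    (delta_mx i.1.1.1.2 i.1.1.2 : inputs) i.1.2 i.2 0) <= c%:R.
have [c2 hc2] : exists c, forall i, Q2 i c.
  apply: finite_uniform_bound => [i m n mn Qm|i].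
    by apply: (le_trans Qm); rewrite ler_nat.
  exists (Num.bound (sqmodc (transmit w h (jamming i.1.1.1.1)
    (delta_mx i.1.1.1.2 i.1.1.2 : inputs) i.1.2 i.2 0))); apply: ltW.
  exact/archi_boundP/sqmodc_ge0.
exists (maxn c1 c2) => x tx; split => [k z [q zk]|k q n i].
  have [n Jn hn] := hc1 (x, k, q) tx z zk; exists n => //; apply: le_trans hn.
  by rewrite lef_pV2 ?posrE ?ltr0n// ler_nat ltnS leq_maxl.
apply: (le_trans (hc2 (x, k, q, n, i))).
by rewrite ler_nat leq_maxr.
Qed.

(** The exceptional sets decrease in c, and their intersection lies in a finite union of null sets
    where some window determinant vanishes; continuity from above yields c. *)
Lemma good_channel_probability d (T : measurableType d) (P : probability T R)
    (X : nat * 'I_K -> T -> 'rV[R[i]]_K) (e : R) :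
  (forall i, measurable_fun setT (X i)) -> mutually_independent P X ->
  (forall i, hyperplane_null P (X i)) -> 0 < e ->
  exists c, Pr P (~` [set v | good_channel w L c (fun n r => X (n, r) v)]) <= e.
Proof.
move=> mX iX nX e0.
pose B c := ~` [set v | good_channel w L c (fun n r => X (n, r) v)].
have mB c : measurable (B c).
  by apply: measurableC; apply: measurable_good_channel.
pose bad (i : pattern * {set 'I_K} * 'I_K) :=
  [set v | [&& typical w L (jamming i.1.1), i.2 \in i.1.2 &
    window_det w L (fun n r => X (n, r) v) (jamming i.1.1) i.1.2 i.2 == 0]].
have mbad i : measurable (bad i).
  rewrite /bad; case: (typical _ _ _) => /=; last first.
    by rewrite (_ : [set v | _] = set0)//; apply/seteqP; split.
  case: (_ \in _) => /=; last first.
    by rewrite (_ : [set v | _] = set0)//; apply/seteqP; split.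
  rewrite (_ : [set v | _] = (fun v => window_det w L (fun n r => X (n, r) v)
      (jamming i.1.1) i.1.2 i.2) @^-1` [set 0]); last first.
    by apply/seteqP; split => v /= /eqP.
  rewrite -[X in measurable X]setTI; apply: measurable_det => //.
    move=> m p; under eq_fun do rewrite !mxE; apply: measurable_complex_sum => q _.
    by apply: measurable_complexM => //; exact: measurable_fun_entry.
  exact: measurable_complex_set1.
have bad0 i : P (bad i) = 0%E.
  have [tx|ntx] := boolP (typical w L (jamming i.1.1)); last first.
    rewrite (_ : bad i = set0) ?measure0//; apply/seteqP; split => v //=.
    by rewrite /bad /= (negbTE ntx).
  have [kS|nkS] := boolP (i.2 \in i.1.2); last first.
    rewrite (_ : bad i = set0) ?measure0//; apply/seteqP; split => v //=.
    by rewrite /bad /= (negbTE nkS) andbF.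
  rewrite -[RHS](window_det_null tx mX iX nX kS); congr (P _).
  by apply/seteqP; split => v; rewrite /bad /= tx kS /= => /eqP.
have capB : P (\bigcap_c B c) = 0%E.
  apply/eqP; rewrite eq_le measure_ge0 andbT.
  have -> : 0%E = P (\bigcup_(i in [set: pattern * {set 'I_K} * 'I_K]) bad i).
    apply/esym/eqP; rewrite eq_le measure_ge0 andbT.
    have mU : measurable (\bigcup_(i in [set: pattern * {set 'I_K} * 'I_K]) bad i).
      exact: fin_bigcup_measurable.
    apply: (@le_trans _ _ (\sum_(i \in [set: pattern * {set 'I_K} * 'I_K]) P (bad i))%E).
      by apply: content_sub_fsum => //; exact: finite_finset.
    by rewrite fsbig1.
  apply: le_measure; rewrite ?inE.
  - exact: bigcapT_measurable.
  - exact: fin_bigcup_measurable.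
  move=> v Bv; apply: contrapT => nbad.
  have [|c gc] := @good_channel_exists (fun n r => X (n, r) v).
    move=> x S k tx kS; apply/negP => det0; apply: nbad.
    by exists (x, S, k) => //; rewrite /bad /= tx kS.
  exact: (Bv c Logic.I).
have cvB : P (B c) @[c --> \oo] --> 0%E.
  rewrite -capB; apply: nonincreasing_cvg_mu => //.
  - by rewrite -ge0_fin_numE// fin_num_measure.
  - exact: bigcapT_measurable.
  - move=> m n mn; apply/subsetPset; apply: subsetC => v /=.
    exact: good_channel_mono.
have /fine_cvgP[_ /cvgrPdist_le/(_ e e0)] := cvB.
move=> [N _ HN]; exists N; have := HN N (leqnn _).
by rewrite /= sub0r normrN ger0_norm// fine_ge0.
Qed.

End good_channel_probability.

(** * Good and bad blocks *)

Section blocks.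
Variables (len K : nat).

(** Blocks become tuples of one fixed shape at disjoint indices, so an event about a block is the
    preimage of a set that is the same for all blocks. *)
Definition block_index (b : nat) : #|{: 'I_len * 'I_K}|.-tuple (nat * 'I_K) :=
  [tuple ((b * len + (enum_val m).1)%N, (enum_val m).2) | m < #|{: 'I_len * 'I_K}|].

Definition lookup (E : Type) (e : E) (v : #|{: 'I_len * 'I_K}|.-tuple E)
    (n : nat) (r : 'I_K) : E :=
  if insub n is Some n' then tnth v (enum_rank (n' : 'I_len, r)) else e.

Lemma block_index_disjoint b b' : b != b' ->
  uniq (block_index b ++ block_index b').
Proof.
have u c : uniq (block_index c).
  apply/tuple_uniqP => m m'; rewrite !tnth_mktuple => -[/addnI e1 e2].
  by apply: enum_val_inj; move: e1 e2; case: (enum_val m) (enum_val m') =>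
    [x y] [x' y'] /= /val_inj -> ->.
move=> bb; rewrite cat_uniq !u andbT andTb; apply/hasPn => x /tnthP[m ->].
apply/negP => /tnthP[m']; rewrite !tnth_mktuple => -[e _].
move/eqP: bb; apply.
have l0 : (0 < len)%N by exact: leq_ltn_trans (ltn_ord (enum_val m).1).
have := congr1 (divn^~ len) e; rewrite !divnMDl// !divn_small ?ltn_ord//.
by rewrite !addn0.
Qed.

Lemma uniq_block_index b : uniq (block_index b).
Proof.
by have := @block_index_disjoint b b.+1; rewrite cat_uniq => /(_ _)/andP[]//; lia.
Qed.

Lemma lookup_subfamily d (T : measurableType d) d' (E : measurableType d') (e : E)
    (X : nat * 'I_K -> T -> E) b v n r :
  (n < len)%N ->
  lookup e (subfamily X (block_index b) v) n r = X ((b * len + n)%N, r) v.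
Proof.
by move=> nl; rewrite /lookup insubT /= /subfamily tnth_mktuple /block_index tnth_mktuple enum_rankK.
Qed.

Lemma measurable_lookup d (E : measurableType d) (e : E) n r :
  measurable_fun setT (fun v => lookup e v n r).
Proof. by rewrite /lookup; case: insubP => // n' _ _; exact: measurable_tnth. Qed.

Lemma block_event_indep d (T : measurableType d) (R : realType)
    (P : probability T R) d' (E : measurableType d') (X : nat * 'I_K -> T -> E) Q b b' :
  (forall i, measurable_fun setT (X i)) -> mutually_independent P X ->
  measurable Q -> b != b' ->
  P ((subfamily X (block_index b) @^-1` Q) `&` (subfamily X (block_index b') @^-1` Q)) =
  (P (subfamily X (block_index b) @^-1` Q) * P (subfamily X (block_index b') @^-1` Q))%E.
Proof. by move=> mX iX mQ bb; apply: subfamily_indep => //; exact: block_index_disjoint. Qed.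

End blocks.

Section block_events.
Variables (R : realType) (K w L : nat).
Local Notation block_len := (block_len K w).

Lemma good_channel_ext c (h h' : nat -> 'I_K -> 'rV[R[i]]_K) : (0 < w)%N ->
  (forall n, (n < block_len)%N -> h n = h' n) ->
  good_channel w L c h -> good_channel w L c h'.
Proof.
move=> w0 hh gh x tx; have [g1 g2] := gh x tx.
have tE z (n : 'I_block_len) : transmit w h (jamming x) (z : 'M[R[i]]_(K, num_symbols K L 1)) n =
    transmit w h' (jamming x) z n.
  apply: transmit_causal => // m mn; rewrite ?hh//.
  exact: ltn_trans mn (ltn_ord n).
split.
  move=> k z /(g1 k z)[n Jn hn]; exists n => //; move: hn.
  by rewrite /observe tE hh.
by move=> k q n i; rewrite -tE; exact: g2.
Qed.

Definition good_rows c := [set v : #|{: 'I_block_len * 'I_K}|.-tuple 'rV[R[i]]_K |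
  good_channel w L c (lookup 0 v)].

Lemma measurable_good_rows c : measurable (good_rows c).
Proof.
by apply: measurable_good_channel => n r; exact: measurable_lookup.
Qed.

Lemma good_rowsE d (T : measurableType d) (X : nat * 'I_K -> T -> 'rV[R[i]]_K) b c v : (0 < w)%N ->
  good_rows c (subfamily X (block_index _ K b) v) <->
  good_channel w L c (fun n r => X ((b * block_len + n)%N, r) v).
Proof.
move=> w0; split; apply: good_channel_ext => // n nl; apply/funext => r;
  by rewrite lookup_subfamily.
Qed.

Definition small_noise (a : R) (z : R[i]) : bool :=
  (`|complex.Re z| <= a) && (`|complex.Im z| <= a).

Lemma measurable_small_noise a : measurable [set z | small_noise a z].
Proof.
have mball : measurable [set x : R | `|x| <= a].
  rewrite (_ : [set x | _] = `[- a, a]%classic)//.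
  by apply/seteqP; split => x /=; rewrite in_itv/= ler_norml.
rewrite (_ : [set z | _] = (@complex.Re R) @^-1` [set x : R | `|x| <= a] `&`
    (@complex.Im R) @^-1` [set x : R | `|x| <= a]); last first.
  by apply/seteqP; split => z /= /andP.
by apply: measurableI; rewrite -[X in measurable X]setTI;
  [exact: measurable_Re|exact: measurable_Im].
Qed.

Lemma small_noise_probability (e : R) : 0 < e -> exists a : R,
  forall d (T : measurableType d) (P : probability T R) (Z : T -> R[i]),
    measurable_fun setT Z ->
    std_complex_gaussian P Z -> Pr P [set v | ~~ small_noise a (Z v)] <= e.
Proof.
move=> e0; pose g : probability _ R := normal_prob 0 (Num.sqrt (2^-1 : R)).
pose I n := `[- n%:R, n%:R]%classic : set R.
have cv : g (I n) @[n --> \oo] --> 1%E.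
  have -> : 1%E = g (\bigcup_n I n).
    rewrite (_ : \bigcup_n I n = setT) ?probability_setT//.
    apply/seteqP; split => // x _; exists (Num.bound `|x|) => //; rewrite /I /=.
    by rewrite in_itv /= -ler_norml; apply/ltW/archi_boundP.
  apply: nondecreasing_cvg_mu => //.
  - by move=> n; exact: measurable_itv.
  - by apply: bigcupT_measurable => n; exact: measurable_itv.
  - move=> m n mn; apply/subsetPset => x; rewrite /I /= !in_itv /= -!ler_norml.
    by move=> /le_trans; apply; rewrite ler_nat.
(* Half of e, because the real and the imaginary part must both be small: the square of 1 - e/2 is
   at least 1 - e. *)
have /fine_cvgP[_ /cvgrPdist_le/(_ (e / 2))] := cv.
rewrite divr_gt0// => /(_ isT)[N _ /(_ N (leqnn _))] /= hN.
exists N%:R => d T P Z mZ gZ.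
have mA : measurable [set v | small_noise N%:R (Z v)].
  by have := mZ measurableT _ (measurable_small_noise N%:R); rewrite setTI.
rewrite (_ : [set v | _] = ~` [set v | small_noise N%:R (Z v)]); last first.
  by apply/seteqP; split => v /= /negP.
rewrite PrC// /Pr (_ : [set v | _] = [set v | I N (complex.Re (Z v)) /\ I N (complex.Im (Z v))]).
  rewrite gZ; [|exact: measurable_itv..].
  rewrite fineM ?fin_num_measure//; [|exact: measurable_itv..].
  have p0 : 0 <= fine (g (I N)) by exact: fine_ge0.
  have p1 : fine (g (I N)) <= 1.
    by rewrite (Pr_le1 g)//; exact: measurable_itv.
  move: hN; rewrite -/g ger0_norm ?subr_ge0//.
  move: p0 p1; set p := fine _; nra.
apply/seteqP; split => v /=; rewrite /small_noise /I /= !in_itv /= !ler_norml.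
  by move=> /andP.
by move=> [-> ->].
Qed.

End block_events.

Section typical_probability.
Context d (T : measurableType d) (R : realType) (P : probability T R) (K : nat).
Variables (S : nat -> T -> K.-tuple bool) (delta : R).
Hypothesis mS : forall t, measurable_fun setT (S t).
Hypothesis iS : mutually_independent P S.
Hypothesis PS : forall t r, Pr P [set v | tnth (S t v) r] = 1 - delta.

Lemma measurable_jammed t r : measurable [set v | tnth (S t v) r].
Proof.
have := measurableT_comp (measurable_tnth r) (mS t).
move=> /(_ measurableT [set true] I); rewrite setTI.
by rewrite (_ : _ @^-1` _ = [set v | tnth (S t v) r]).
Qed.

Lemma jammed_indep t t' r : t != t' ->
  P ([set v | tnth (S t v) r] `&` [set v | tnth (S t' v) r]) =
  (P [set v | tnth (S t v) r] * P [set v | tnth (S t' v) r])%E.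
Proof.
move=> tt.
have mA : measurable [set s : K.-tuple bool | tnth s r].
  have := measurable_tnth (T := bool) (n := K) r measurableT (I : measurable [set true]).
  by rewrite setTI.
have := iS (A := fun=> [set s : K.-tuple bool | tnth s r]) (_ : uniq [:: t; t']).
rewrite /= !inE tt => /(_ isT (fun=> mA)).
rewrite big_cons big_seq1 => <-; congr (P _).
apply/seteqP; split => v /=.
  by move=> [vt vt'] x /=; rewrite !inE => /orP[/eqP ->|/eqP ->].
by move=> h; split; apply: (h _ _); rewrite /= !inE eqxx ?orbT.
Qed.

(** Union bound over sets and users of the weak law for the jammed slots of one window, each window
    having at least w slots. *)
Lemma typical_probability w L e b : 0 < e -> (0 < w)%N ->
  L%:R <= (delta - e) * w%:R ->
  Pr P [set v | ~~ typical w L (fun n r => tnth (S (b * block_len K w + n)%N v) r)]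
    <= (#|{: {set 'I_K} * 'I_K}|)%:R / (e ^+ 2 * w%:R).
Proof.
move=> e0 w0 Lw.
pose J v n r := tnth (S (b * block_len K w + n)%N v) r.
pose few (i : {set 'I_K} * 'I_K) := if i.1 == finset.set0 then set0 else
  [set v | [set s : seq nat | ~~ (window_eqs K L #|i.1| <= size s)%N]
     (open_slots w (J v) i.1 i.2)].
have mfew i : measurable (few i).
  rewrite /few; case: ifP => // _.
  by apply: measurable_open_slots => n r; exact: measurable_jammed.
have sub : [set v | ~~ typical w L (J v)] `<=` \big[setU/set0]_i few i.
  move=> v /= /forallPn[A]; rewrite negb_imply => /andP[A0 /forallPn[r hr]].
  rewrite (bigD1 (A, r))//=; left; rewrite /few /= (negbTE A0)//.
apply: (le_trans (Pr_le _ _ _ sub)).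
- rewrite (_ : [set v | _] = ~` [set v | typical w L (J v)]).
    by apply: measurableC; apply: measurable_typical => n r; exact: measurable_jammed.
  by apply/seteqP; split => v /= /negP.
- by apply: big_ind => // *; exact: measurableU.
apply: (le_trans (Pr_bigcup_le _ _ mfew)).
rewrite -[X in X%:R / _]sum1_card natr_sum mulr_suml; apply: ler_sum => -[A r] _.
rewrite mul1r /few /=; case: ifPn => [_|A0].
  by rewrite /Pr measure0 invr_ge0 mulr_ge0// exprn_ge0// ltW.
pose W := window_len K w #|A|.
have W0 : (0 < W)%N by rewrite /W /window_len /copies !muln_gt0 !fact_gt0.
pose B (t : 'I_W) := [set v | J v (slot w A t) r].
have mB t : measurable (B t) by exact: measurable_jammed.
(* Too few open slots means many jammed ones: open slots below [copies * L], hence below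
   [(delta - e) * W], leave at least [(1 - delta + e) * W] jammed. *)
apply: (@le_trans _ _ (Pr P [set v | (1 - delta + e) * W%:R <= (\sum_t (v \in B t))%:R])).
  apply: Pr_le.
  - have := mfew (A, r); by rewrite /few /= (negbTE A0).
  - pose bB (t : 'I_W) v := v \in B t.
    rewrite (_ : [set v | _] = [set v | [set x : {ffun 'I_W -> bool} |
        (1 - delta + e) * W%:R <= (\sum_t x t)%:R] [ffun t => bB t v]]).
      apply: measurable_finite_pattern => t.
      by rewrite (_ : [set v | _] = B t)//; apply/seteqP; split => v /=; rewrite inE.
    by apply/funext => v /=; under [in RHS]eq_bigr do rewrite ffunE.
  move=> v /=; rewrite -ltnNge size_filter => hv.
  have cnt : (count (fun t => ~~ J v (slot w A t) r) (iota 0 W) + \sum_t (v \in B t) = W)%N.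
    rewrite -[RHS](size_iota 0 W) -(count_predC (fun t => ~~ J v (slot w A t) r)).
    congr (_ + _)%N; rewrite -sum1_count [RHS]big_mkcond /=.
    rewrite (_ : iota 0 W = index_iota 0 W); last by rewrite /index_iota subn0.
    rewrite big_mkord; apply: eq_bigr => t _.
    by rewrite negbK /B; case: (boolP (J v (slot w A t) r)) => h;
      [rewrite mem_set|rewrite memNset//; exact/negP].
  have {}hv : (count (fun t => ~~ J v (slot w A t) r) (iota 0 W))%:R
      <= (copies K #|A|)%:R * L%:R :> R by rewrite -natrM ler_nat ltnW.
  have cntR : (count (fun t => ~~ J v (slot w A t) r) (iota 0 W))%:R
      + (\sum_t (v \in B t))%:R = W%:R :> R by rewrite -natrD cnt.
  have wl : (copies K #|A|)%:R * L%:R <= (delta - e) * W%:R :> R.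
    by rewrite /W /window_len natrM mulrCA ler_wpM2l.
  rewrite mulrDl mulrBl mul1r; move: hv wl; rewrite mulrBl; lra.
apply: (le_trans (weak_law _ _ _ _ _)) => //.
- by move=> t; rewrite PS.
- move=> t t' tt; apply: jammed_indep; rewrite eqn_add2l.
  apply: contra_neq tt => tt; have [] := slot_inj A0 (ltn_ord t) tt.
  exact: val_inj.
rewrite lef_pV2 ?posrE ?mulr_gt0 ?exprn_gt0 ?ltr0n//.
rewrite ler_wpM2l ?exprn_ge0 ?(ltW e0)// ler_nat /W /window_len leq_pmull//.
by rewrite /copies muln_gt0 !fact_gt0.
Qed.

End typical_probability.

(** If the three kinds together spoil a fraction 3(q + e) of the blocks, one kind alone spoils a
    fraction q + e. The weak law is applied to each kind separately, and a union bound joins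
    them. *)
Lemma count_bad_events d (T : measurableType d) (R : realType)
    (P : probability T R) (B : 'I_3 -> nat -> set T) (q e : R) m :
  (forall i b, measurable (B i b)) -> (forall i b, Pr P (B i b) <= q) ->
  (forall i b b', b != b' -> P (B i b `&` B i b') = (P (B i b) * P (B i b'))%E) ->
  0 < e -> (0 < m)%N ->
  Pr P [set v | (q + e) * 3 * m%:R <= (\sum_(b < m) (v \in \bigcup_i B i b))%:R]
    <= 3 / (e ^+ 2 * m%:R).
Proof.
move=> mB Bq BI e0 m0.
pose A i := [set v | (q + e) * m%:R <= (\sum_(b < m) (v \in B i b))%:R].
have mcount (C : nat -> set T) (x : R) : (forall b, measurable (C b)) ->
    measurable [set v | x <= (\sum_(b < m) (v \in C b))%:R].
  move=> mC; pose bC (b : 'I_m) v := v \in C b.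
  rewrite (_ : [set v | _] = [set v | [set y : {ffun 'I_m -> bool} |
      x <= (\sum_b y b)%:R] [ffun b => bC b v]]).
    apply: measurable_finite_pattern => b.
    by rewrite (_ : [set v | _] = C b)//; apply/seteqP; split => v /=; rewrite inE.
  by apply/funext => v /=; under [in RHS]eq_bigr do rewrite ffunE.
have mA i : measurable (A i) by exact: mcount.
have mU b : measurable (\bigcup_i B i b).
  by apply: fin_bigcup_measurable; [exact: finite_finset|].
apply: (@le_trans _ _ (Pr P (\big[setU/set0]_i A i))).
  apply: Pr_le; first exact: (mcount (fun b => \bigcup_i B i b)).
    by apply: big_ind => // *; exact: measurableU.
  move=> v /= hv; apply: contrapT => nA.
  have lt i : (\sum_(b < m) (v \in B i b))%:R < (q + e) * m%:R.
    rewrite ltNge; apply/negP => Av; apply: nA.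
    by rewrite (bigD1 i)//=; left.
  move: hv; apply/negP; rewrite -ltNge.
  apply: (@le_lt_trans _ _ (\sum_(i < 3) (\sum_(b < m) (v \in B i b))%:R)).
    rewrite -natr_sum ler_nat exchange_big /=; apply: leq_sum => b _.
    case: (boolP (v \in _)) => // /set_mem[i _ Bv].
    by rewrite (bigD1 i)//= mem_set.
  rewrite !big_ord_recl big_ord0 addr0.
  by have := lt ord0; have := lt (lift ord0 ord0);
    have := lt (lift ord0 (lift ord0 ord0)); lra.
apply: (le_trans (Pr_bigcup_le _ _ mA)).
apply: (@le_trans _ _ (\sum_(i < 3) (e ^+ 2 * m%:R)^-1)).
  apply: ler_sum => i _; apply: (weak_law e0 m0) => [b|b|b b' bb'] //; apply: BI.
  by apply: contra_neq bb' => /val_inj.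
by rewrite sumr_const card_ord mulr_natl.
Qed.

(** The jamming states of different users at one time are dependent, so the state vector is kept
    whole; a dummy index in ['I_1] gives it the shape of the other two processes. *)
Lemma mutually_independent_lift d (T : measurableType d) (R : realType)
    (P : probability T R) d' (E : measurableType d') (S : nat -> T -> E) :
  mutually_independent P S ->
  mutually_independent P (fun tk : nat * 'I_1 => S tk.1).
Proof.
move=> iS s A us mA.
have us' : uniq (map fst s).
  by rewrite map_inj_uniq// => -[x a] [y b] /= ->; rewrite (ord1 a) (ord1 b).
have := iS _ (fun t => A (t, ord0)) us' (fun t => mA _).
rewrite big_map (eq_bigr (fun i => P (S i.1 @^-1` A i))).
  move=> <-; congr (P _); apply/seteqP; split => v /= h.
    by move=> t /mapP[[x a] xs /= ->]; have := h (x, a) xs; rewrite /= (ord1 a).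
  by move=> [x a] xs /=; rewrite (ord1 a); apply: h; apply/mapP; exists (x, a).
by move=> [x a] _ /=; rewrite (ord1 a).
Qed.

(** * The three ways in which a block can be spoiled *)

Section block_statistics.
Variables (R : realType) (K : nat) (w L : nat).
Local Notation block_len := (block_len K w).

Section channel_blocks.
Variable c : channel R K.

Definition chan_row (tk : nat * 'I_K) (v : ch_space c) := row tk.2 (chH c tk.1 v).
Definition noise (tk : nat * 'I_K) (v : ch_space c) := chN c tk.1 v tk.2 0.

Definition block_rows b v (n : nat) (r : 'I_K) :=
  chan_row ((b * block_len + n)%N, r) v.
Definition block_jam b v (n : nat) (r : 'I_K) : bool :=
  tnth (chS c (b * block_len + n)%N v) r.

Definition good_block cg a b v :=
  [/\ good_channel w L cg (block_rows b v),
      forall (n : 'I_block_len) r, small_noise a (noise ((b * block_len + n)%N, r) v) &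
      typical w L (block_jam b v)].

Lemma measurable_chan_row tk : measurable_fun setT (chan_row tk).
Proof.
apply: measurable_fun_matrix => i j; under eq_fun do rewrite mxE.
exact: measurable_fun_entry.
Qed.

Lemma measurable_noise tk : measurable_fun setT (noise tk).
Proof. exact: measurable_fun_entry. Qed.

Definition noisy_rows a := [set v : #|{: 'I_block_len * 'I_K}|.-tuple R[i] |
  exists i, ~~ small_noise a (tnth v i)].

Lemma measurable_noisy_rows a : measurable (noisy_rows a).
Proof.
rewrite (_ : noisy_rows a = \bigcup_(i in setT)
   (fun v => tnth v i) @^-1` (~` [set z | small_noise a z])).
  apply: fin_bigcup_measurable; first exact: finite_finset.
  move=> i _; rewrite -[X in measurable X]setTI; apply: measurable_tnth => //.
  exact: measurableC (measurable_small_noise a).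
apply/seteqP; split => v /=; first by move=> [i hi]; exists i => //; exact/negP.
by move=> [i _ /= hi]; exists i; exact/negP.
Qed.

Definition atypical_rows := [set v : #|{: 'I_block_len * 'I_1}|.-tuple (K.-tuple bool) |
  ~~ typical w L (fun n r => tnth (lookup point v n ord0) r)].

Lemma measurable_atypical_rows : measurable atypical_rows.
Proof.
rewrite (_ : atypical_rows = ~` [set v | typical w L (fun n r => tnth (lookup point v n ord0) r)]).
  apply: measurableC; apply: measurable_typical => n r.
  have := measurableT_comp (measurable_tnth (T := bool) r)
    (@measurable_lookup block_len 1 _ (K.-tuple bool) point n ord0).
  by move=> /(_ measurableT [set true] I); rewrite setTI.
by apply/seteqP; split => v /= /negP.
Qed.

Variables (lam : K.-tuple bool -> R) (fH fG : 'I_K -> 'rV[R[i]]_K -> R) (PT : R).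
Hypothesis jc : jammed_miso_bc lam fH fG PT c.
Variables (cg : nat) (a : R).

(** Ill-conditioned channels, large noise and atypical jamming, each written as the preimage of a
    set of tuples under a single process. *)
Definition bad_event (i : 'I_3) b : set (ch_space c) :=
  if i == 0 :> nat then subfamily chan_row (block_index _ K b) @^-1` (~` @good_rows R K w L cg)
  else if i == 1 :> nat then subfamily noise (block_index _ K b) @^-1` noisy_rows a
  else subfamily (fun tk : nat * 'I_1 => chS c tk.1) (block_index _ 1 b) @^-1` atypical_rows.

Lemma measurable_bad_event i b : measurable (bad_event i b).
Proof.
rewrite /bad_event; case: ifP => _; last case: ifP => _.
- apply: measurable_subfamily_preimage; first exact: measurable_chan_row.
  exact: measurableC (@measurable_good_rows R K w L cg).
- apply: measurable_subfamily_preimage; first exact: measurable_noise.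
  exact: measurable_noisy_rows.
- apply: measurable_subfamily_preimage => //.
  exact: measurable_atypical_rows.
Qed.

Lemma bad_event_indep i b b' : b != b' ->
  ch_prob c (bad_event i b `&` bad_event i b') =
  (ch_prob c (bad_event i b) * ch_prob c (bad_event i b'))%E.
Proof.
move=> bb; rewrite /bad_event; case: ifP => _; last case: ifP => _.
- apply: block_event_indep => //; first exact: measurable_chan_row.
    exact: (H_indep jc).
  exact: measurableC (@measurable_good_rows R K w L cg).
- apply: block_event_indep => //; first exact: measurable_noise.
    exact: (N_indep jc).
  exact: measurable_noisy_rows.
- apply: block_event_indep => //.
    exact: (mutually_independent_lift (S_indep jc)).
  exact: measurable_atypical_rows.
Qed.

Lemma bad_eventE b v : (0 < w)%N ->
  (\bigcup_i bad_event i b) v <-> ~ good_block cg a b v.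
Proof.
move=> w0.
have typE : typical w L (fun n r => tnth (lookup point
    (subfamily (fun tk : nat * 'I_1 => chS c tk.1) (block_index block_len 1 b) v) n ord0) r)
    = typical w L (block_jam b v).
  apply: typical_ext => // n nl; apply/funext => r.
  by rewrite lookup_subfamily.
have noiseE i : tnth (subfamily noise (block_index block_len K b) v) i =
    noise ((b * block_len + (enum_val i).1)%N, (enum_val i).2) v.
  by rewrite /subfamily tnth_mktuple /block_index tnth_mktuple.
split.
  move=> [[[|[|[|//]]] ?] _] /= bv [gc gn gt].
  - by apply: bv; apply/good_rowsE.
  - by case: bv => i; rewrite noiseE gn.
  - by move: bv; rewrite /bad_event /= /atypical_rows /= typE gt.
move=> ng; apply: contrapT => nb; apply: ng; split.
- apply: contrapT => h; apply: nb; exists ord0 => //; rewrite /bad_event /=.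
  by move=> g; apply: h; apply/good_rowsE.
- move=> n r; apply/negPn/negP => h; apply: nb; exists (lift ord0 ord0) => //.
  rewrite /bad_event /=; exists (enum_rank (n, r)).
  by rewrite noiseE enum_rankK.
- apply/negPn/negP => h; apply: nb; exists (lift ord0 (lift ord0 ord0)) => //.
  by rewrite /bad_event /= /preimage /atypical_rows /= typE.
Qed.

End channel_blocks.
End block_statistics.

Section few_bad_blocks.
Variables (R : realType) (K w L : nat) (lam : K.-tuple bool -> R).
Variables (fH fG : 'I_K -> 'rV[R[i]]_K -> R) (c : R -> channel R K).
Variables (delta e eta : R).
Hypothesis jc : forall PT, 0 < PT -> jammed_miso_bc lam fH fG PT (c PT).
Hypothesis Sdelta : forall PT t r, 0 < PT ->
  Pr (ch_prob (c PT)) [set v | tnth (chS (c PT) t v) r] = 1 - delta.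
Hypotheses (e0 : 0 < e) (eta0 : 0 < eta) (w0 : (0 < w)%N).

(** The constant is found for the first block at power 1; equal densities and independence transfer
    it to every block and power. *)
Lemma bad_channel_le : exists cg, forall a PT b, 0 < PT ->
  Pr (ch_prob (c PT)) (@bad_event R K w L (c PT) cg a ord0 b) <= e.
Proof.
have j1 := jc ltr01.
have null1 tk : hyperplane_null (ch_prob (c 1)) (@chan_row R K (c 1) tk).
  exact: density_hyperplane_null (H_density j1 tk.1 tk.2).
have [cg hcg] := good_channel_probability w L (@measurable_chan_row R K (c 1))
  (H_indep j1) null1 e0.
exists cg => a PT b PT0; apply: le_trans hcg; rewrite /bad_event /= le_eqVlt.
apply/orP; left; apply/eqP; congr fine.
transitivity (ch_prob (c 1)
    (subfamily (@chan_row R K (c 1)) (block_index (block_len K w) K 0) @^-1`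
      (~` @good_rows R K w L cg))).
  apply: subfamily_law.
  - exact: measurable_chan_row.
  - exact: measurable_chan_row.
  - exact: (H_indep (jc PT0)).
  - exact: (H_indep j1).
  - exact: uniq_block_index.
  - exact: uniq_block_index.
  - move=> i A mA; rewrite /block_index !tnth_mktuple.
    have [_ _ E1] := H_density (jc PT0) (b * block_len K w + (enum_val i).1)%N (enum_val i).2.
    have [_ _ E2] := H_density j1 (0 * block_len K w + (enum_val i).1)%N (enum_val i).2.
    by rewrite (E1 A mA) -(E2 A mA).
  - exact: measurableC (@measurable_good_rows R K w L cg).
congr (ch_prob (c 1) _); rewrite preimage_setC; congr (~` _).
have E v := @good_rowsE R K w L _ _ (@chan_row R K (c 1)) 0 cg v w0.
by apply/seteqP; split => v h; [exact: (E v).1 h|exact: (E v).2 h].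
Qed.

Lemma bad_noise_le : exists a, forall cg PT b, 0 < PT ->
  Pr (ch_prob (c PT)) (@bad_event R K w L (c PT) cg a (lift ord0 ord0) b) <= e.
Proof.
pose N := #|{: 'I_(block_len K w) * 'I_K}|.
(* The bound e is shared among the N noise samples of a block; the successor keeps the denominator
   positive. *)
have [a ha] := small_noise_probability (divr_gt0 e0 (ltr0Sn R N)).
exists a => cg PT b PT0; rewrite /bad_event /=.
pose B i := [set v | ~~ small_noise a (tnth (subfamily (@noise R K (c PT))
  (block_index (block_len K w) K b) v) i)].
have BE i : B i = [set v | ~~ small_noise a (@noise R K (c PT)
    ((b * block_len K w + (enum_val i).1)%N, (enum_val i).2) v)].
  by apply/funext => v; rewrite /B /subfamily /= tnth_mktuple /block_index tnth_mktuple.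
have mB i : measurable (B i).
  have := measurable_tnth (T := R[i]) i measurableT (measurableC (measurable_small_noise a)).
  rewrite setTI => mS.
  rewrite (_ : B i = subfamily (@noise R K (c PT)) (block_index (block_len K w) K b) @^-1`
    ((fun v => tnth v i) @^-1` (~` [set z | small_noise a z]))).
    by apply: measurable_subfamily_preimage => //; exact: measurable_noise.
  by apply/seteqP; split => v /= /negP.
apply: (@le_trans _ _ (Pr (ch_prob (c PT)) (\big[setU/set0]_i B i))).
  apply: Pr_le.
  - apply: measurable_subfamily_preimage; first exact: measurable_noise.
    exact: measurable_noisy_rows.
  - by apply: big_ind => // *; exact: measurableU.
  - by move=> v [i hi]; rewrite (bigD1 i)//=; left.
apply: (le_trans (Pr_bigcup_le _ _ mB)).
apply: (@le_trans _ _ (\sum_(i < N) e / N.+1%:R)).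
  apply: ler_sum => i _; rewrite BE; apply: ha; first exact: measurable_noise.
  exact: (N_law (jc PT0)).
rewrite sumr_const card_ord -[leLHS]mulr_natr -mulrA ler_piMr ?(ltW e0)//.
by rewrite mulrC ler_pdivrMr ?ltr0n// mul1r ler_nat.
Qed.

(** The order of quantifiers is the point: [cg] and [a] are chosen before the power and before the
    number of blocks. *)
Lemma few_bad_blocks : L%:R <= (delta - eta) * w%:R ->
  (#|{: {set 'I_K} * 'I_K}|)%:R / (eta ^+ 2 * w%:R) <= e ->
  exists cg a, forall PT m, 0 < PT -> (0 < m)%N ->
    Pr (ch_prob (c PT)) [set v | (e + e) * 3 * m%:R <=
      (\sum_(b < m) (v \in ~` [set v | @good_block R K w L (c PT) cg a b v]))%:R]
    <= 3 / (e ^+ 2 * m%:R).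
Proof.
move=> Lw we; have [cg hcg] := bad_channel_le; have [a ha] := bad_noise_le.
exists cg, a => PT m PT0 m0.
have -> : [set v | (e + e) * 3 * m%:R <=
    (\sum_(b < m) (v \in ~` [set v | @good_block R K w L (c PT) cg a b v]))%:R] =
    [set v | (e + e) * 3 * m%:R <=
    (\sum_(b < m) (v \in \bigcup_i @bad_event R K w L (c PT) cg a i b))%:R].
  apply/funext => v /=; congr (_ <= _%:R); apply: eq_bigr => b _; congr nat_of_bool.
  have E := @bad_eventE R K w L (c PT) cg a b v w0.
  by apply/idP/idP => /set_mem h; apply/mem_set; [exact: E.2 h|exact: E.1 h].
apply: count_bad_events => //.
- by move=> i b; exact: measurable_bad_event.
- move=> [[|[|[|//]]] hi] b.
  + rewrite (_ : Ordinal hi = ord0); last exact: val_inj.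
    exact: hcg.
  + rewrite (_ : Ordinal hi = lift ord0 ord0); last exact: val_inj.
    exact: ha.
  apply: le_trans we; rewrite /bad_event /=.
  apply: le_trans (@typical_probability _ _ R (ch_prob (c PT)) K
    (fun t => chS (c PT) t) delta _ (S_indep (jc PT0)) _ w L eta b eta0 w0 Lw) => //.
    rewrite le_eqVlt; apply/orP; left; apply/eqP; congr (Pr _ _).
    apply/funext => v; rewrite /preimage /atypical_rows /=; congr (is_true (~~ _)).
    apply: typical_ext => // n nl; apply/funext => r.
    by rewrite lookup_subfamily.
  by move=> t r; exact: Sdelta.
- by move=> i b b' bb; exact: (bad_event_indep _ _ (jc PT0)).
Qed.

End few_bad_blocks.

(** * The outer code *)

Section gilbert_varshamov.
Variables (A : finType) (m D : nat).
Local Open Scope nat_scope.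
Implicit Types x y : {ffun 'I_m -> A}.

Definition hamming x y := #|[set i | x i != y i]%SET|.

Definition hamming_separated (C : {set {ffun 'I_m -> A}}) :=
  [forall x in C, [forall y in C, (x != y) ==> (D <= hamming x y)]].

(** A word of the ball is found by choosing the set of differing positions and free letters on it.
    The crude factor 2^m costs ln 2 per block, negligible against ln #|A|, which grows with the
    power. *)
Lemma hamming_ball x : 0 < #|A| ->
  #|[set y | hamming x y < D]%SET| <= 2 ^ m * #|A| ^ D.
Proof.
move=> A0; pose F (I : {set 'I_m}) (i : 'I_m) : pred A := fun a => (i \in I) || (a == x i).
have cF (I : {set 'I_m}) : #|family (F I)| = #|A| ^ #|I|.
  rewrite card_family foldrE big_map big_enum /=.
  rewrite (bigID [in I])/= [X in _ * X]big1 ?muln1; last first.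
    move=> i /negbTE iI; rewrite -(card1 (x i)); apply: eq_card => a.
    by rewrite [in LHS]unfold_in /F iI !inE.
  rewrite (eq_bigr (fun=> #|A|)) ?prod_nat_const// => i iI.
  by apply: eq_card => a; rewrite [in LHS]unfold_in /F iI !inE.
apply: (@leq_trans (\sum_(I : {set 'I_m} | #|I| < D) #|family (F I)|)).
  rewrite -sum1_card.
  apply: (@leq_trans (\sum_(y | hamming x y < D)
      \sum_(I : {set 'I_m} | #|I| < D) (y \in family (F I)))).
    rewrite (eq_bigl (fun y => hamming x y < D)); last by move=> y; rewrite inE.
    apply: leq_sum => y yD.
    have yF : y \in family (F [set i | x i != y i]%SET).
      by apply/familyP => i; rewrite unfold_in /F inE eq_sym; case: eqVneq.
    by rewrite (bigD1 [set i | x i != y i]%SET)//= yF.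
  rewrite exchange_big /=; apply: leq_sum => I _.
  by rewrite -sum1_card [X in _ <= X]big_mkcond /= [X in X <= _]big_mkcond /=;
    apply: leq_sum => y _; case: ifP => // _; case: (y \in _).
apply: (@leq_trans (\sum_(I : {set 'I_m}) #|A| ^ D)).
  rewrite [X in X <= _]big_mkcond /=; apply: leq_sum => I _.
  by case: ifP => // ID; rewrite cF leq_pexp2l// ltnW.
have cS : #|{: {set 'I_m}}| = 2 ^ m.
  by rewrite -cardsT -finset.powersetT card_powerset cardsT card_ord.
by rewrite sum_nat_const cS.
Qed.

(** A maximal separated code covers the space by balls of radius below D, since an uncovered word
    could be added. *)
Lemma gilbert_varshamov : 0 < #|A| -> 0 < D -> exists C : {set {ffun 'I_m -> A}},
  hamming_separated C /\ #|A| ^ m <= #|C| * (2 ^ m * #|A| ^ D).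
Proof.
move=> A0 D0.
have sep0 : hamming_separated finset.set0 by apply/forallP => x; rewrite inE.
have [C /maxsetP[sC maxC] _] := maxset_exists sep0.
exists C; split => //.
have cover y : exists2 x, x \in C & hamming x y < D.
  have [/existsP[x /andP[xC xy]]|] := boolP [exists x, (x \in C) && (hamming x y < D)].
    by exists x.
  move/existsPn => far.
  have hsym x z : hamming x z = hamming z x.
    by apply: eq_card => i; rewrite !inE eq_sym.
  have farD x : x \in C -> D <= hamming x y.
    by move=> xC; have := far x; rewrite xC /= -leqNgt.
  have sy : hamming_separated (y |: C).
    apply/forallP => x; apply/implyP; rewrite !inE => xyC.
    apply/forallP => z; apply/implyP; rewrite !inE => zyC; apply/implyP => xz.
    case/orP: xyC => [/eqP xy|xC]; case/orP: zyC => [/eqP zy|zC].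
    - by rewrite xy zy eqxx in xz.
    - by rewrite xy hsym farD.
    - by rewrite zy farD.
    - by have /forallP/(_ x)/implyP/(_ xC)/forallP/(_ z)/implyP/(_ zC)/implyP/(_ xz) := sC.
  have yC : y \in C by rewrite -(maxC _ sy (finset.subsetUr _ _)) !inE eqxx.
  exists y => //; rewrite /hamming (_ : [set i | _]%SET = finset.set0) ?cards0//.
  by apply/setP => i; rewrite !inE eqxx.
rewrite -[X in _ ^ X](card_ord m) -card_ffun -sum_nat_const.
apply: (@leq_trans (\sum_(x in C) #|[set y | hamming x y < D]%SET|)); last first.
  by apply: leq_sum => x _; exact: hamming_ball.
under [X in _ <= X]eq_bigr do rewrite -sum1_card big_mkcond /=.
rewrite exchange_big /= -sum1_card; apply: leq_sum => y _.
have [x xC xy] := cover y.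
by rewrite (bigD1 x)//= inE xy.
Qed.

End gilbert_varshamov.

(** * Encoder and decoder *)

Lemma measurable_nth d (E : measurableType d) n (e : E) s :
  measurable_fun [set: n.-tuple E] (fun v : n.-tuple E => nth e v s).
Proof.
have [sn|sn] := ltnP s n; last first.
  rewrite (_ : (fun v => _) = cst e)//; apply/funext => v /=.
  by rewrite nth_default// size_tuple.
rewrite (_ : (fun v => _) = fun v => tnth v (Ordinal sn)).
  exact: measurable_tnth.
by apply/funext => v; rewrite (tnth_nth e).
Qed.

Lemma measurable_fun_nth d (T : measurableType d) d' (E : measurableType d') n
    (f : T -> n.-tuple E) (e : E) s :
  measurable_fun setT f -> measurable_fun setT (fun v => nth e (f v) s).
Proof. exact: measurableT_comp (measurable_nth e s). Qed.

Section transmitter.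
Variables (R : realType) (K w L Q m M : nat) (alpha P : R).
Local Notation block_len := (block_len K w).
Local Notation nsym := (num_symbols K L 1).
Local Notation alphabet := {ffun 'I_nsym -> 'I_Q * 'I_Q}.
Variable codebook : 'I_M -> {ffun 'I_m -> alphabet}.
Local Notation message := (messages (fun _ : 'I_K => M)).

Definition lattice_input (W : message) (b : 'I_m) : 'M[int * int]_(K, nsym) :=
  \matrix_(k, q) (Posz (codebook (W k) b q).1, Posz (codebook (W k) b q).2).

Definition block_input W (b : nat) : 'M[R[i]]_(K, nsym) :=
  if insub b is Some b' then
    (alpha%:C)%C *: map_mx (gauss_int R) (lattice_input W b') else 0.

Definition raw_signal (Hs : nat -> 'M[R[i]]_K) (Ss : nat -> K.-tuple bool) W t
    : 'cV[R[i]]_K :=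
  let b := (t %/ block_len)%N in
  transmit w (fun n r => row r (Hs (b * block_len + n)%N))
    (fun n r => tnth (Ss (b * block_len + n)%N) r) (block_input W b)
    (t %% block_len).

(* Transmitting nothing when the power budget would be exceeded makes the power
   constraint trivial; good blocks never need this. *)
Definition signal Hs Ss W t :=
  let x := raw_signal Hs Ss W t in if sqnorm x <= P then x else 0.

Lemma sqnorm0 p q : sqnorm (0 : 'M[R[i]]_(p, q)) = 0.
Proof.
by rewrite /sqnorm big1// => i _; rewrite big1// => j _; rewrite mxE /sqmodc /= expr0n addr0.
Qed.

Lemma signal_power Hs Ss W t : 0 <= P -> sqnorm (signal Hs Ss W t) <= P.
Proof. by move=> P0; rewrite /signal; case: ifP => //; rewrite sqnorm0. Qed.

Hypothesis w0 : (0 < w)%N.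
Hypothesis len0 : (0 < block_len)%N.

(** The test of the power budget looks at the raw signal only, so it is as causal as the scheme
    itself. *)
Lemma signal_causal Hs Ss Hs' Ss' W t :
  (forall s, (s < t)%N -> Hs s = Hs' s) -> (forall s, (s < t)%N -> Ss s = Ss' s) ->
  signal Hs Ss W t = signal Hs' Ss' W t.
Proof.
move=> HH SS; rewrite /signal (_ : raw_signal Hs Ss W t = raw_signal Hs' Ss' W t)//.
have lt n : (n < t %% block_len -> t %/ block_len * block_len + n < t)%N.
  by move=> nt; rewrite [X in (_ < X)%N](divn_eq t block_len) ltn_add2l.
apply: transmit_causal => //; first by rewrite ltn_mod.
- by move=> n /lt nt; apply/funext => r; rewrite HH.
- by move=> n /lt nt; apply/funext => r; rewrite SS.
Qed.

Lemma measurable_signal d (V : measurableType d) (Hs : V -> nat -> 'M[R[i]]_K)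
    (Ss : V -> nat -> K.-tuple bool) W t :
  (forall s, measurable_fun setT (fun v => Hs v s)) ->
  (forall s r, measurable [set v | tnth (Ss v s) r]) ->
  measurable_fun setT (fun v => signal (Hs v) (Ss v) W t).
Proof.
move=> mH mS.
have mx : measurable_fun setT (fun v => raw_signal (Hs v) (Ss v) W t).
  apply: measurable_transmit => [n r|n r]; first exact: mS.
  apply: measurable_fun_matrix => i j; under eq_fun do rewrite mxE.
  exact: measurable_fun_entry.
apply: measurable_fun_ifT => //.
apply: measurable_fun_ler => //; rewrite /sqnorm.
apply: measurable_sum => i; apply: measurable_sum => j.
by apply: measurable_sqmodc; exact: measurable_fun_entry.
Qed.

End transmitter.

Section code.
Variables (R : realType) (K w L Q m M n B0 : nat) (alpha P rho : R).
Local Notation block_len := (block_len K w).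
Local Notation nsym := (num_symbols K L 1).
Local Notation alphabet := {ffun 'I_nsym -> 'I_Q * 'I_Q}.
Variable codebook : 'I_M -> {ffun 'I_m -> alphabet}.
Local Notation message := (messages (fun _ : 'I_K => M)).
Hypotheses (w0 : (0 < w)%N) (M0 : (0 < M)%N).
Local Notation signal := (signal w alpha P codebook).

(** Times from t on are read as [point]; by [signal_causal] the value is the one computed from the
    full processes. *)
Definition encoder (t : 'I_n) (W : message)
    (v : t.-tuple ('M[R[i]]_K * K.-tuple bool)) : 'cV[R[i]]_K :=
  signal (fun s => (nth point v s).1) (fun s => (nth point v s).2) W t.

Definition received := (n.-tuple R[i] * n.-tuple 'M[R[i]]_K * n.-tuple (K.-tuple bool))%type.

(** The candidate contains the messages of all users, because all of them shape the received signal.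
    Knowing channels and jamming, the receiver can recompute what would have been sent and compare
    it in its open slots. *)
Definition consistent (k : 'I_K) (v : received) (W : message) (b : 'I_m) : bool :=
  [forall i : 'I_block_len,
    tnth (nth point v.2 (b * block_len + i)%N) k ||
    (sqmodc (nth 0 v.1.1 (b * block_len + i)%N -
       (nth 0 v.1.2 (b * block_len + i)%N *m
        signal (nth 0 v.1.2) (nth point v.2) W (b * block_len + i)%N) k 0) <= rho)].

(* Exhaustive search, unlike the inversion of channel matrices, makes the
   measurability of the decoder a finite matter. *)
Definition decoder (k : 'I_K) (v : received) : 'I_M :=
  if [pick W | (m <= (\sum_b consistent k v W b) + B0)%N] is Some W then W k
  else Ordinal M0.

Lemma measurable_encoder t W : measurable_fun setT (@encoder t W).
Proof.
apply: measurable_signal => [s|s r].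
  exact: measurableT_comp (measurable_fst) (measurable_nth point s).
have mS : measurable_fun setT (fun v : t.-tuple ('M[R[i]]_K * K.-tuple bool) =>
    tnth (nth point v s).2 r).
  apply: (measurableT_comp (measurable_tnth (T := bool) r)).
  exact: measurableT_comp (measurable_snd) (measurable_nth point s).
by have := mS measurableT [set true] I; rewrite setTI.
Qed.

Lemma measurable_decoder k j : measurable (decoder k @^-1` [set j]).
Proof.
pose pat (i : message * 'I_m) v := consistent k v i.1 i.2.
rewrite (_ : _ @^-1` _ = [set v | [set x : {ffun message * 'I_m -> bool} |
   (if [pick W | (m <= (\sum_b x (W, b)) + B0)%N] is Some W then W k
    else Ordinal M0) = j] [ffun i => pat i v]]); last first.
  apply/funext => v /=; congr (_ = j).
  rewrite /decoder (_ : (fun W => (m <= (\sum_b [ffun i => pat i v] (W, b)) + B0)%N) =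
    (fun W => (m <= (\sum_b consistent k v W b) + B0)%N))//.
  by apply/funext => W; under eq_bigr do rewrite ffunE.
apply: measurable_finite_pattern => -[W b'].
rewrite (_ : [set v | _] = \bigcap_(i in [set: 'I_block_len])
  ([set v : received | tnth (nth point v.2 (b' * block_len + i)%N) k] `|`
   [set v : received | sqmodc (nth 0 v.1.1 (b' * block_len + i)%N -
       (nth 0 v.1.2 (b' * block_len + i)%N *m
        signal (nth 0 v.1.2) (nth point v.2) W (b' * block_len + i)%N) k 0) <= rho])).
  have mH s : measurable_fun setT (fun v : received => nth 0 v.1.2 s).
    by apply: measurable_fun_nth; exact: (measurableT_comp measurable_snd measurable_fst).
  have mS s r : measurable [set v : received | tnth (nth point v.2 s) r].
    have mS' : measurable_fun setT (fun v : received => tnth (nth point v.2 s) r).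
      apply: (measurableT_comp (measurable_tnth (T := bool) r)).
      by apply: measurable_fun_nth; exact: measurable_snd.
    by have := mS' measurableT [set true] I; rewrite setTI.
  apply: fin_bigcap_measurable; first exact: finite_finset.
  move=> i _; apply: measurableU; first exact: mS.
  have mle (f : received -> R) : measurable_fun setT f ->
      measurable [set v | f v <= rho].
    move=> mf; rewrite -[X in measurable X]setTI.
    by have /(_ [set true]) := measurable_fun_ler mf (measurable_cst rho) measurableT; apply.
  apply: mle; apply: measurable_sqmodc; apply: measurable_complexD.
    apply: measurable_fun_nth; exact: (measurableT_comp measurable_fst measurable_fst).
  apply: measurable_complexN; under eq_fun do rewrite mxE.
  apply: measurable_complex_sum => j' _; apply: measurable_complexM.
    exact: measurable_fun_entry.
  by apply: measurable_fun_entry; apply: measurable_signal => //; exact: mS.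
apply/seteqP; split => v /=.
  by move=> /forallP h i _ /=; apply/orP; exact: h.
by move=> h; apply/forallP => i; apply/orP; exact: (h i Logic.I).
Qed.

Definition jamming_code : DD_code R K n :=
  @DDCode R K n (fun _ => M) (fun _ => M0) encoder decoder
    measurable_encoder measurable_decoder.

End code.

Lemma nth_block d (T : measurableType d) (E : Type) (X : nat -> T -> E) n e s v :
  (s < n)%N -> nth e (block X n v) s = X s v.
Proof. by move=> sn; rewrite -[s]/(val (Ordinal sn)) -tnth_nth tnth_mktuple. Qed.

Lemma gauss_intB (R : realType) (x y : int * int) :
  gauss_int R (x - y) = gauss_int R x - gauss_int R y.
Proof.
case: x y => [a b] [a' b']; apply/eqP.
by rewrite /gauss_int eq_complex /= !rmorphB !eqxx.
Qed.

(** * Correct decoding when few blocks are bad *)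

Section decoding.
Variables (R : realType) (K w L Q m M n B0 : nat) (alpha P a : R) (cg : nat).
Local Notation block_len := (block_len K w).
Local Notation nsym := (num_symbols K L 1).
Local Notation alphabet := {ffun 'I_nsym -> 'I_Q * 'I_Q}.
Variable codebook : 'I_M -> {ffun 'I_m -> alphabet}.
Local Notation message := (messages (fun _ : 'I_K => M)).
Hypotheses (w0 : (0 < w)%N) (M0 : (0 < M)%N) (len0 : (0 < block_len)%N).
Hypothesis mn : (m * block_len <= n)%N.
Hypothesis alpha0 : 0 <= alpha.
Hypothesis alpha_sep : 8 * a ^+ 2 < alpha ^+ 2 / cg.+1%:R.
Hypothesis alpha_power :
  K%:R * (K%:R * nsym%:R * (2 * alpha * Q%:R)) ^+ 2 * cg%:R <= P.
Hypothesis codebook_sep : forall j j', j != j' ->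
  (B0 + B0 < hamming (codebook j) (codebook j'))%N.
Variable c : channel R K.
Variable v : ch_space c.
Local Notation good b := (@good_block R K w L c cg a b v).
Local Notation Hs := (fun s => chH c s v).
Local Notation Ss := (fun s => chS c s v).
Local Notation h b := (@block_rows R K w c b v).
Local Notation J b := (@block_jam R K w c b v).
Local Notation signal := (signal w alpha P codebook).
Local Notation input := (block_input alpha codebook).

Definition block_pattern b : {ffun 'I_block_len * 'I_K -> bool} :=
  [ffun nr : 'I_block_len * 'I_K => J b (nr.1 : nat) nr.2].

Lemma block_patternE b i r : (i < block_len)%N ->
  jamming (block_pattern b) i r = J b i r.
Proof. by move=> il; rewrite /jamming insubT ffunE. Qed.

Lemma transmit_pattern b z i : (i < block_len)%N ->
  transmit w (h b) (J b) (z : 'M[R[i]]_(K, nsym)) i =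
  transmit w (h b) (jamming (block_pattern b)) z i.
Proof.
move=> il; apply: transmit_causal => // m' m'i; apply/funext => r.
by rewrite block_patternE// (ltn_trans m'i).
Qed.

Lemma good_blockP b : good b ->
  (forall k (z : 'M[int * int]_(K, nsym)), (exists q, z k q != (0, 0)) ->
     exists2 i : 'I_block_len, ~~ J b i k &
       cg.+1%:R^-1 <= sqmodc (observe w (h b) (J b) (map_mx (gauss_int R) z) k i)) /\
  (forall k q (i : 'I_block_len) l,
     sqmodc (transmit w (h b) (J b) (delta_mx k q : 'M[R[i]]_(K, nsym)) i l 0) <= cg%:R).
Proof.
move=> [gc _ gt]; have := gc (block_pattern b).
rewrite (@typical_ext _ _ _ _ (J b)) => [/(_ gt)[g1 g2]|i il]; last first.
  by apply/funext => r; rewrite block_patternE.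
split=> [k z /(g1 k z)[i Ji hi]|k q i l]; last by rewrite transmit_pattern.
exists i; first by rewrite -block_patternE.
by rewrite /observe transmit_pattern.
Qed.

Lemma index_div b i : (i < block_len)%N ->
  ((b * block_len + i) %/ block_len = b)%N /\ ((b * block_len + i) %% block_len = i)%N.
Proof.
by move=> il; rewrite divnMDl// modnMDl divn_small// modn_small// addn0.
Qed.

Lemma index_lt (b : 'I_m) i : (i < block_len)%N -> (b * block_len + i < n)%N.
Proof.
move=> il; apply: leq_trans mn.
apply: (@leq_trans (b.+1 * block_len)); last by rewrite leq_mul2r ltn_ord orbT.
by rewrite mulSn addnC ltn_add2r.
Qed.

Lemma input_entry W (b : nat) k q : cabs (input W b k q) <= 2 * alpha * Q%:R.
Proof.
rewrite /block_input; case: insubP => [b' _ _|_]; last first.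
  by rewrite mxE /cabs /sqmodc /= expr0n addr0 sqrtr0 !mulr_ge0.
rewrite !mxE cabsM.
have -> : cabs (alpha%:C)%C = alpha.
  by rewrite /cabs /sqmodc /= expr0n addr0 sqrtr_sqr ger0_norm.
rewrite [2 * alpha]mulrC -mulrA ler_wpM2l// -sqmodc_le ?mulr_ge0// /sqmodc /gauss_int /=.
set x := (codebook _ _ _).1; set y := (codebook _ _ _).2.
have xQ : (x : nat)%:R <= Q%:R :> R by rewrite ler_nat ltnW.
have yQ : (y : nat)%:R <= Q%:R :> R by rewrite ler_nat ltnW.
have x0 : 0 <= (x : nat)%:R :> R by [].
have y0 : 0 <= (y : nat)%:R :> R by [].
move: xQ yQ x0 y0; rewrite -!pmulrn.
set X : R := (x : nat)%:R; set Y : R := (y : nat)%:R; set q' : R := Q%:R; nra.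
Qed.

(** Origin of [alpha_power]: on each of the K antennas, K nsym basis signals of modulus at most sqrt
    cg are superposed with coefficients of modulus at most 2 alpha Q, so the budget is never
    exceeded on a good block. *)
Lemma good_signal W (b : 'I_m) i : good b -> (i < block_len)%N ->
  signal Hs Ss W (b * block_len + i)%N = transmit w (h b) (J b) (input W b) i.
Proof.
move=> /good_blockP[_ gp] il; have [e1 e2] := index_div b il.
rewrite /signal.
have -> : raw_signal w alpha codebook Hs Ss W (b * block_len + i)%N =
    transmit w (h b) (J b) (input W b) i by rewrite /raw_signal e1 e2.
suff -> : sqnorm (transmit w (h b) (J b) (input W b) i) <= P by [].
apply: le_trans alpha_power; rewrite /sqnorm.
set B := K%:R * nsym%:R * (2 * alpha * Q%:R).
have B0' : 0 <= B by rewrite !mulr_ge0.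
apply: (@le_trans _ _ (\sum_(l < K) B ^+ 2 * cg%:R)); last first.
  by rewrite sumr_const card_ord -[leLHS]mulr_natl mulrA.
apply: ler_sum => l _; rewrite big_ord1.
have -> : B ^+ 2 * cg%:R = (B * Num.sqrt cg%:R) ^+ 2 by rewrite [RHS]exprMn sqr_sqrtr.
rewrite sqmodc_le ?mulr_ge0 ?sqrtr_ge0// transmit_linear summxE.
apply: (le_trans (cabs_sum _ _ _)).
apply: (@le_trans _ _ (\sum_(k < K) \sum_(q < nsym) 2 * alpha * Q%:R * Num.sqrt cg%:R)).
  apply: ler_sum => k _; rewrite summxE; apply: (le_trans (cabs_sum _ _ _)).
  apply: ler_sum => q _; rewrite mxE cabsM ler_pM ?cabs_ge0// ?input_entry//.
  by apply: ler_wsqrtr; exact: (gp k q (Ordinal il) l).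
rewrite sumr_const card_ord sumr_const card_ord -[leLHS]mulr_natl.
by rewrite -[X in _ * X <= _]mulr_natl /B !mulrA.
Qed.

Lemma good_observation W (b : 'I_m) i k : good b -> (i < block_len)%N ->
  (chH c (b * block_len + i)%N v *m signal Hs Ss W (b * block_len + i)%N) k 0 =
  observe w (h b) (J b) (input W b) k i.
Proof.
move=> gb il; rewrite good_signal// /observe /block_rows /chan_row !mxE.
by apply: eq_bigr => j _; rewrite !mxE.
Qed.

Let C := @jamming_code R K w L Q m M n B0 alpha P (2 * a ^+ 2) codebook M0.

Lemma input_signal (W : message) (t : 'I_n) :
  @Defs.input R K n c C W t v = signal Hs Ss W t.
Proof.
rewrite /Defs.input /= /encoder; apply: signal_causal => // s st.
  by rewrite nth_block.
by rewrite nth_block.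
Qed.

Lemma output_open (W : message) k (b : 'I_m) i (tn : (b * block_len + i < n)%N) :
  (i < block_len)%N -> good b -> ~~ J b i k ->
  @output R K n c C k W (Ordinal tn) v =
  observe w (h b) (J b) (input W b) k i + @noise R K c ((b * block_len + i)%N, k) v.
Proof.
move=> il gb Ji; rewrite /output input_signal /= good_observation//.
by move: Ji; rewrite /block_jam => /negbTE ->; rewrite mul0r addr0.
Qed.

Definition observations (k : 'I_K) (W : message) : received R K n :=
  ([tuple @output R K n c C k W t v | t < n], block (fun t w => chH c t w) n v,
   block (fun t w => chS c t w) n v).

Lemma consistentE k (W W' : message) (b : 'I_m) : good b ->
  @consistent R K w L Q m M n alpha P (2 * a ^+ 2) codebook k (observations k W) W' b ->
  forall i : 'I_block_len, ~~ J b i k ->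
    sqmodc (observe w (h b) (J b) (input W b) k i +
      @noise R K c ((b * block_len + i)%N, k) v -
      observe w (h b) (J b) (input W' b) k i) <= 2 * a ^+ 2.
Proof.
move=> gb /forallP cons i Ji; have := cons i.
have tn := index_lt b (ltn_ord i).
have ES s : (s < n)%N -> nth point (observations k W).2 s = chS c s v.
  exact: nth_block.
have EH s : (s < n)%N -> nth 0 (observations k W).1.2 s = chH c s v.
  exact: nth_block.
have EY : nth 0 (observations k W).1.1 (b * block_len + i) =
    @output R K n c C k W (Ordinal tn) v.
  by rewrite -[X in nth 0 _ X]/(val (Ordinal tn)) -tnth_nth tnth_mktuple.
rewrite ES// EH// EY (output_open W tn (ltn_ord i) gb Ji).
move: (Ji); rewrite /block_jam => /negbTE -> /=.
rewrite (_ : signal _ _ W' _ = signal Hs Ss W' (b * block_len + i)%N).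
  by rewrite good_observation.
apply: signal_causal => // s st; first by apply: EH; exact: (ltn_trans st).
by apply: ES; exact: (ltn_trans st).
Qed.

Lemma noise_small (b : 'I_m) k (i : 'I_block_len) : good b ->
  sqmodc (@noise R K c ((b * block_len + i)%N, k) v) <= 2 * a ^+ 2.
Proof.
move=> [_ gn _]; have /andP[] := gn i k; rewrite /sqmodc.
set x := complex.Re _; set y := complex.Im _ => xa ya.
rewrite mulr_natl mulr2n lerD// -real_normK ?num_real// ler_pXn2r// nnegrE//;
  exact: le_trans xa.
Qed.

Lemma block_input_diff (W W' : message) (b : 'I_m) :
  input W b - input W' b = (alpha%:C)%C *: map_mx (gauss_int R)
    (lattice_input codebook W b - lattice_input codebook W' b).
Proof.
rewrite /block_input valK -scalerBr; congr (_ *: _).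
by apply/matrixP => k q; rewrite !mxE gauss_intB.
Qed.

(** Origin of [alpha_sep]: noise and residual have modulus at most sqrt(2 a^2) each, so the two
    noiseless observations differ in square by at most 8 a^2, whereas different letters are
    separated by alpha^2 / (cg + 1) in some open slot. *)
Lemma consistent_codeword k (W W' : message) (b : 'I_m) : good b ->
  @consistent R K w L Q m M n alpha P (2 * a ^+ 2) codebook k (observations k W) W' b ->
  codebook (W' k) b = codebook (W k) b.
Proof.
move=> gb cons; apply: contrapT => ne.
have [q hq] : exists q, (lattice_input codebook W b - lattice_input codebook W' b) k q != (0, 0).
  apply: contrapT => /forallNP h; apply: ne; apply/ffunP => q.
  have /negP := h q; rewrite negbK !mxE => /eqP -[/eqP + /eqP].
  rewrite !subr_eq0 !eqz_nat => /eqP e1 /eqP e2.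
  by apply/eqP; rewrite -pair_eqE /pair_eq /= -!val_eqE /= e1 e2 !eqxx.
have [sep _] := good_blockP gb.
have [i Ji hi] := sep k _ (ex_intro _ q hq).
have hc := consistentE gb cons Ji; have hn := noise_small k i gb.
have diff : (alpha%:C)%C * observe w (h b) (J b) (map_mx (gauss_int R)
      (lattice_input codebook W b - lattice_input codebook W' b)) k i =
    observe w (h b) (J b) (input W b) k i - observe w (h b) (J b) (input W' b) k i.
  rewrite -observeZ -block_input_diff observeD -scaleN1r observeZ.
  by rewrite mulN1r.
set X := observe w (h b) (J b) (input W b) k i in hc diff.
set X' := observe w (h b) (J b) (input W' b) k i in hc diff.
set N := noise _ _ in hc hn.
have cX : cabs (X - X') <= Num.sqrt (2 * a ^+ 2) + Num.sqrt (2 * a ^+ 2).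
  rewrite (_ : X - X' = (X + N - X') - N); last by ring.
  by rewrite (le_trans (cabsD _ _))// cabsN lerD// ler_wsqrtr.
have : alpha ^+ 2 / cg.+1%:R <= cabs (X - X') ^+ 2.
  rewrite -diff cabsM exprMn.
  have -> : cabs (alpha%:C)%C = alpha.
    by rewrite /cabs /sqmodc /= expr0n addr0 sqrtr_sqr ger0_norm.
  by rewrite ler_wpM2l ?sqr_ge0// sqr_cabs.
have : cabs (X - X') ^+ 2 <= 8 * a ^+ 2.
  apply: (@le_trans _ _ ((Num.sqrt (2 * a ^+ 2) + Num.sqrt (2 * a ^+ 2)) ^+ 2)).
    by rewrite ler_pXn2r// nnegrE ?cabs_ge0// addr_ge0// sqrtr_ge0.
  have := @sqr_sqrtr _ (2 * a ^+ 2); rewrite mulr_ge0 ?sqr_ge0// => /(_ isT).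
  set s := Num.sqrt _ => hs.
  by rewrite (_ : (s + s) ^+ 2 = 4 * s ^+ 2); [rewrite hs; lra|ring].
by move=> h2 h1; have := lt_le_trans alpha_sep (le_trans h1 h2); rewrite ltxx.
Qed.

(** The search succeeds, as the true message is consistent on all good blocks. Any accepted
    candidate is consistent on at least m - B0 blocks, hence agrees with the true codeword on at
    least m - 2 B0, which the minimum distance allows for one codeword only. *)
Lemma decoded_correct k (W : message) :
  (\sum_(b < m) ((v \in ~` [set v | @good_block R K w L c cg a b v])) <= B0)%N ->
  @decoded R K n c C k W v = W k.
Proof.
move=> few.
have fewb : (\sum_(b < m) ~~ `[< good b >] <= B0)%N.
  apply: leq_trans few; apply: leq_sum => b _.
  case: (boolP (v \in _)) => [_|/negP h]; first exact: leq_b1.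
  by rewrite leqn0 eqb0 negbK; apply/asboolP; apply: contrapT => ng; apply: h; exact: mem_set.
rewrite /decoded /= /decoder -/(observations k W).
have Wok : (m <= (\sum_b @consistent R K w L Q m M n alpha P (2 * a ^+ 2) codebook k
    (observations k W) W b) + B0)%N.
  apply: leq_trans (leq_add (leqnn _) fewb); rewrite -big_split /=.
  rewrite -[X in (X <= _)%N](card_ord m) -sum1_card; apply: leq_sum => b _.
  case: asboolP => gb; last by rewrite addn1.
  rewrite addn0 lt0b; apply/forallP => i.
  have tn := index_lt b (ltn_ord i).
  case: (boolP (J b i k)) => Ji.
    apply/orP; left; move: Ji; rewrite /block_jam.
    by rewrite (nth_block (fun t w => chS c t w) point v tn).
  apply/orP; right.
  have EH s : (s < n)%N -> nth 0 (observations k W).1.2 s = chH c s v.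
    exact: nth_block.
  have ES s : (s < n)%N -> nth point (observations k W).2 s = chS c s v.
    exact: nth_block.
  have EY : nth 0 (observations k W).1.1 (b * block_len + i) =
      @output R K n c C k W (Ordinal tn) v.
    by rewrite -[X in nth 0 _ X]/(val (Ordinal tn)) -tnth_nth tnth_mktuple.
  rewrite EH// EY (output_open W tn (ltn_ord i) gb Ji).
  rewrite (_ : signal _ _ W _ = signal Hs Ss W (b * block_len + i)%N).
    by rewrite good_observation// addrAC subrr add0r noise_small.
  apply: signal_causal => // s st; first by apply: EH; exact: (ltn_trans st).
  by apply: ES; exact: (ltn_trans st).
case: pickP => [W' W'ok|/(_ W)]; last by rewrite Wok.
move: W'ok; set cons := consistent _ _ _ _ _ _ _ W' => W'ok.
have gm : (m <= \sum_(b < m) `[< good b >] + B0)%N.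
  apply: (leq_trans _ (leq_add (leqnn _) fewb)); rewrite -big_split /=.
  rewrite -[X in (X <= _)%N](card_ord m) -sum1_card; apply: leq_sum => b _.
  by case: asboolP.
have agree : (\sum_(b < m) (cons b && `[< good b >]) +
    hamming (codebook (W' k)) (codebook (W k)) <= m)%N.
  rewrite /hamming -sum1_card [X in (_ + X)%N]big_mkcond -big_split /=.
  rewrite -[X in (_ <= X)%N](card_ord m) -sum1_card; apply: leq_sum => b _.
  rewrite inE; case: (boolP (_ && _)) => [/andP[cb /asboolP gb]|_]; last by case: ifP.
  by rewrite (consistent_codeword gb cb) eqxx.
have both : (\sum_(b < m) cons b + \sum_(b < m) `[< good b >] <=
    \sum_(b < m) (cons b && `[< good b >]) + m)%N.
  rewrite -big_split /=.
  rewrite -[X in (_ <= _ + X)%N](card_ord m) -sum1_card -big_split /=.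
  by apply: leq_sum => b _; case: (cons b); case: asboolP.
apply/eqP; apply: contraT => /codebook_sep far.
move: W'ok gm agree both far; move: (hamming _ _) => x.
move: (\sum_(b < m) (cons b && _))%N (\sum_(b < m) cons b)%N => x1 x2.
by move: (\sum_(b < m) _)%N => x3; lia.
Qed.

End decoding.

Section code_performance.
Variables (R : realType) (K n : nat) (c : channel R K) (C : DD_code R K n).
Local Notation P := (ch_prob c).

Lemma measurable_input W t : measurable_fun setT (@Defs.input R K n c C W t).
Proof.
apply: (measurableT_comp (enc_measurable (t := t) W)).
apply/measurable_fun_tnthP => i.
rewrite (_ : _ \o _ = fun v => (chH c i v, chS c i v)); last first.
  by apply/funext => v /=; rewrite tnth_mktuple.
exact: measurable_fun_pair.
Qed.

Lemma measurable_output k W t : measurable_fun setT (@output R K n c C k W t).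
Proof.
have mMv (A : ch_space c -> 'M[R[i]]_K) (x : ch_space c -> 'cV[R[i]]_K) :
    measurable_fun setT A -> measurable_fun setT x ->
    measurable_fun setT (fun v => (A v *m x v) k 0).
  move=> mA mx; under eq_fun do rewrite mxE.
  by apply: measurable_complex_sum => j _; apply: measurable_complexM;
    exact: measurable_fun_entry.
apply: measurable_complexD; last exact: measurable_fun_entry.
apply: measurable_complexD; first exact: mMv (measurable_input W t).
apply: measurable_complexM; last exact: mMv.
apply: (@measurable_fun_select _ _ _ R[i] bool (fun v => tnth (chS c t v) k)
  (fun b _ => (b : nat)%:R)) => //.
move=> b; have := measurableT_comp (measurable_tnth (T := bool) k)
  (measurable_funPT (chS c t)).
by move=> /(_ measurableT [set b] I); rewrite setTI.
Qed.

Lemma measurable_error k W : measurable [set v | @decoded R K n c C k W v != W k].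
Proof.
pose obs v := ([tuple @output R K n c C k W t v | t < n],
  block (fun t v => chH c t v) n v, block (fun t v => chS c t v) n v).
have mblock d (E : measurableType d) (X : nat -> ch_space c -> E) :
    (forall t, measurable_fun setT (X t)) -> measurable_fun setT (block X n).
  move=> mX; apply/measurable_fun_tnthP => i.
  rewrite (_ : _ \o _ = X i)//; apply/funext => v /=; by rewrite tnth_mktuple.
have mobs : measurable_fun setT obs.
  apply: measurable_fun_pair; last exact: mblock.
  apply: measurable_fun_pair; last exact: mblock.
  apply/measurable_fun_tnthP => i.
  rewrite (_ : _ \o _ = @output R K n c C k W i); last first.
    by apply/funext => v /=; rewrite tnth_mktuple.
  exact: measurable_output.
rewrite (_ : [set v | _] = ~` (obs @^-1` (@dec R K n C k @^-1` [set W k]))).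
  apply: measurableC; rewrite -[X in measurable X]setTI; apply: mobs => //.
  exact: dec_measurable.
by apply/seteqP; split => v /= /eqP.
Qed.

Lemma message_mean_le (F : messages (msize C) -> \bar R) (x : R) :
  (forall W, 0 <= F W)%E -> (forall W, F W <= x%:E)%E -> 0 <= x ->
  (0 <= @message_mean R K n C F <= x%:E)%E.
Proof.
move=> F0 Fx x0; rewrite /message_mean.
rewrite mule_ge0 ?lee_fin ?invr_ge0//=; last exact: sume_ge0.
apply: (@le_trans _ _ ((#|{: messages (msize C)}|%:R^-1)%:E *
  \sum_(W : messages (msize C)) x%:E)%E).
  by rewrite lee_wpmul2l ?lee_fin ?invr_ge0//; apply: lee_sum.
rewrite sumEFin sumr_const -EFinM lee_fin -[x *+ _]mulr_natl mulrA.
have [->|N0] := eqVneq (#|{: messages (msize C)}|) 0%N.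
  by rewrite invr0 !mul0r.
by rewrite mulVf ?mul1r// pnatr_eq0.
Qed.

Lemma error_prob_le k (x : R) :
  (forall W, Pr P [set v | @decoded R K n c C k W v != W k] <= x) -> 0 <= x ->
  (0 <= @error_prob R K n c C k <= x%:E)%E.
Proof.
move=> hx x0; apply: message_mean_le => // W.
by rewrite PrE ?lee_fin//; exact: measurable_error.
Qed.

Lemma input_power_le t (x : R) : 0 <= x ->
  (forall W v, sqnorm (@Defs.input R K n c C W t v) <= x) ->
  (@input_power R K n c C t <= x%:E)%E.
Proof.
move=> x0 hx.
have sq0 W v : 0 <= sqnorm (@Defs.input R K n c C W t v).
  by rewrite /sqnorm sumr_ge0// => i _; rewrite sumr_ge0// => j _; exact: sqmodc_ge0.
refine (proj2 (andP (@message_mean_le (fun W =>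
  \int[P]_v (sqnorm (@Defs.input R K n c C W t v))%:E)%E x _ _ x0))).
  by move=> W; apply: integral_ge0 => v _; rewrite lee_fin.
move=> W; apply: (@le_trans _ _ (\int[P]_v x%:E)%E).
  apply: ge0_le_integral => //.
  - by move=> v _; rewrite lee_fin.
  - apply/measurable_EFinP; rewrite /sqnorm.
    apply: measurable_sum => i; apply: measurable_sum => j.
    by apply: measurable_sqmodc; apply: measurable_fun_entry; exact: measurable_input.
  - by move=> v _; rewrite lee_fin.
by rewrite integral_cst//= probability_setT mule1.
Qed.

End code_performance.

(** * Achievable rates *)

Lemma cvg_by_rate (R : realType) (u : R^nat) (l C : R) (N : nat) :
  (forall n, (N <= n)%N -> `|u n - l| <= C / n.+1%:R) -> u @ \oo --> l.
Proof.
move=> hu; apply/cvgrPdist_le => e e0.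
have C0 : 0 <= C.
  have := le_trans (normr_ge0 _) (hu N (leqnn _)).
  by rewrite pmulr_lge0// invr_gt0 ltr0n.
exists (maxn N (Num.truncn (C / e))) => // n /=; rewrite geq_max => /andP[Nn Cn].
rewrite distrC (le_trans (hu n Nn))// ler_pdivrMr ?ltr0n// -ler_pdivrMl//.
rewrite mulrC ltW// (lt_le_trans (truncnS_gt _))// ler_nat ltnS//.
Qed.

Section fixed_power.
Variables (R : realType) (K w L : nat) (c : channel R K).
Variables (cg Q : nat) (a e alpha P r : R).
Local Notation block_len := (block_len K w).
Local Notation nsym := (num_symbols K L 1).
Local Notation alphabet := {ffun 'I_nsym -> 'I_Q * 'I_Q}.
Hypotheses (e0 : 0 < e) (w0 : (0 < w)%N) (len0 : (0 < block_len)%N).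
Hypotheses (Q0 : (0 < Q)%N) (alpha0 : 0 <= alpha) (P0 : 0 <= P) (r0 : 0 <= r).
Hypothesis few : forall m, (0 < m)%N ->
  Pr (ch_prob c) [set v | (e + e) * 3 * m%:R <=
    (\sum_(b < m) (v \in ~` [set v | @good_block R K w L c cg a b v]))%:R]
  <= 3 / (e ^+ 2 * m%:R).
Hypothesis alpha_sep : 8 * a ^+ 2 < alpha ^+ 2 / cg.+1%:R.
Hypothesis alpha_power :
  K%:R * (K%:R * nsym%:R * (2 * alpha * Q%:R)) ^+ 2 * cg%:R <= P.
Hypothesis rate_gap :
  r * block_len%:R < (1 - 13 * e) * ln (#|{: alphabet}|%:R) - ln 2.

Definition num_blocks n := (n %/ block_len)%N.
(** The fraction 6 e is the threshold of [few]: three kinds of bad event, each with probability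
    bound e plus deviation e. *)
Definition error_budget n := Num.truncn ((e + e) * 3 * (num_blocks n)%:R).
Definition min_distance n := (error_budget n + error_budget n).+1.

Lemma alphabet_gt0 : (0 < #|{: alphabet}|)%N.
Proof. by rewrite card_ffun expn_gt0 card_prod card_ord muln_gt0 Q0. Qed.

Definition code_set n : {set {ffun 'I_(num_blocks n) -> alphabet}} :=
  projT1 (cid (@gilbert_varshamov alphabet (num_blocks n) (min_distance n)
    alphabet_gt0 (ltn0Sn _))).

Lemma code_setP n : @hamming_separated alphabet (num_blocks n) (min_distance n) (code_set n) /\
  (#|{: alphabet}| ^ (num_blocks n) <=
   #|code_set n| * (2 ^ (num_blocks n) * #|{: alphabet}| ^ (min_distance n)))%N.
Proof. by rewrite /code_set; case: cid. Qed.

(** The cap makes the rates converge to r exactly instead of merely exceeding it; the minimum with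
    the code size matters for short blocklengths only. *)
Definition num_messages n := minn #|code_set n| (Num.truncn (expR (n%:R * r))).

Lemma num_messages_gt0 n : (0 < num_messages n)%N.
Proof.
rewrite leq_min; apply/andP; split.
  have [_ +] := code_setP n; case: #|code_set n| => //.
  by rewrite mul0n leqn0 expn_eq0 -leqn0 leqNgt alphabet_gt0.
by rewrite truncn_gt0 -expR0 ler_expR mulr_ge0.
Qed.

Definition codeword n (j : 'I_(num_messages n)) : {ffun 'I_(num_blocks n) -> alphabet} :=
  enum_val (widen_ord (geq_minl _ _) j : 'I_#|code_set n|).

Definition the_code n : DD_code R K n :=
  @jamming_code R K w L Q (num_blocks n) (num_messages n) n (error_budget n)
    alpha P (2 * a ^+ 2) (@codeword n) (num_messages_gt0 n).

Lemma codeword_separated n (j j' : 'I_(num_messages n)) : j != j' ->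
  (error_budget n + error_budget n < hamming (codeword j) (codeword j'))%N.
Proof.
move=> jj; have [/forallP sep _] := code_setP n.
have /implyP/(_ (enum_valP _))/forallP := sep (codeword j).
move=> /(_ (codeword j'))/implyP/(_ (enum_valP _))/implyP; apply.
apply: contra_neq jj => /enum_val_inj h.
by apply: val_inj; exact: (congr1 val h).
Qed.

Lemma the_code_power n t : (@input_power R K n c (the_code n) t <= P%:E)%E.
Proof. by apply: input_power_le => // W v; exact: signal_power. Qed.

Lemma the_code_error n k : (0 < num_blocks n)%N ->
  (0 <= @error_prob R K n c (the_code n) k <=
    (3 / (e ^+ 2 * (num_blocks n)%:R))%:E)%E.
Proof.
move=> m0; apply: error_prob_le; last by rewrite divr_ge0// mulr_ge0// sqr_ge0.
move=> W; apply: le_trans (few m0).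
have mgood b : measurable (~` [set v | @good_block R K w L c cg a b v]).
  rewrite (_ : ~` _ = \bigcup_i @bad_event R K w L c cg a i b); last first.
    by apply/seteqP; split => v h; apply/(@bad_eventE R K w L c cg a b v w0).
  apply: fin_bigcup_measurable; first exact: finite_finset.
  by move=> i _; exact: measurable_bad_event.
apply: Pr_le; first exact: measurable_error.
  pose bad (b : 'I_(num_blocks n)) v := v \in ~` [set v | @good_block R K w L c cg a b v].
  rewrite (_ : [set v | _] = [set v | [set x : {ffun 'I_(num_blocks n) -> bool} |
        (e + e) * 3 * (num_blocks n)%:R <= (\sum_b x b)%:R] [ffun b => bad b v]]).
    apply: measurable_finite_pattern => b; rewrite (_ : [set v | _] =
      ~` [set v | @good_block R K w L c cg a b v]); first exact: mgood.
    by apply/seteqP; split => v; [exact: set_mem|exact: mem_set].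
  by apply/funext => v /=; under [in RHS]eq_bigr do rewrite ffunE.
move=> v /= err; rewrite leNgt; apply/negP => fewv; move/eqP: err; apply.
apply: (@decoded_correct R K w L Q (num_blocks n) (num_messages n) n
  (error_budget n) alpha P a cg (@codeword n) w0 _ len0 _ alpha0 alpha_sep alpha_power
  (@codeword_separated n) c v k W).
  exact: leq_trunc_div.
have x0 : 0 <= (e + e) * 3 * (num_blocks n)%:R.
  by rewrite !mulr_ge0// ltW// addr_gt0.
by rewrite /error_budget truncn_ge_nat//; exact: ltW.
Qed.

Lemma num_messages_eventually : exists N, forall n, (N <= n)%N ->
  num_messages n = Num.truncn (expR (n%:R * r)).
Proof.
pose lq : R := ln #|{: alphabet}|%:R.
have gap : r * block_len%:R < (1 - 13 * e) * lq - ln 2 := rate_gap.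
pose g := (1 - 13 * e) * lq - ln 2 - r * block_len%:R.
have g0 : 0 < g by rewrite subr_gt0.
(* Enough blocks for e m >= 1 and for the gap g m to pay for the slots after the last complete
   block. *)
pose m0 := maxn (Num.truncn e^-1).+1 (Num.truncn (block_len%:R * r / g)).+1.
exists (m0 * block_len)%N => n Nn; apply/minn_idPr.
have mn : (m0 <= num_blocks n)%N by rewrite leq_divRL.
have [me mg] : 1 <= e * (num_blocks n)%:R /\ block_len%:R * r <= g * (num_blocks n)%:R.
  split.
    rewrite -ler_pdivrMl// mulr1 ltW// (lt_le_trans (truncnS_gt _))// ler_nat.
    exact: leq_trans (leq_maxl _ _) mn.
  rewrite -ler_pdivrMl// mulrC ltW// (lt_le_trans (truncnS_gt _))// ler_nat.
  exact: leq_trans (leq_maxr _ _) mn.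
set m := num_blocks n in me mg mn *.
have C0 : (0 < #|code_set n|)%N.
  by have := num_messages_gt0 n; rewrite leq_min => /andP[].
have lq0 : 0 <= lq by rewrite ln_ge0// ler1n alphabet_gt0.
have lnC : m%:R * lq <= ln #|code_set n|%:R + (m%:R * ln 2 + (min_distance n)%:R * lq).
  have [_ h] := code_setP n.
  have p2 : 0 < 2 ^+ m :> R by rewrite exprn_gt0.
  have q0 : 0 < #|{: alphabet}|%:R :> R by rewrite ltr0n alphabet_gt0.
  have pC : 0 < #|code_set n|%:R :> R by rewrite ltr0n.
  rewrite !mulr_natl -!lnXn// -!lnM ?posrE ?mulr_gt0 ?exprn_gt0//.
  rewrite ler_ln ?posrE ?mulr_gt0 ?exprn_gt0//.
  by rewrite -!natrX -!natrM ler_nat.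
(* The distance is at most 12 e m + 1, and 1 <= e m absorbs the last unit; hence the 13 in
   [rate_gap]. *)
have D13 : (min_distance n)%:R <= 13 * (e * m%:R).
  rewrite /min_distance -natr1 natrD.
  have : (error_budget n)%:R <= (e + e) * 3 * m%:R.
    by rewrite truncn_le !mulr_ge0// ltW// addr_gt0.
  move: me; lra.
have big : n%:R * r <= ln #|code_set n|%:R.
  have nm : n%:R <= (m%:R + 1) * block_len%:R :> R.
    by rewrite natr1 -natrM ler_nat ltnW// ltn_ceil.
  apply: (@le_trans _ _ ((m%:R + 1) * block_len%:R * r)); first exact: ler_wpM2r.
  have Dl : (min_distance n)%:R * lq <= 13 * (e * m%:R) * lq by exact: ler_wpM2r.
  have gm : g * m%:R = m%:R * lq - 13 * (e * m%:R) * lq - m%:R * ln 2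
      - m%:R * (block_len%:R * r) by rewrite /g; ring.
  have -> : (m%:R + 1) * block_len%:R * r =
      m%:R * (block_len%:R * r) + block_len%:R * r :> R by ring.
  move: mg lnC Dl; rewrite gm; lra.
rewrite -(ler_nat R); apply: (@le_trans _ _ (expR (n%:R * r))).
  by rewrite truncn_le expR_ge0.
by rewrite -[leRHS]lnK ?posrE ?ltr0n// ler_expR.
Qed.

Lemma fixed_power_achievable : DD_achievable c P (fun _ => r).
Proof.
exists the_code; split.
- exact: the_code_power.
- move=> k; have [N hN] := num_messages_eventually.
  (* Truncation loses at most a factor 2, that is ln 2 in the logarithm; the other 2 comes from n +
     1 <= 2 n. *)
  apply: (@cvg_by_rate _ _ _ (2 * ln 2) N.+1) => n Nn.
  have n0 : (0 < n)%N by exact: leq_ltn_trans Nn.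
  rewrite /= hN ?(ltnW Nn)//.
  set y := expR (n%:R * r); have y1 : 1 <= y by rewrite -expR0 ler_expR mulr_ge0.
  have y0 : 0 < y by exact: lt_le_trans y1.
  have /andP[ty yt] := truncn_itv (ltW y0).
  have t1 : 1 <= (Num.truncn y)%:R :> R by rewrite ler1n truncn_gt0.
  have t0 : 0 < (Num.truncn y)%:R :> R by exact: lt_le_trans t1.
  have lny : ln y = n%:R * r by rewrite expRK.
  have up : ln (Num.truncn y)%:R <= n%:R * r by rewrite -lny ler_ln ?posrE.
  have dn : n%:R * r <= ln (Num.truncn y)%:R + ln 2.
    rewrite -lny -lnM ?posrE// ler_ln ?posrE ?mulr_gt0// (le_trans (ltW yt))//.
    by rewrite -natr1; lra.
  have nR : 0 < n%:R :> R by rewrite ltr0n.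
  have -> : ln (Num.truncn y)%:R / n%:R - r = (ln (Num.truncn y)%:R - n%:R * r) / n%:R.
    by rewrite mulrBl [n%:R * r]mulrC mulfK// gt_eqF.
  rewrite normrM normfV (ger0_norm (ltW nR)) ler0_norm ?subr_le0// opprB.
  rewrite ler_pdivrMr// mulrAC ler_pdivlMr ?ltr0n//.
  have n1 : n.+1%:R <= 2 * n%:R :> R by rewrite -natr1; have : 1 <= n%:R :> R; [rewrite ler1n|lra].
  have ln20 : 0 <= ln 2 :> R by rewrite ln_ge0// ler1n.
  apply: (@le_trans _ _ (ln 2 * n.+1%:R)).
    by rewrite ler_wpM2r// lerBlDr addrC.
  by rewrite [leRHS]mulrC mulrA [leRHS]mulrC [n%:R * _]mulrC ler_wpM2l.
- move=> k; apply/fine_cvgP.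
  have err n : (block_len <= n)%N -> 0 <= fine (@error_prob R K n c (the_code n) k)
      <= 3 / (e ^+ 2 * (num_blocks n)%:R) /\
      @error_prob R K n c (the_code n) k \is a fin_num.
    move=> ln; have m0 : (0 < num_blocks n)%N by rewrite divn_gt0.
    have /andP[h1 h2] := the_code_error k m0.
    have fn : @error_prob R K n c (the_code n) k \is a fin_num.
      by rewrite ge0_fin_numE// (le_lt_trans h2)// ltry.
    by split => //; rewrite -!lee_fin fineK// h1 h2.
  split; first by exists block_len => // n /= /err[].
  apply: (@cvg_by_rate _ _ _ (3 * (2 * block_len%:R) / e ^+ 2) block_len) => n ln.
  have [/andP[h1 h2] _] := err n ln.
  rewrite subr0 /= ger0_norm// (le_trans h2)//.
  have m0 : (0 < num_blocks n)%N by rewrite divn_gt0.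
  have mR : 0 < (num_blocks n)%:R :> R by rewrite ltr0n.
  have e2 : 0 < e ^+ 2 by rewrite exprn_gt0.
  have -> : 3 / (e ^+ 2 * (num_blocks n)%:R) = 3 / e ^+ 2 * (num_blocks n)%:R^-1.
    by rewrite invfM mulrA.
  have -> : 3 * (2 * block_len%:R) / e ^+ 2 / n.+1%:R =
      3 / e ^+ 2 * (2 * block_len%:R / n.+1%:R) by rewrite [_ / e ^+ 2]mulrAC -!mulrA.
  apply: ler_wpM2l; first by rewrite divr_ge0// ltW.
  rewrite ler_pdivlMr ?ltr0n// mulrC ler_pdivrMr// -!natrM ler_nat.
  have := ltn_ceil n len0; rewrite -/(num_blocks n).
  move: m0; set m := num_blocks n; nia.
Qed.

End fixed_power.

(** * Counting the symbols and slots of a block *)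

Section asymptotics.
Variables (R : realType) (K : nat).
Hypothesis K0 : (0 < K)%N.
Local Notation harm := (\sum_(1 <= i < K.+1) i%:R^-1 : R).

(** The binomial(K,j) sets of size j contribute (j-1)! (K-j)! each, together K!/j. *)
Lemma sum_copies : (\sum_(S : {set 'I_K} | S != finset.set0) copies K #|S|)%:R
  = K`!%:R * harm :> R.
Proof.
rewrite big_add1 /= big_mkord mulr_sumr.
rewrite (partition_big (fun S : {set 'I_K} => inord #|S|.-1 : 'I_K.-1.+1) xpredT)//=.
rewrite natr_sum; rewrite -[in RHS](prednK K0).
apply: eq_bigr => j _; have jK : (j < K)%N by rewrite -[X in (_ < X)%N](prednK K0).
have cardlt (S : {set 'I_K}) : (#|S|.-1 < K.-1.+1)%N.
  have : (#|S| <= K)%N by rewrite -[X in (_ <= X)%N](card_ord K) max_card.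
  rewrite (prednK K0) => SK; have [->//|S0] := posnP #|S|.
  by rewrite prednK.
have -> : (\sum_(S : {set 'I_K} | (S != finset.set0) && (inord #|S|.-1 == j)) copies K #|S|)%N
    = (\sum_(S in [set S : {set 'I_K} | #|S| == j.+1]%SET) copies K j.+1)%N.
  apply: eq_big => [S|S /andP[S0 /eqP Sj]].
    rewrite inE -card_gt0 -val_eqE /= inordK ?cardlt//.
    by case: #|S|.
  by rewrite -Sj inordK ?cardlt// prednK// card_gt0.
rewrite sum_nat_const card_draws card_ord /copies /=.
have := bin_fact jK; rewrite factS => e.
rewrite (_ : (K.-1.+1)`! = K`!)%N; last by rewrite prednK.
rewrite -e !natrM; set p : R := j.+1%:R.
have p0 : p != 0 by rewrite pnatr_eq0.
by field.
Qed.

Lemma harm_gt0 : 0 < harm.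
Proof.
by rewrite big_ltn ?ltnS// invr1 ltr_pwDl// sumr_ge0.
Qed.

Lemma num_symbols1 L : num_symbols K L 1 = (K`! * L)%N.
Proof.
rewrite /num_symbols /window_eqs /copies /= mul1n mulnA subn1 prednK//.
by rewrite -[in (_ * _)%N](prednK K0) -factS prednK.
Qed.

Lemma block_lenR w : (block_len K w)%:R = w%:R * (K`!%:R * harm) :> R.
Proof. by rewrite block_lenE natrM sum_copies. Qed.

End asymptotics.

(** * Probability that a given user is unjammed *)

Section jamming_probability.
Variables (R : realType) (K : nat) (lam : K.-tuple bool -> R) (eta : 'I_K.+1 -> R).
Variables (fH fG : 'I_K -> 'rV[R[i]]_K -> R) (c : R -> channel R K).
Hypothesis K0 : (0 < K)%N.
Hypothesis sym : symmetric_jammer lam.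
Hypothesis jc : forall PT : R, 0 < PT -> jammed_miso_bc lam fH fG PT (c PT).
Hypothesis etaE : forall (PT : R) (t : nat) (j : 'I_K.+1), 0 < PT ->
  ch_prob (c PT) (chS (c PT) t @^-1` [set s : K.-tuple bool | count id s = j])
  = (eta j)%:E.

Lemma measurable_state (PT : R) t s : measurable (chS (c PT) t @^-1` [set s]).
Proof.
rewrite (_ : _ @^-1` _ = \bigcap_(r in [set: 'I_K])
    [set v | tnth (chS (c PT) t v) r = tnth s r]).
  apply: fin_bigcap_measurable; first exact: finite_finset.
  move=> r _; have := measurableT_comp (measurable_tnth (T := bool) r)
    (measurable_funPT (chS (c PT) t)).
  by move=> /(_ measurableT [set tnth s r] I); rewrite setTI.
apply/seteqP; split => v /=; first by move=> h r _ /=; rewrite h.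
by move=> h; apply: eq_from_tnth => r; exact: (h r Logic.I).
Qed.

Lemma state_probability (Q : pred (K.-tuple bool)) (PT : R) t : 0 < PT ->
  Pr (ch_prob (c PT)) [set v | Q (chS (c PT) t v)] = \sum_(s | Q s) lam s.
Proof.
move=> PT0; rewrite (Pr_finite _ _ (measurable_state PT t)).
by apply: eq_bigr => s _; rewrite /Pr (S_law (jc PT0)).
Qed.

Let jam_prob (r : 'I_K) := \sum_(s : K.-tuple bool | tnth s r) lam s.

Lemma jam_prob_sym r r' : jam_prob r = jam_prob r'.
Proof.
pose f (s : K.-tuple bool) : K.-tuple bool := [tuple tnth s (tperm r r' i) | i < K].
have ff : involutive f.
  by move=> s; apply: eq_from_tnth => i; rewrite !tnth_mktuple tpermK.
rewrite /jam_prob (reindex_inj (inv_inj ff)) /=; apply: eq_big => s.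
  by rewrite tnth_mktuple tpermL.
by move=> _; exact: sym.
Qed.

Lemma etaS j : eta j = \sum_(s : K.-tuple bool | count id s == j :> nat) lam s.
Proof.
rewrite -(state_probability (fun s => count id s == j :> nat) 0 ltr01) /Pr.
rewrite (_ : [set v | _] = chS (c 1) 0 @^-1` [set s : K.-tuple bool | count id s = j]).
  by rewrite etaE ?ltr01.
by apply/seteqP; split => v /= /eqP.
Qed.

Lemma unjammed_probability PT t r : 0 < PT ->
  Pr (ch_prob (c PT)) [set v | tnth (chS (c PT) t v) r] =
  1 - \sum_(j < K.+1) (K - j)%:R / K%:R * eta j.
Proof.
move=> PT0; rewrite (state_probability (fun s => tnth s r) t PT0) -/(jam_prob r).
have K0R : K%:R != 0 :> R by rewrite pnatr_eq0 -lt0n.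
have cK (s : K.-tuple bool) : (count id s < K.+1)%N.
  by rewrite ltnS -[X in (_ <= X)%N](size_tuple s) count_size.
have part (g : nat -> R) : \sum_(j < K.+1) g j * eta j =
    \sum_(s : K.-tuple bool) g (count id s) * lam s.
  rewrite [RHS](partition_big (fun s : K.-tuple bool => Ordinal (cK s)) xpredT)//=.
  apply: eq_bigr => j _; rewrite etaS mulr_sumr.
  apply: eq_big => [s|s /eqP <-//]; by rewrite -val_eqE.
have sum1 : \sum_(s : K.-tuple bool) lam s = 1.
  rewrite -(state_probability predT 0 ltr01) (_ : [set v | _] = setT).
    by rewrite /Pr probability_setT.
  by apply/seteqP; split.
(* By symmetry all users are jammed equally often, so both sides are the expected number of jammed
   users. *)
have sumj : K%:R * jam_prob r = \sum_(s : K.-tuple bool) (count id s)%:R * lam s.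
  rewrite mulr_natl -[X in _ *+ X](card_ord K) -sumr_const.
  rewrite (eq_bigr jam_prob) => [|r' _]; last exact: jam_prob_sym.
  rewrite /jam_prob; under eq_bigr do rewrite big_mkcond /=.
  rewrite exchange_big /=; apply: eq_bigr => s _.
  rewrite -sum1_count [X in X%:R]big_mkcond big_tuple natr_sum mulr_suml.
  by apply: eq_bigr => i _; case: (tnth s i); rewrite ?mul1r ?mul0r.
rewrite (part (fun j => (K - j)%:R / K%:R)) -[X in X - _]sum1 -sumrB.
apply: (mulfI K0R); rewrite sumj mulr_sumr; apply: eq_bigr => s _.
rewrite natrB; last by rewrite -ltnS.
by field.
Qed.

End jamming_probability.

Lemma measurable_cst_preimage d (T : measurableType d) (A : Type) (x : A) (Q : set A) :
  measurable ((fun _ : T => x) @^-1` Q).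
Proof.
have [Qx|Qx] := pselect (Q x).
  by rewrite (_ : _ @^-1` _ = setT)//; apply/seteqP; split.
by rewrite (_ : _ @^-1` _ = set0)//; apply/seteqP; split.
Qed.

Definition silent_code (R : realType) (K n : nat) : DD_code R K n :=
  @DDCode R K n (fun _ => 1%N) (fun _ => isT) (fun t _ _ => 0) (fun _ _ => ord0)
    (fun _ _ => measurable_cst _) (fun _ j => measurable_cst_preimage _ ord0 [set j]).

(** The region asks for an achievable rate at every positive power; this serves the powers below the
    threshold of the scheme. *)
Lemma zero_rate_achievable (R : realType) (K : nat) (c : channel R K) (P : R) :
  0 <= P -> DD_achievable c P (fun _ => 0).
Proof.
move=> P0; exists (silent_code R K); split.
- by move=> n t; apply: input_power_le => // W v; rewrite sqnorm0.
- move=> k; rewrite (_ : (fun n => _) = fun=> 0); first exact: cvg_cst.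
  by apply/funext => n; rewrite ln1 mul0r.
- move=> k; rewrite (_ : (fun n => _) = fun=> 0%E); first exact: cvg_cst.
  apply/funext => n; apply/eqP; rewrite eq_le andbC.
  have := @error_prob_le R K n c (silent_code R K n) k 0 _ (lexx _); apply.
  move=> W; rewrite (_ : [set v | _] = set0) ?/Pr ?measure0//.
  by apply/seteqP; split => v //=; rewrite (ord1 (W k)) eqxx.
Qed.

(** * Choice of the parameters and passage to high power *)

Section rates.
Variables (R : realType) (K : nat) (lam : K.-tuple bool -> R).
Variables (fH fG : 'I_K -> 'rV[R[i]]_K -> R) (c : R -> channel R K) (delta : R).
Hypothesis K0 : (0 < K)%N.
Hypothesis jc : forall PT : R, 0 < PT -> jammed_miso_bc lam fH fG PT (c PT).
Hypothesis Sdelta : forall PT t r, 0 < PT ->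
  Pr (ch_prob (c PT)) [set v | tnth (chS (c PT) t v) r] = 1 - delta.
Local Notation harm := (\sum_(1 <= i < K.+1) i%:R^-1 : R).

Lemma rate_achievable x : 0 <= x -> x < delta / harm ->
  exists P0, forall P, P0 <= P -> 0 < P -> DD_achievable (c P) P (fun _ => x * ln P).
Proof.
move=> x0 xd; have h0 := harm_gt0 R K0.
pose y := x * harm; have y0 : 0 <= y by rewrite mulr_ge0// ltW.
have yd : y < delta by rewrite /y -ltr_pdivlMr.
(* Three equal slacks: one for typicality of the jamming, one for rounding L down, one for the outer
   code. *)
have [eta [eta0 deltaE]] : exists eta, 0 < eta /\ delta = y + 3 * eta.
  exists ((delta - y) / 3); split; last by field.
  by rewrite divr_gt0// subr_gt0.
have yeta : 0 < y + eta by rewrite ltr_wpDl.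
have z0 : 0 < y + eta + 1 by rewrite addr_gt0.
(* Chosen so that (1 - 13 e)(y + eta) still exceeds y; the summand 1 also forces 13 e < 1. *)
have [e [e0 e13]] : exists e, 0 < e /\ 13 * e * (y + eta + 1) = eta / 2.
  exists (eta / (26 * (y + eta + 1))); split.
    by rewrite divr_gt0// mulr_gt0.
  by field; rewrite gt_eqF.
(* The first term makes atypical jamming rarer than e, the second makes one unit of rounding at most
   [eta * w]. *)
pose w := (Num.truncn ((#|{: {set 'I_K} * 'I_K}|)%:R / (eta ^+ 2 * e)) +
  Num.truncn eta^-1).+1.
have w0 : (0 < w)%N by [].
have wR : 0 < w%:R :> R by rewrite ltr0n.
have w1 : 1 <= eta * w%:R.
  rewrite -ler_pdivrMl// mulr1 ltW// (lt_le_trans (truncnS_gt _))//.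
  by rewrite ler_nat ltnS leq_addl.
have w2 : (#|{: {set 'I_K} * 'I_K}|)%:R / (eta ^+ 2 * w%:R) <= e.
  have : (#|{: {set 'I_K} * 'I_K}|)%:R / (eta ^+ 2 * e) <= w%:R.
    by rewrite ltW// (lt_le_trans (truncnS_gt _))// ler_nat ltnS leq_addr.
  rewrite !ler_pdivrMr ?mulr_gt0 ?exprn_gt0// => /le_trans; apply.
  by rewrite (_ : w%:R * _ = e * (eta ^+ 2 * w%:R))//; ring.
pose L := Num.truncn ((delta - eta) * w%:R).
have dw0 : 0 <= (delta - eta) * w%:R by rewrite mulr_ge0// deltaE; lra.
have Lw : L%:R <= (delta - eta) * w%:R by rewrite truncn_le.
have Lge : (y + eta) * w%:R <= L%:R.
  have := truncnS_gt ((delta - eta) * w%:R); rewrite -/L -natr1 deltaE.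
  move: w1; lra.
have [cg [a few]] := few_bad_blocks jc Sdelta e0 eta0 w0 Lw w2.
have len0 : (0 < block_len K w)%N.
  by rewrite -(ltr0n R) block_lenR// !mulr_gt0// ltr0n ?fact_gt0.
pose alpha := Num.sqrt ((8 * a ^+ 2 + 1) * cg.+1%:R).
have alpha_sep : 8 * a ^+ 2 < alpha ^+ 2 / cg.+1%:R.
  have a2 : 0 <= 8 * a ^+ 2 + 1 by rewrite addr_ge0// mulr_ge0// sqr_ge0.
  have c0 : cg.+1%:R != 0 :> R by rewrite pnatr_eq0.
  by rewrite sqr_sqrtr ?mulr_ge0// mulfK// ltrDl.
pose ns := num_symbols K L 1.
(* Power spent per squared lattice side, plus 1 so that kap <= kap ^+ 2: a lattice of side sqrt P /
   kap then respects the budget. *)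
pose kap := 1 + K%:R * (K%:R * ns%:R * (2 * alpha)) ^+ 2 * cg%:R.
have kap1 : 1 <= kap by rewrite lerDl mulr_ge0// mulr_ge0// sqr_ge0.
have kap0 : 0 < kap by exact: lt_le_trans kap1.
(* Coefficient of ln P in the rate gap; [B] collects the terms bounded in P, and the power threshold
   lets [G * ln P] exceed it. *)
pose G := (1 - 13 * e) * ns%:R - x * (block_len K w)%:R.
have G0 : 0 < G.
  rewrite subr_gt0 /ns num_symbols1// block_lenR// natrM.
  rewrite (_ : x * _ = K`!%:R * (y * w%:R)); last by rewrite /y; ring.
  rewrite [ltRHS]mulrCA ltr_pM2l ?ltr0n ?fact_gt0//.
  have e1 : 0 < 1 - 13 * e.
    rewrite subr_gt0 -(ltr_pM2r z0) e13; move: y0 eta0; lra.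
  apply: (@lt_le_trans _ _ ((1 - 13 * e) * ((y + eta) * w%:R))); last first.
    by rewrite ler_pM2l.
  rewrite mulrA ltr_pM2r//; move: e13 eta0 e0; lra.
pose B := (1 - 13 * e) * (ns%:R * (2 * ln (2 * kap))) + ln 2.
exists (Num.max (kap ^+ 2) (expR ((B + 1) / G))) => P.
rewrite ge_max => /andP[Pkap PB] Pgt0.
have lnP : B + 1 <= G * ln P.
  by rewrite -ler_pdivrMl// mulrC -ler_expR lnK.
have sP : kap <= Num.sqrt P.
  by rewrite -[kap]ger0_norm ?(ltW kap0)// -sqrtr_sqr ler_wsqrtr.
have sP0 : 0 < Num.sqrt P by exact: lt_le_trans sP.
pose Q := Num.truncn (Num.sqrt P / kap).
have ratio1 : 1 <= Num.sqrt P / kap by rewrite ler_pdivlMr// mul1r.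
have Q0 : (0 < Q)%N by rewrite truncn_gt0.
have Q1 : 1 <= Q%:R :> R by rewrite ler1n.
have Qle : Q%:R * kap <= Num.sqrt P.
  by rewrite -ler_pdivlMr// truncn_le divr_ge0// ltW.
have Qge : Num.sqrt P <= Q%:R * (2 * kap).
  have := truncnS_gt (Num.sqrt P / kap); rewrite -/Q -natr1 ltr_pdivrMr// => /ltW.
  by move=> /le_trans; apply; rewrite mulrCA mulrA ler_pM2r//; move: Q1; lra.
apply: (@fixed_power_achievable R K w L (c P) cg Q a e alpha P (x * ln P)) => //.
- exact: sqrtr_ge0.
- exact: ltW.
- apply: mulr_ge0 => //; apply: ln_ge0; apply: le_trans Pkap.
  by rewrite expr_ge1// ltW.
- by move=> m m0; exact: few.
- apply: (@le_trans _ _ ((Q%:R * kap) ^+ 2)); last first.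
    rewrite -[leRHS]sqr_sqrtr ?(ltW Pgt0)// ler_pXn2r// nnegrE ?(ltW sP0)//.
    by rewrite mulr_ge0// ltW.
  rewrite -/ns (_ : _ * cg%:R = Q%:R ^+ 2 *
    (K%:R * (K%:R * ns%:R * (2 * alpha)) ^+ 2 * cg%:R)); last by ring.
  rewrite [leRHS]exprMn ler_wpM2l ?sqr_ge0//.
  apply: (@le_trans _ _ kap); first by rewrite lerDr.
  by rewrite expr2 ler_peMl// ltW.
rewrite card_ffun card_prod !card_ord -/ns natrX natrM lnXn ?mulr_gt0 ?ltr0n//.
rewrite lnM ?posrE ?ltr0n// -[_ *+ ns]mulr_natl.
have lnQ : ln P <= 2 * ln Q%:R + 2 * ln (2 * kap).
  rewrite -mulrDr -lnM ?posrE ?ltr0n ?mulr_gt0// mulr_natl -lnXn ?mulr_gt0 ?ltr0n//.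
  rewrite ler_ln ?posrE ?exprn_gt0 ?mulr_gt0 ?ltr0n//.
  rewrite -[leLHS]sqr_sqrtr ?(ltW Pgt0)// ler_pXn2r// nnegrE ?(ltW sP0)//.
  by rewrite !mulr_ge0// ltW.
have e1 : 0 <= (1 - 13 * e) * ns%:R.
  rewrite mulr_ge0// subr_ge0 ltW// -(ltr_pM2r z0) e13; move: y0 eta0; lra.
have := ler_wpM2l e1 lnQ.
move: lnP; rewrite /G /B; lra.
Qed.

End rates.

(** For each power, x is taken within 1/P of the supremum of the achievable values in [0, d]. This
    supremum eventually exceeds every x < d, so the choice converges to d although no single
    threshold serves all x. *)
Lemma dof_of_rates (R : realType) (K : nat) (c : R -> channel R K) (d : R) :
  0 <= d -> (forall P, 0 < P -> DD_achievable (c P) P (fun _ => 0)) ->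
  (forall x, 0 <= x -> x < d -> exists P0, forall P, P0 <= P -> 0 < P ->
     DD_achievable (c P) P (fun _ => x * ln P)) ->
  DD_dof_region c (fun _ => d).
Proof.
move=> d0 ach0 achx.
pose E P := [set x : R | 0 <= x <= d /\ DD_achievable (c P) P (fun _ => x * ln P)].
have E0 P : 0 < P -> E P 0.
  by move=> P0; split; rewrite ?lexx ?d0//= mul0r; exact: ach0.
have supE P : 0 < P -> has_sup (E P).
  by move=> P0; split; [exists 0; exact: E0|exists d => x [/andP[]]].
have /choice[f hf] : forall P, exists x, 0 < P -> E P x /\ sup (E P) - P^-1 < x.
  move=> P; have [P0|P0] := ltP 0 P; last by exists 0.
  have iP : 0 < P^-1 by rewrite invr_gt0.
  by have [x Ex xs] := sup_adherent iP (supE P P0); exists x.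
exists (fun P _ => f P * ln P); split.
  by move=> P P0; have [[_ ?] _] := hf P P0.
move=> k.
suff cv : f P @[P --> +oo] --> d.
  apply: cvg_trans cv; apply: near_eq_cvg; near=> P.
  by rewrite mulfK// gt_eqF// ln_gt0.
apply/cvgrPdist_le => e e0.
(* The maximum keeps x nonnegative when e is large compared with d; if then d = 0, the zero rate
   takes over. *)
pose x := Num.max 0 (d - e / 2).
have [P0 hP0] : exists P0, forall P, P0 <= P -> 0 < P -> E P x.
  have [xd|xd] := ltP x d.
    have x0 : 0 <= x by rewrite le_max lexx.
    have [P0 h] := achx x x0 xd; exists P0 => P PP P1.
    by split; [rewrite x0 ltW|exact: h].
  exists 0 => P _ P1; have -> : x = 0; last exact: E0.
  move: xd; rewrite /x le_max => /orP[d0'|]; last by lra.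
  by apply/max_idPl; lra.
near=> P.
have P1 : 0 < P by [].
have [[/andP[f0 fd] _] fs] := hf P P1.
have xs : x <= sup (E P).
  by apply: sup_ubound; [exact: (supE P P1).2|apply: hP0].
have dx : d - e / 2 <= x by rewrite le_max lexx orbT.
have Pe : P^-1 <= e / 2.
  by rewrite -[e / 2]invrK lef_pV2 ?posrE ?invr_gt0 ?divr_gt0//.
rewrite ger0_norm ?subr_ge0//; lra.
Unshelve. all: by end_near. Qed.

Unset Implicit Arguments.

Theorem theorem11 (R : realType) (K : nat)
    (lam : K.-tuple bool -> R) (eta : 'I_K.+1 -> R)
    (fH fG : 'I_K -> 'rV[R[i]]_K -> R) (c : R -> channel R K) :
  (0 < K)%N ->
  symmetric_jammer lam ->
  (forall PT : R, 0 < PT -> jammed_miso_bc lam fH fG PT (c PT)) ->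
  (forall (PT : R) (t : nat) (j : 'I_K.+1), 0 < PT ->
     ch_prob (c PT) (chS (c PT) t @^-1` [set s : K.-tuple bool | count id s = j])
     = (eta j)%:E) ->
  exists2 d : 'I_K -> R, DD_dof_region c d &
    \sum_(k < K) d k =
    (\sum_(j < K.+1) (K - j)%:R / K%:R * eta j)
    * (K%:R / \sum_(1 <= i < K.+1) i%:R^-1).
Proof.
move=> K0 sym jc etaE.
pose delta := \sum_(j < K.+1) (K - j)%:R / K%:R * eta j.
have Sdelta PT t r : 0 < PT ->
    Pr (ch_prob (c PT)) [set v | tnth (chS (c PT) t v) r] = 1 - delta.
  exact: (unjammed_probability K0 sym jc etaE).
have h0 := harm_gt0 R K0.
have delta0 : 0 <= delta.
  have mS t : measurable_fun setT (chS (c 1) t) by [].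
  have := Pr_le1 (ch_prob (c 1)) (measurable_jammed mS 0 (Ordinal K0)).
  by rewrite Sdelta// lerBlDr lerDl.
exists (fun=> delta / \sum_(1 <= i < K.+1) i%:R^-1).
  apply: dof_of_rates; first by rewrite divr_ge0// ltW.
    by move=> P P0; apply: zero_rate_achievable; exact: ltW.
  move=> x x0 xd; exact: (rate_achievable K0 jc Sdelta x0 xd).
rewrite sumr_const card_ord -/delta -[LHS]mulr_natl mulrCA.
by [].
Qed.
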